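(* Let $\alpha\ge -1$ and let $\varphi:\mathbb{D}\to\mathbb{D}$ be a Schur function. Then there exist constants $c>0$ and $0<r<1$ such that the approximation numbers of the composition operator $C_\varphi:\mathfrak{B}_\alpha\to\mathfrak{B}_\alpha$ satisfy $$a_n(C_\varphi)\ \ge\ c\,r^n,\qquad n=1,2,\ldots$$ More precisely, $\beta(C_\varphi)\ge[\varphi]^2$, and hence for each $\kappa$ with $0<\kappa<[\varphi]$ there exists a constant $c_\kappa>0$ such that $a_n(C_\varphi)\ge c_\kappa\,\kappa^{2n}$ for all $n\ge1$.
   Context: $\mathbb{D}$ is the open unit disk with normalized area measure $dA=\frac{dx\,dy}{\pi}$. For $\alpha>-1$, $\mathfrak{B}_\alpha$ is the weighted Bergman space of analytic functions $f$ on $\mathbb{D}$ with $\|f\|_\alpha^2=(\alpha+1)\int_{\mathbb{D}}|f(z)|^2(1-|z|^2)^\alpha\,dA(z)<\infty$; for $\alpha=-1$, $\mathfrak{B}_{-1}=H^2$ is the Hardy space with $\|\sum a_nz^n\|^2=\sum|a_n|^2$. A Schur function is a non-constant analytic map $\varphi:\mathbb{D}\to\mathbb{D}$; $C_\varphi f=f\circ\varphi$ (always bounded on $\mathfrak{B}_\alpha$). For a bounded operator $T$ between Hilbert spaces, $a_n(T)=\inf\{\|T-R\|:\ \operatorname{rank}R<n\}$, $n\ge1$, and $\beta(T)=\liminf_{n\to\infty}[a_n(T)]^{1/n}$. The pseudo-hyperbolic derivative is $\varphi^{\#}(z)=\frac{|\varphi'(z)|(1-|z|^2)}{1-|\varphi(z)|^2}$,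 and $[\varphi]=\sup_{z\in\mathbb{D}}\varphi^{\#}(z)$. *)

(* Defs.v *)
(* MathComp-Analysis, over the complex numbers R[i] for R : realType. *)
From HB Require Import structures.
From mathcomp Require Import all_boot all_order all_algebra.
From mathcomp Require Import all_classical all_reals all_analysis.
From mathcomp Require Import complex.

Set Implicit Arguments.
Unset Strict Implicit.
Unset Printing Implicit Defensive.

Import Order.TTheory GRing.Theory Num.Theory.
Import numFieldNormedType.Exports.

Local Open Scope ring_scope.
Local Open Scope classical_set_scope.
Local Open Scope complex_scope.

(* R[i] carries no topology in the library; this gives it the one induced by
   its modulus, as for an abstract numFieldType. *)
HB.instance Definition _ (R : realType) := NormedModule.copy R[i] R[i]^o.

(* A space is given by its underlying set H inside an ambient lmodType W and
   its norm.  Operators are maps W -> W of which only the values on H matter.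
   Norms take values in \bar R, with value +oo for "infinite norm", so that
   the suprema and infima below exist without side conditions. *)
Section approximation_numbers.
Variables (R : realType) (W : lmodType R[i]).
Variables (H : set W) (nrm : W -> \bar R).
Implicit Types (S T : W -> W) (n : nat).

Definition operator_norm T : \bar R :=
  ereal_sup [set nrm (T f) | f in [set f | H f /\ (nrm f <= 1)%E]].

Definition bounded_operator T : Prop :=
  [/\ forall f, H f -> H (T f),
      forall (a : R[i]) f g, H f -> H g -> T (a *: f + g) = a *: T f + T g
    & (operator_norm T < +oo)%E].

Definition rank_lt T n : Prop :=
  exists k (e : 'I_k -> W), (k < n)%N /\
    forall f, H f -> exists a : 'I_k -> R[i], T f = \sum_(i < k) a i *: e i.

Definition approx_number T n : \bar R :=
  ereal_inf [set operator_norm (fun f => T f - S f) |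
             S in [set S | bounded_operator S /\ rank_lt S n]].

(* The term of index n = 0 is irrelevant for the lower limit. *)
Definition approx_rate T : \bar R :=
  limn_einf (fun n => (approx_number T n `^ n%:R^-1)%E).

End approximation_numbers.

Section analytic_functions.
Variable R : realType.
Local Notation C := R[i].
Local Notation modulus := (@Normc.normc R).
Implicit Types (f phi : C -> C) (z : C).

Definition disk : set C := [set z | modulus z < 1].

Definition has_expansion f (a : C) (c : nat -> C) : Prop :=
  \forall z \near a, series (fun n => c n * (z - a) ^+ n) @ \oo --> f z.

Definition analytic_on (U : set C) f : Prop :=
  forall a, U a -> exists c, has_expansion f a c.

(* For f analytic near 0 the sequence c is unique. *)
Definition taylor_coef f : nat -> C := get (has_expansion f 0).

Definition hardy_norm f : \bar R :=
  ((\sum_(0 <= n <oo) (modulus (taylor_coef f n) ^+ 2)%:E) `^ 2^-1)%E.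

(* The factor pi^-1 is the normalization of the area measure. *)
Definition bergman_integral (alpha : R) f : \bar R :=
  ((pi^-1)%:E *
   \int[(@lebesgue_measure R \x @lebesgue_measure R)%E]_(p in
     [set p : R * R | disk (p.1 +i* p.2)])
     (modulus (f (p.1 +i* p.2)) ^+ 2 *
      (1 - modulus (p.1 +i* p.2) ^+ 2) `^ alpha)%:E)%E.

Definition space_norm (alpha : R) f : \bar R :=
  if alpha == -1 then hardy_norm f
  else (((alpha + 1)%:E * bergman_integral alpha f) `^ 2^-1)%E.

(* A function on the disk is represented by its extension by 0 to R[i], which
   makes the representation unique. *)
Definition bergman_space (alpha : R) : set (C -> C) :=
  [set f | [/\ analytic_on disk f, (forall z, ~ disk z -> f z = 0)
             & (space_norm alpha f < +oo)%E]].

(* The values of phi outside the disk are irrelevant. *)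
Definition schur phi : Prop :=
  [/\ analytic_on disk phi, (forall z, disk z -> disk (phi z))
    & ~ exists c : C, forall z, disk z -> phi z = c].

Definition comp_op phi (f : C -> C) : C -> C :=
  fun z => if z \in disk then f (phi z) else 0.

Definition pseudo_hyperbolic_derivative phi z : R :=
  modulus (phi^`() z) * (1 - modulus z ^+ 2) / (1 - modulus (phi z) ^+ 2).

Definition pseudo_hyperbolic_sup phi : \bar R :=
  ereal_sup [set (pseudo_hyperbolic_derivative phi z)%:E | z in disk].

Definition comp_approx_number (alpha : R) phi (n : nat) : \bar R :=
  approx_number (bergman_space alpha) (space_norm alpha) (comp_op phi) n.

Definition comp_approx_rate (alpha : R) phi : \bar R :=
  approx_rate (bergman_space alpha) (space_norm alpha) (comp_op phi).

End analytic_functions.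

(* Main.v *)
Require Import Defs.
From mathcomp Require Import all_boot all_order all_algebra.
From mathcomp Require Import fingroup perm cyclic separable cyclotomic spectral.
From mathcomp Require Import all_classical all_reals all_analysis.
From mathcomp Require Import measurable_realfun complex.
From mathcomp Require Import ring lra zify.

(** The lower bound comes from a determinant. Let [a] be a point of the disk and
    [s] the pseudo-hyperbolic derivative of [phi] at [a]. The functions
    [mobius (phi a) ^+ k], composed with [phi] and read in the coordinate
    [mobius (- a)], are the powers [h ^+ k] of a function [h] with [h 0 = 0] and
    [|h' 0| = s]. Hence their Taylor coefficients of index [j] form a triangular
    matrix with diagonal [1, h' 0, h' 0 ^+ 2, ...], and for [k, j < 2 n] its
    determinant has modulus [s ^+ (n (2 n - 1))], up to the normalization of the
    test functions ([det_functional]). If an operator [S] of rank less than [n]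
    is at distance [e] from the composition operator, the same matrix is the
    sum of a matrix of rank less than [n] and of a matrix of size [O (e)], up to
    a polynomial in [n]. In an orthonormal basis adapted to the kernel of the
    former, at least [n] rows are of size [O (e)], so that the determinant is at
    most [(poly n * e) ^+ n] ([det_low_rank]). Comparing the two gives
    [e >= s ^+ (2 n) / poly n] ([approximation_bound]), and the polynomial is
    absorbed by replacing [s] by any [kappa < s].

    Only two properties of the space are used: point evaluations grow at most
    polynomially at the boundary, which makes the Taylor coefficients of index
    [j] functionals of norm polynomial in [j] by Cauchy's estimates, and bounded
    analytic functions belong to the space ([growth_bound],
    [contains_bounded]). For the Hardy space the second one is a discrete form
    of Parseval's identity. For the Bergman spaces the first one is the area
    mean value inequality ([area_submean]), and the second one the
    integrability of the weight ([weight_integral]).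

    The complex analysis is developed without integration along curves. A
    function is called smooth at a point when it has asymptotic polynomial
    expansions of all orders there, a property which is clearly stable under
    composition. The maximum principle for such functions only uses the
    expansion of order three at a maximum point. Averaging over roots of unity
    isolates one Taylor coefficient, and the maximum principle applied to the
    average divided by [z ^+ n] gives Cauchy's estimates ([cauchy_estimate]).
    They imply that the Taylor series converges on every disk of smoothness,
    so that smooth functions on the disk are exactly the analytic ones
    ([analytic_on_diskP]). *)

Set Implicit Arguments.
Unset Strict Implicit.
Unset Printing Implicit Defensive.

Import Order.TTheory GRing.Theory Num.Theory.
Import numFieldNormedType.Exports.

Local Open Scope ring_scope.
Local Open Scope classical_set_scope.
Local Open Scope complex_scope.

Local Notation modulus := (@Normc.normc _).

(** * Modulus and polynomial approximation *)

Section modulus.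
Variable R : realType.
Local Notation C := R[i].
Implicit Types z w : C.

Lemma modulus_ge0 z : 0 <= modulus z.
Proof. by case: z => a b; exact: sqrtr_ge0. Qed.

Lemma normE z : `|z| = (modulus z)%:C.
Proof. by []. Qed.

Lemma modulusM z w : modulus (z * w) = modulus z * modulus w.
Proof. exact: Normc.normcM. Qed.

Lemma modulus0 : modulus (0 : C) = 0. Proof. exact: Normc.normc0. Qed.
Lemma modulus1 : modulus (1 : C) = 1. Proof. exact: Normc.normc1. Qed.

Lemma modulusX z n : modulus (z ^+ n) = modulus z ^+ n.
Proof. by elim: n => [|n IH]; rewrite ?expr0 ?modulus1// !exprS modulusM IH. Qed.

Lemma modulusV z : modulus z^-1 = (modulus z)^-1.
Proof. exact: Normc.normcV. Qed.

Lemma modulusN z : modulus (- z) = modulus z.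
Proof. by case: z => a b /=; rewrite !sqrrN. Qed.

Lemma modulusD z w : modulus (z + w) <= modulus z + modulus w.
Proof. by have := ler_normD z w; rewrite !normE -rmorphD lecR. Qed.

Lemma modulusB z w : modulus (z - w) <= modulus z + modulus w.
Proof. by rewrite -(modulusN w) modulusD. Qed.

Lemma modulus_distC z w : modulus (z - w) = modulus (w - z).
Proof. by rewrite -modulusN opprB. Qed.

Lemma modulus_lip z w : `|modulus z - modulus w| <= modulus (z - w).
Proof.
rewrite ler_norml; apply/andP; split.
  have := modulusB z (z - w); rewrite subKr; lra.
have := modulusD w (z - w); rewrite [w + _]addrC subrK; lra.
Qed.

Lemma modulus_eq0 z : (modulus z == 0) = (z == 0).
Proof.
by apply/eqP/eqP => [/Normc.eq0_normc //|->]; rewrite modulus0.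
Qed.

Lemma modulus_gt0 z : (0 < modulus z) = (z != 0).
Proof. by rewrite lt_neqAle modulus_ge0 andbT eq_sym modulus_eq0. Qed.

Lemma modulus_real (x : R) : modulus x%:C = `|x|.
Proof. by rewrite /= expr0n addr0 sqrtr_sqr. Qed.

Lemma modulus_nat n : modulus (n%:R : C) = n%:R.
Proof.
have -> : (n%:R : C) = (n%:R)%:C by rewrite rmorph_nat.
by rewrite modulus_real normr_nat.
Qed.

Lemma modulus_sum (I : Type) (s : seq I) (P : pred I) (F : I -> C) :
  modulus (\sum_(i <- s | P i) F i) <= \sum_(i <- s | P i) modulus (F i).
Proof.
elim/big_rec2: _ => [|i y x _ h]; first by rewrite modulus0.
by apply: le_trans (modulusD _ _) _; rewrite lerD2l.
Qed.

Lemma modulus_prod (I : Type) (s : seq I) (P : pred I) (F : I -> C) :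
  modulus (\prod_(i <- s | P i) F i) = \prod_(i <- s | P i) modulus (F i).
Proof.
by elim/big_rec2: _ => [|i y x _ h]; rewrite ?modulus1// modulusM h.
Qed.

Lemma sqr_modulus z : modulus z ^+ 2 = complex.Re z ^+ 2 + complex.Im z ^+ 2.
Proof. by case: z => a b /=; rewrite sqr_sqrtr// addr_ge0// sqr_ge0. Qed.

Lemma mul_conj z : z * z^*%C = (modulus z ^+ 2)%:C.
Proof. by rewrite sqr_modulus; case: z => a b; simpc; congr (_ +i* _); ring. Qed.

Lemma modulus_conj z : modulus z^*%C = modulus z.
Proof. by case: z => a b /=; rewrite sqrrN. Qed.

Lemma Re_le_modulus z : complex.Re z <= modulus z.
Proof.
by case: z => a b /=; apply: le_trans (ler_norm a) _; rewrite -sqrtr_sqr ler_wsqrtr// lerDl sqr_ge0.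
Qed.

Lemma normRe_le_modulus z : `|complex.Re z| <= modulus z.
Proof.
by case: z => a b /=; rewrite -sqrtr_sqr ler_wsqrtr// lerDl sqr_ge0.
Qed.

Lemma normIm_le_modulus z : `|complex.Im z| <= modulus z.
Proof.
by case: z => a b /=; rewrite -sqrtr_sqr ler_wsqrtr// lerDr sqr_ge0.
Qed.

Lemma ReD z w : complex.Re (z + w) = complex.Re z + complex.Re w.
Proof. by case: z w => a b [c d]. Qed.

Lemma ReB z w : complex.Re (z - w) = complex.Re z - complex.Re w.
Proof. by case: z w => a b [c d]. Qed.

Lemma modulus_horner_bound (P : {poly C}) (B : R) : exists2 K,
  0 <= K & forall w, modulus w <= B -> modulus P.[w] <= K.
Proof.
exists (\sum_(i < size P) modulus P`_i * `|B| ^+ i) => [|w wB].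
  by apply: sumr_ge0 => i _; rewrite mulr_ge0 ?modulus_ge0 ?exprn_ge0.
rewrite horner_coef; apply: le_trans (modulus_sum _ _ _) _; apply: ler_sum => i _.
rewrite modulusM modulusX ler_wpM2l ?modulus_ge0//.
by apply: lerXn2r; rewrite ?nnegrE ?modulus_ge0// (le_trans wB) ?ler_norm.
Qed.

End modulus.

(** * Asymptotic Taylor expansions *)

Section jets.
Variable R : realType.
Local Notation C := R[i].
Implicit Types (f g : C -> C) (p z w : C) (P Q : {poly C}).

(** The polynomial [P] is not required to have degree less than [n]: this is
    what makes expansions compatible with products and compositions as they
    stand. *)
Definition expands f p n P := exists K d : R, 0 < d /\
  forall w, modulus w < d -> modulus (f (p + w) - P.[w]) <= K * modulus w ^+ n.

(** Analyticity in a form that is stable under composition without any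
    manipulation of series: an asymptotic expansion of every order.  On an
    open set it is equivalent to being the sum of a power series near every
    point, see [smooth_has_expansion]. *)
Definition smooth f p := forall n, exists P, expands f p n P.

Lemma expandsP f p n P : expands f p n P -> exists K d : R,
  [/\ 0 < K, 0 < d, d <= 1 & forall w, modulus w < d ->
    modulus (f (p + w) - P.[w]) <= K * modulus w ^+ n].
Proof.
move=> [K [d [d0 h]]]; exists (`|K| + 1), (Num.min d 1); split => [| | |w].
- by rewrite ltr_wpDl.
- by rewrite lt_min d0 ltr01.
- by rewrite ge_min lexx orbT.
rewrite lt_min => /andP[/h wd _]; apply: (le_trans wd).
rewrite ler_wpM2r ?exprn_ge0 ?modulus_ge0// (le_trans (ler_norm _))// lerDl//.
Qed.

Lemma expandsW f p m n P : (m <= n)%N -> expands f p n P -> expands f p m P.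
Proof.
move=> mn /expandsP[K [d [K0 d0 d1 h]]]; exists K, d; split=> // w wd.
apply: le_trans (h _ wd) _; rewrite ler_wpM2l ?(ltW K0)//.
by apply: (ler_wiXn2l (modulus_ge0 w) _ mn); apply: ltW; apply: lt_le_trans d1.
Qed.

Lemma expands_eq_near f g p n P (d : R) : 0 < d ->
  (forall w, modulus w < d -> f (p + w) = g (p + w)) ->
  expands f p n P -> expands g p n P.
Proof.
move=> d0 fg [K [e [e0 h]]]; exists K, (Num.min d e); split.
  by rewrite lt_min d0 e0.
by move=> w; rewrite lt_min => /andP[/fg <- /h].
Qed.

Lemma expandsD f g p n P Q : expands f p n P -> expands g p n Q ->
  expands (fun z => f z + g z) p n (P + Q).
Proof.
move=> [K [d [d0 h]]] [K' [d' [d'0 h']]]; exists (K + K'), (Num.min d d'); split.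
  by rewrite lt_min d0 d'0.
move=> w; rewrite lt_min => /andP[/h hw /h' h'w].
rewrite hornerD opprD addrACA mulrDl; apply: le_trans (modulusD _ _) _.
exact: lerD.
Qed.

(** From [f g - P Q = (f - P) g + P (g - Q)]. *)
Lemma expandsM f g p n P Q : expands f p n P -> expands g p n Q ->
  expands (fun z => f z * g z) p n (P * Q).
Proof.
move=> /expandsP[K [d [K0 d0 d1 h]]] /expandsP[K' [d' [K'0 d'0 d'1 h']]].
have [A A0 hA] := modulus_horner_bound P 1.
have [B B0 hB] := modulus_horner_bound Q 1.
exists (K * (K' + B) + A * K'), (Num.min d d'); split.
  by rewrite lt_min d0 d'0.
move=> w; rewrite lt_min => /andP[wd wd'].
have w1 : modulus w <= 1 by apply: ltW; apply: lt_le_trans d1.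
have gB : modulus (g (p + w)) <= K' + B.
  rewrite -(subrK (Q.[w]) (g _)); apply: le_trans (modulusD _ _) _.
  apply: lerD (hB _ w1); apply: le_trans (h' _ wd') _.
  by rewrite ler_piMr ?(ltW K'0)// exprn_ile1 ?modulus_ge0.
rewrite hornerM.
have -> : f (p + w) * g (p + w) - P.[w] * Q.[w] =
  (f (p + w) - P.[w]) * g (p + w) + P.[w] * (g (p + w) - Q.[w]) by ring.
apply: le_trans (modulusD _ _) _; rewrite !modulusM mulrDl; apply: lerD.
  rewrite mulrAC; apply: ler_pM; rewrite ?modulus_ge0//; exact: h.
by rewrite -mulrA; apply: ler_pM; rewrite ?modulus_ge0//; [exact: hA|exact: h'].
Qed.

Lemma expandsN f p n P : expands f p n P -> expands (fun z => - f z) p n (- P).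
Proof.
move=> [K [d [d0 h]]]; exists K, d; split=> // w /h.
by rewrite hornerN -opprD modulusN.
Qed.

Lemma expands_id p n : expands id p n ('X + p%:P).
Proof.
exists 0, 1; split=> // w _.
by rewrite hornerD hornerX hornerC [w + p]addrC subrr modulus0 mul0r.
Qed.

Lemma expands_cst c p n : expands (fun=> c) p n c%:P.
Proof. by exists 0, 1; split=> // w _; rewrite hornerC subrr modulus0 mul0r. Qed.

Lemma expandsX f p n P k : expands f p n P ->
  expands (fun z => f z ^+ k) p n (P ^+ k).
Proof.
move=> h; elim: k => [|k IH].
  have := expands_cst 1 p n.
  by congr (expands _ _ _ _).
under eq_fun do rewrite exprS; rewrite exprS.
exact: expandsM.
Qed.

Lemma expands_sum (I : Type) (s : seq I) (F : I -> C -> C) p n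
    (P : I -> {poly C}) : (forall i, expands (F i) p n (P i)) ->
  expands (fun z => \sum_(i <- s) F i z) p n (\sum_(i <- s) P i).
Proof.
move=> h; elim: s => [|i s IH].
  rewrite big_nil; under eq_fun do rewrite big_nil.
  exact: expands_cst.
rewrite big_cons; under eq_fun do rewrite big_cons.
exact: expandsD.
Qed.

Lemma expandsZ f p n P c : expands f p n P ->
  expands (fun z => c * f z) p n (c *: P).
Proof. by rewrite -mul_polyC => h; apply: expandsM h; exact: expands_cst. Qed.

Lemma expands_value f p n P : expands f p n.+1 P -> f p = P`_0.
Proof.
move=> /expandsP[K [d [K0 d0 d1 /(_ 0)]]].
rewrite modulus0 => /(_ d0); rewrite expr0n mulr0 addr0 -horner_coef0 => h.
by apply/eqP; rewrite -subr_eq0 -modulus_eq0 eq_le h modulus_ge0.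
Qed.

Lemma expands_lipschitz f p n P : expands f p n.+1 P -> exists K d : R,
  [/\ 0 < K, 0 < d & forall w, modulus w < d ->
    modulus (f (p + w) - f p) <= K * modulus w].
Proof.
move=> h; have fp := expands_value h; move: h => /expandsP[K [d [K0 d0 d1 h]]].
have [Q PQ] : exists Q, P = Q * 'X + (f p)%:P.
  by exists (\poly_(i < (size P).-1) P`_i.+1); apply/polyP => -[|i];
     rewrite coefD coefMX coefC /= ?add0r // coef_poly addr0; case: ltnP => // hi;
     rewrite nth_default // -[size P]/(size P); case: (size P) hi.
have [B B0 hB] := modulus_horner_bound Q 1.
exists (K + B), d; split=> [||w wd] //; first by rewrite ltr_pwDl.
have w1 : modulus w <= 1 by apply: ltW; apply: lt_le_trans d1.
have -> : f (p + w) - f p = (f (p + w) - P.[w]) + Q.[w] * w.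
  by rewrite PQ !hornerE; ring.
apply: le_trans (modulusD _ _) _; rewrite mulrDl modulusM; apply: lerD.
  apply: le_trans (h _ wd) _; rewrite ler_pM2l// exprS ler_piMr ?modulus_ge0//.
  by rewrite exprn_ile1 ?modulus_ge0.
by rewrite ler_wpM2r ?modulus_ge0// hB.
Qed.

(** Substituting the expansion [Q] of the inner function in the expansion of
    the outer one: [Q - Q`_0] is the expansion of the increment. *)
Lemma expands_comp f g p n P Q : expands g p n.+1 Q -> expands f (g p) n.+1 P ->
  expands (f \o g) p n.+1 (P \Po (Q - (Q`_0)%:P)).
Proof.
move=> gQ fP.
have [L [e [L0 e0 hL]]] := expands_lipschitz gQ.
have gp : g p = Q`_0 by exact: expands_value gQ.
have incr : expands (fun z => g z - g p) p n.+1 (Q - (Q`_0)%:P).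
  by rewrite -gp; apply: expandsD gQ _; apply: expandsN; exact: expands_cst.
have [K1 [d1 [d10 h1]]] : expands (fun z => P.[g z - g p]) p n.+1
    (P \Po (Q - (Q`_0)%:P)).
  rewrite comp_polyE; under eq_fun do rewrite horner_coef.
  by apply: expands_sum => i; apply: expandsZ; exact: expandsX.
move: fP => /expandsP[K [d [K0 d0 _ h]]].
exists (K * L ^+ n.+1 + K1), (Num.min (Num.min e d1) (d / L)); split.
  by rewrite !lt_min e0 d10 divr_gt0.
move=> w; rewrite !lt_min => /andP[/andP[we wd1] wd].
have -> : (f \o g) (p + w) - (P \Po (Q - (Q`_0)%:P)).[w] =
   (f (g p + (g (p + w) - g p)) - P.[g (p + w) - g p]) +
   (P.[g (p + w) - g p] - (P \Po (Q - (Q`_0)%:P)).[w]).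
  by rewrite /= [g p + _]addrC subrK addrA subrK.
apply: le_trans (modulusD _ _) _; rewrite mulrDl; apply: lerD; last exact: h1.
have gw := hL _ we.
apply: le_trans (h _ _) _.
  by apply: le_lt_trans gw _; rewrite mulrC -ltr_pdivlMr.
rewrite -mulrA ler_pM2l// -exprMn.
by apply: lerXn2r; rewrite ?nnegrE ?modulus_ge0 ?mulr_ge0 ?modulus_ge0 ?(ltW L0).
Qed.

Lemma smooth_eq_near f g p (d : R) : 0 < d ->
  (forall w, modulus w < d -> f (p + w) = g (p + w)) ->
  smooth f p -> smooth g p.
Proof. by move=> d0 fg sf n; have [P hP] := sf n; exists P; exact: expands_eq_near d0 fg hP. Qed.

Lemma smoothD f g p : smooth f p -> smooth g p -> smooth (fun z => f z + g z) p.
Proof.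
by move=> sf sg n; have [P ?] := sf n; have [Q ?] := sg n; exists (P + Q); exact: expandsD.
Qed.

Lemma smoothM f g p : smooth f p -> smooth g p -> smooth (fun z => f z * g z) p.
Proof.
by move=> sf sg n; have [P ?] := sf n; have [Q ?] := sg n; exists (P * Q); exact: expandsM.
Qed.

Lemma smoothN f p : smooth f p -> smooth (fun z => - f z) p.
Proof. by move=> sf n; have [P ?] := sf n; exists (- P); exact: expandsN. Qed.

Lemma smoothB f g p : smooth f p -> smooth g p -> smooth (fun z => f z - g z) p.
Proof. by move=> sf sg; apply: smoothD => //; exact: smoothN. Qed.

Lemma smoothX f p k : smooth f p -> smooth (fun z => f z ^+ k) p.
Proof. by move=> sf n; have [P ?] := sf n; exists (P ^+ k); exact: expandsX. Qed.

Lemma smooth_cst c p : smooth (fun=> c) p.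
Proof. by move=> n; exists c%:P; exact: expands_cst. Qed.

Lemma smooth_id p : smooth id p.
Proof. by move=> n; exists ('X + p%:P); exact: expands_id. Qed.

Lemma smooth_sum (I : Type) (s : seq I) (F : I -> C -> C) p :
  (forall i, smooth (F i) p) -> smooth (fun z => \sum_(i <- s) F i z) p.
Proof.
move=> h n; have /choice[P hP] : forall i, exists P, expands (F i) p n P.
  by move=> i; exact: h.
by exists (\sum_(i <- s) P i); exact: expands_sum.
Qed.

Lemma smooth_comp f g p : smooth g p -> smooth f (g p) -> smooth (f \o g) p.
Proof.
move=> sg sf n; have [P fP] := sf n.+1; have [Q gQ] := sg n.+1.
by eexists; apply: expandsW (expands_comp gQ fP).
Qed.

(** The expansions are the partial sums of the geometric series of
    [1 / (p + w)]. *)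
Lemma smooth_inv p : p != 0 -> smooth (fun z => z^-1) p.
Proof.
move=> p0 n; exists (\poly_(i < n) ((-1) ^+ i * p^-1 ^+ i.+1)).
have mp : 0 < modulus p by rewrite modulus_gt0.
exists ((modulus p)^-1 ^+ n * (2 / modulus p)), (modulus p / 2); split.
  by rewrite divr_gt0.
move=> w wp.
have pw : modulus p / 2 <= modulus (p + w).
  have := modulusB (p + w) w; rewrite addrK; lra.
have pw0 : p + w != 0.
  by rewrite -modulus_gt0; apply: lt_le_trans pw; rewrite divr_gt0.
have -> : (p + w)^-1 - (\poly_(i < n) ((-1) ^+ i * p^-1 ^+ i.+1)).[w] =
   (- w / p) ^+ n / (p + w).
  apply: (mulIf pw0); rewrite divfK// mulrBl mulVf// horner_poly.
  elim: n => [|n IH]; first by rewrite big_ord0 mul0r subr0 expr0.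
  rewrite big_ord_recr /= mulrDl opprD addrA IH !exprS.
  have <- : (-1) ^+ n * p^-1 ^+ n * w ^+ n = (- w / p) ^+ n.
    by rewrite -!exprMn; congr (_ ^+ n); ring.
  by set a := p^-1 ^+ n; set b := w ^+ n; field.
rewrite modulusM modulusX modulusM modulusN !modulusV exprMn.
rewrite [leRHS]mulrAC [_^-1 ^+ n * _]mulrC ler_wpM2l//.
  by rewrite mulr_ge0 ?exprn_ge0 ?invr_ge0 ?modulus_ge0.
by rewrite -invf_div lef_pV2// ?posrE ?divr_gt0 // modulus_gt0.
Qed.

End jets.

Section taylor_coefficients.
Variable R : realType.
Local Notation C := R[i].
Implicit Types (f g : C -> C) (p z w : C) (P Q : {poly C}).

Lemma poly_head_tail P : P = drop_poly 1 P * 'X + (P`_0)%:P.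
Proof.
rewrite -{1}(poly_take_drop 1 P) expr1 addrC; congr (_ + _).
by apply/polyP => i; rewrite coef_take_poly coefC; case: i.
Qed.

(** Only the values at small nonzero points are used, so that the statement
    passes from [P] to [P / 'X]. *)
Lemma poly_bigO_coef P n (K d : R) : 0 < d ->
  (forall w, 0 < modulus w < d -> modulus P.[w] <= K * modulus w ^+ n) ->
  forall i, (i < n)%N -> P`_i = 0.
Proof.
move=> d0; elim: n P => // n IH P h.
have P0 : P`_0 = 0.
  have [B B0 hB] := modulus_horner_bound (drop_poly 1 P) 1.
  apply/eqP; rewrite -modulus_eq0 eq_le modulus_ge0 andbT; apply/ler_addgt0Pl => e e0.
  rewrite addr0.
  pose L := `|K| + B + 1; have L0 : 0 < L by rewrite ltr_wpDl// addr_ge0.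
  pose t := Num.min (Num.min 1 (d / 2)) (e / L).
  have t0 : 0 < t by rewrite !lt_min ltr01 !divr_gt0.
  have t1 : t <= 1 by rewrite /t !ge_min lexx.
  have td : t < d.
    apply: (@le_lt_trans _ _ (d / 2)); first by rewrite /t !ge_min lexx orbT.
    by rewrite ltr_pdivrMr// ltr_pMr// ltr1n.
  have te : t * L <= e by rewrite -ler_pdivlMr// /t !ge_min lexx orbT.
  have mt : modulus t%:C = t by rewrite modulus_real gtr0_norm.
  have := h t%:C; rewrite mt t0 td => /(_ isT).
  rewrite {1}(poly_head_tail P) hornerD hornerC hornerM hornerX => ht.
  have -> : P`_0 = (drop_poly 1 P).[t%:C] * t%:C + P`_0 - (drop_poly 1 P).[t%:C] * t%:C.
    by rewrite addrAC subrr add0r.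
  apply: le_trans (modulusB _ _) _; apply: le_trans te.
  rewrite modulusM mt [t * L]mulrC /L [`|K| + B + 1]addrAC mulrDl; apply: lerD.
    have tn1 : t ^+ n <= 1 by rewrite exprn_ile1// ltW.
    have tn0 : 0 <= t ^+ n by rewrite exprn_ge0// ltW.
    apply: (le_trans ht); rewrite exprSr mulrA ler_wpM2r ?(ltW t0)//.
    apply: (@le_trans _ _ (`|K| * t ^+ n)).
      by rewrite ler_wpM2r ?ler_norm.
    by apply: (@le_trans _ _ `|K|); rewrite ?lerDl// ler_piMr.
  by rewrite ler_wpM2r ?(ltW t0)// hB// mt.
case=> [//|i] iltn.
suff : (drop_poly 1 P)`_i = 0 by rewrite coef_drop_poly addn1.
apply: IH iltn => w /andP[w0 wd].
have := h w; rewrite w0 wd {1}(poly_head_tail P) P0 addr0 hornerM hornerX => /(_ isT).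
by rewrite modulusM exprSr mulrA ler_pM2r.
Qed.

Lemma expands_uniq f p n P Q : expands f p n P -> expands f p n Q ->
  forall i, (i < n)%N -> P`_i = Q`_i.
Proof.
move=> /expandsP[K [d [K0 d0 _ h]]] /expandsP[K' [d' [K'0 d'0 _ h']]] i iltn.
apply/eqP; rewrite -subr_eq0 -coefB; apply/eqP.
apply: (@poly_bigO_coef _ n (K + K') (Num.min d d')) => [|w|//].
  by rewrite lt_min d0.
rewrite lt_min => /and3P[_ wd wd'].
have -> : (P - Q).[w] = (f (p + w) - Q.[w]) - (f (p + w) - P.[w]).
  by rewrite !hornerE; ring.
by rewrite mulrDl [leRHS]addrC; apply: le_trans (modulusB _ _) _; rewrite lerD ?h ?h'.
Qed.

(** By [expands_coef] any other expansion of order greater than [n] yields the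
    same coefficient; [xget] only makes a choice. *)
Definition tcoef f p n : C := (xget 0 [set P | expands f p n.+1 P])`_n.

Lemma expands_coef f p n P i : expands f p n P -> (i < n)%N ->
  P`_i = tcoef f p i.
Proof.
move=> h iltn; rewrite /tcoef.
have hi := expandsW iltn h.
by apply: (expands_uniq hi _ (ltnSn i)); apply: xgetPex; exists P.
Qed.

Lemma expands_take f p n P : expands f p n P -> expands f p n (take_poly n P).
Proof.
move=> /expandsP[K [d [K0 d0 d1 h]]].
have [B B0 hB] := modulus_horner_bound (drop_poly n P) 1.
exists (K + B), d; split=> // w wd.
have -> : f (p + w) - (take_poly n P).[w] =
    (f (p + w) - P.[w]) + (drop_poly n P).[w] * w ^+ n.
  by rewrite -{2}(poly_take_drop n P) !hornerE; ring.
apply: le_trans (modulusD _ _) _; rewrite mulrDl; apply: lerD; first exact: h.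
rewrite modulusM modulusX ler_wpM2r ?exprn_ge0 ?modulus_ge0// hB//.
by apply/ltW/(lt_le_trans wd).
Qed.

Lemma smooth_expands f p n : smooth f p ->
  expands f p n (\poly_(i < n) tcoef f p i).
Proof.
move=> /(_ n)[P hP]; have := expands_take hP; congr expands.
apply/polyP => i; rewrite coef_take_poly coef_poly; case: ltnP => // iltn.
exact: expands_coef hP iltn.
Qed.

Lemma tcoef0 f p : smooth f p -> tcoef f p 0 = f p.
Proof.
by move=> /(_ 1%N)[P hP]; rewrite -(expands_coef hP)// -(expands_value hP).
Qed.

Lemma tcoef_eq_near f g p (d : R) n : 0 < d ->
  (forall w, modulus w < d -> f (p + w) = g (p + w)) -> smooth f p ->
  tcoef f p n = tcoef g p n.
Proof.
move=> d0 fg /(_ n.+1)[P hP]; rewrite -(expands_coef hP)//.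
by rewrite -(expands_coef (expands_eq_near d0 fg hP)).
Qed.

Lemma tcoef_sum (I : Type) (s : seq I) (F : I -> C -> C) (a : I -> C) p n :
  (forall i, smooth (F i) p) ->
  tcoef (fun z => \sum_(i <- s) a i * F i z) p n =
  \sum_(i <- s) a i * tcoef (F i) p n.
Proof.
move=> sF; have := fun i => expandsZ (a i) (smooth_expands n.+1 (sF i)).
move=> /(expands_sum s) /expands_coef <-//.
rewrite coef_sum.
by apply: eq_bigr => i _; rewrite coefZ coef_poly ltnSn.
Qed.

Lemma tcoefB f g p n : smooth f p -> smooth g p ->
  tcoef (fun z => f z - g z) p n = tcoef f p n - tcoef g p n.
Proof.
move=> sf sg.
have := expandsD (smooth_expands n.+1 sf) (expandsN (smooth_expands n.+1 sg)).
by move=> /expands_coef <-//; rewrite coefB !coef_poly ltnSn.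
Qed.

Lemma tcoef_comp1 f g p : smooth g p -> smooth f (g p) ->
  tcoef (f \o g) p 1 = tcoef f (g p) 1 * tcoef g p 1.
Proof.
move=> sg sf; have [P fP] := sf 2%N; have [Q gQ] := sg 2%N.
rewrite -(expands_coef (expands_comp gQ fP))// -(expands_coef fP)//.
rewrite -(expands_coef gQ)//; set Q' := Q - _.
have Q'0 : Q'.[0] = 0 by rewrite horner_coef0 coefB coefC subrr.
have c1 (S : {poly C}) : S`_1 = (S^`()).[0].
  by rewrite horner_coef0 coef_deriv mulr1n.
rewrite c1 deriv_comp hornerM horner_comp Q'0 -!c1 coefB coefC subr0.
by [].
Qed.

Lemma tcoef_exp f p k : smooth f p -> f p = 0 ->
  tcoef (fun z => f z ^+ k) p k = tcoef f p 1 ^+ k /\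
  forall j, (j < k)%N -> tcoef (fun z => f z ^+ k) p j = 0.
Proof.
move=> sf fp; have [P hP] := sf k.+2.
have P0 : P`_0 = 0 by rewrite -(expands_value hP).
have PE : P = drop_poly 1 P * 'X by rewrite {1}(poly_head_tail P) P0 addr0.
have hk := expandsX k hP; rewrite PE exprMn in hk.
split=> [|j jk].
  rewrite -(expands_coef hk) ?ltnS ?leqnSn// coefMXn ltnn subnn.
  rewrite -(expands_coef hP)// -[1%N]add0n -coef_drop_poly.
  by rewrite -!horner_coef0 horner_exp.
by rewrite -(expands_coef hk) ?coefMXn ?jk// (ltn_trans jk)// ltnS leqnSn.
Qed.

End taylor_coefficients.

(** * Convergent power series *)

Section power_series.
Variable R : realType.
Local Notation C := R[i].
Implicit Types (f g : C -> C) (p z w : C) (c : nat -> C).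

Lemma nbhs_modulus p (A : set C) : nbhs p A <->
  exists2 d : R, 0 < d & forall w, modulus w < d -> A (p + w).
Proof.
split=> [/nbhs_normP[e /= e0 h]|[d d0 h]].
  have eE : e = (complex.Re e)%:C.
    by move: (gtr0_real e0) => /complex_realP[k ->].
  rewrite eE in e0 h; exists (complex.Re e); first by rewrite -ltcR.
  by move=> w wd; apply: h => /=; rewrite opprD addNKr normrN normE ltcR.
apply/nbhs_normP; exists d%:C => /=; first by rewrite ltcR.
move=> z /=; rewrite normE ltcR => zd.
by rewrite -(subrK p z) addrC; apply: h; rewrite modulus_distC.
Qed.

Lemma cvg_modulusP (u : nat -> C) l : u @ \oo --> l <->
  forall e : R, 0 < e -> exists N, forall n, (N <= n)%N -> modulus (u n - l) < e.
Proof.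
split=> [/cvgrPdist_lt h e e0|h].
  have [|N _ hN] := h e%:C; first by rewrite ltcR.
  by exists N => n /hN /=; rewrite normE ltcR modulus_distC.
apply/cvgrPdist_lt => e e0.
have eE : e = (complex.Re e)%:C.
  by move: (gtr0_real e0) => /complex_realP[k ->].
rewrite eE; rewrite eE ltcR in e0; have [N hN] := h _ e0.
by exists N => // n /= /hN; rewrite normE ltcR modulus_distC.
Qed.

Definition psum c w n : C := \sum_(k < n) c k * w ^+ k.

Lemma has_expansionP f a c : has_expansion f a c <->
  exists2 d : R, 0 < d & forall w, modulus w < d ->
    forall e : R, 0 < e -> exists N, forall n, (N <= n)%N ->
      modulus (psum c w n - f (a + w)) < e.
Proof.
have E w n : series (fun n => c n * (a + w - a) ^+ n) n = psum c w n.
  by rewrite /series /= big_mkord [a + w]addrC addrK.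
rewrite /has_expansion; split=> [/nbhs_modulus[d d0 h]|[d d0 h]].
  exists d => // w /h /cvg_modulusP hw e /hw[N hN].
  by exists N => n /hN; rewrite E.
apply/nbhs_modulus; exists d => // w /h hw.
by apply/cvg_modulusP => e /hw[N hN]; exists N => n /hN; rewrite E.
Qed.

Lemma geometric_tail (x : R) m n : 0 <= x -> x <= 2^-1 ->
  \sum_(m <= k < n) x ^+ k <= 2 * x ^+ m.
Proof.
move=> x0 x2; have [mn|nm] := leqP m n; last first.
  by rewrite big_geq ?mulr_ge0 ?exprn_ge0// ltnW.
suff : \sum_(m <= k < n) x ^+ k <= 2 * x ^+ m - 2 * x ^+ n.
  have : 0 <= 2 * x ^+ n by rewrite mulr_ge0 ?exprn_ge0.
  lra.
elim: n mn => [|n IH]; first by rewrite leqn0 => /eqP ->; rewrite big_geq ?subrr.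
rewrite leq_eqVlt => /orP[/eqP<-|]; first by rewrite big_geq ?subrr.
rewrite ltnS => mn; rewrite big_nat_recr//=; have := IH mn.
have : 0 <= x ^+ n by rewrite exprn_ge0.
by rewrite exprS; nra.
Qed.

Lemma psum_bounded c w : (exists l, forall e : R, 0 < e ->
    exists N, forall n, (N <= n)%N -> modulus (psum c w n - l) < e) ->
  exists2 B : R, 0 < B & forall n, modulus (c n) * modulus w ^+ n <= B.
Proof.
move=> [l /(_ _ ltr01)[N hN]].
exists (2 + \sum_(i < N) modulus (c i) * modulus w ^+ i) => [|n].
  rewrite ltr_pwDl// sumr_ge0// => i _.
  by rewrite mulr_ge0 ?exprn_ge0 ?modulus_ge0.
have s0 i : 0 <= modulus (c i) * modulus w ^+ i.
  by rewrite mulr_ge0 ?exprn_ge0 ?modulus_ge0.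
have [Nn|nN] := leqP N n.
  rewrite ler_wpDr ?sumr_ge0//.
  have -> : modulus (c n) * modulus w ^+ n =
     modulus ((psum c w n.+1 - l) - (psum c w n - l)).
    rewrite -modulusX -modulusM /psum big_ord_recr /=; congr modulus; ring.
  apply: le_trans (modulusB _ _) _.
  by have := hN n.+1 (leqW Nn); have := hN n Nn; lra.
by rewrite (bigD1 (Ordinal nN))//= addrCA lerDl addr_ge0// sumr_ge0.
Qed.

(** The terms are bounded at one point [d / 2] of convergence, hence dominated
    by a geometric series at points closer to the centre. *)
Lemma has_expansion_expands f a c n : has_expansion f a c ->
  expands f a n (\poly_(i < n) c i).
Proof.
move=> /has_expansionP[d d0 h].
have d2 : modulus (d / 2)%:C = d / 2 by rewrite modulus_real ger0_norm// divr_ge0// ltW.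
have [B B0 hB] : exists2 B : R, 0 < B & forall n, modulus (c n) * (d / 2) ^+ n <= B.
  rewrite -d2; apply: psum_bounded; exists (f (a + (d / 2)%:C)); apply: h.
  by rewrite d2 ltr_pdivrMr// ltr_pMr// ltr1n.
have r0 : 0 < d / 2 by rewrite divr_gt0.
exists (B * 2 * (d / 2) ^- n), (d / 4); split; first by rewrite divr_gt0.
move=> w wd; rewrite horner_poly -[X in modulus (_ - X)]/(psum c w n).
apply/ler_addgt0Pl => e e0; have wdd : modulus w < d by lra.
have [N hN] := h w wdd e e0; pose M := maxn n N.
have := hN M (leq_maxr _ _) => hM.
have -> : f (a + w) - psum c w n =
   (psum c w M - psum c w n) - (psum c w M - f (a + w)) by ring.
apply: le_trans (modulusB _ _) _; rewrite addrC; apply: lerD; first exact: ltW.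
have -> : psum c w M - psum c w n = \sum_(n <= k < M) c k * w ^+ k.
  rewrite /psum -!(big_mkord xpredT (fun k => c k * w ^+ k)).
  by rewrite (@big_cat_nat _ _ _ n)//= ?leq_maxl// addrAC subrr add0r.
apply: le_trans (modulus_sum _ _ _) _.
pose x := modulus w / (d / 2).
apply: (@le_trans _ _ (\sum_(n <= k < M) B * x ^+ k)).
  apply: ler_sum_nat => k _; rewrite modulusM modulusX /x expr_div_n mulrA.
  rewrite ler_pdivlMr ?exprn_gt0// mulrAC ler_wpM2r ?exprn_ge0 ?modulus_ge0//.
rewrite -mulr_sumr -!mulrA ler_pM2l//.
have -> : modulus w ^+ n = x ^+ n * (d / 2) ^+ n.
  by rewrite -exprMn /x divfK// gt_eqF.
rewrite [_ ^- n * _]mulrC mulrK ?unitfE ?expf_neq0 ?gt_eqF//.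
apply: geometric_tail; first by rewrite divr_ge0 ?modulus_ge0// ltW.
by rewrite /x ler_pdivrMr//; lra.
Qed.

Lemma has_expansion_smooth f a c : has_expansion f a c -> smooth f a.
Proof. by move=> h n; eexists; exact: has_expansion_expands h. Qed.

Lemma has_expansion_coef f a c n : has_expansion f a c -> c n = tcoef f a n.
Proof.
move=> h; rewrite -(expands_coef (has_expansion_expands n.+1 h))//.
by rewrite coef_poly ltnSn.
Qed.

End power_series.

(** * The maximum principle *)

Section maximum_principle.
Variable R : realType.
Local Notation C := R[i].
Implicit Types (f g h : C -> C) (p z w : C).

(** The closed disk is compact as a subset of [R * R]. *)
Lemma disk_EVT (v : C -> R) (r : R) : 0 <= r ->
  (forall p, modulus p <= r -> forall e : R, 0 < e -> exists2 d : R, 0 < d &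
     forall w, modulus w < d -> `|v (p + w) - v p| < e) ->
  exists2 p, modulus p <= r & forall z, modulus z <= r -> v z <= v p.
Proof.
move=> r0 vc.
pose A := [set q : R * R | modulus (q.1 +i* q.2) <= r].
have AE : A = (fun q : R * R => q.1 * q.1 + q.2 * q.2) @^-1` [set t | t <= r ^+ 2].
  apply/seteqP; split => q; rewrite /A /preimage /mkset -!expr2
      -[_ ^+ 2 + _](sqr_modulus (q.1 +i* q.2)) => h.
    by apply: lerXn2r; rewrite ?nnegrE ?modulus_ge0.
  by move: h; rewrite ler_pXn2r ?nnegrE ?modulus_ge0.
have cA : compact A.
  apply: (@subclosed_compact _ _ (`[-r, r] `*` `[-r, r])).
  - rewrite AE; apply: preimage_closed; last exact: closed_le.
    move=> q _; apply: cvgD; apply: cvgM; (exact: cvg_fst || exact: cvg_snd).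
  - by apply: compact_setX; exact: segment_compact.
  - move=> q qr; split => /=; rewrite in_itv /= -ler_norml.
      exact: le_trans (normRe_le_modulus (q.1 +i* q.2)) qr.
    exact: le_trans (normIm_le_modulus (q.1 +i* q.2)) qr.
have A0 : A !=set0 by exists (0, 0); rewrite /A /= expr0n addr0 sqrtr0.
have cv : {within A, continuous (fun q : R * R => v (q.1 +i* q.2))}.
  apply: continuous_in_subspaceT => q; rewrite inE => Aq.
  apply/cvgrPdist_lt => e e0.
  have [d d0 hd] := vc _ Aq e e0.
  have d20 : 0 < d / 2 by rewrite divr_gt0.
  near=> q'.
  have h1 : `|q.1 - q'.1| < d / 2.
    by near: q'; exact: (@cvgr_dist_lt _ _ _ _ _ fst q.1 (@cvg_fst _ _ _ _ _)).
  have h2 : `|q.2 - q'.2| < d / 2.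
    by near: q'; exact: (@cvgr_dist_lt _ _ _ _ _ snd q.2 (@cvg_snd _ _ _ _ _)).
  have := hd ((q'.1 - q.1) +i* (q'.2 - q.2)).
  have -> : q.1 +i* q.2 + ((q'.1 - q.1) +i* (q'.2 - q.2)) = q'.1 +i* q'.2.
    by simpc; congr (_ +i* _); rewrite addrC subrK.
  rewrite distrC; apply.
  have -> : (q'.1 - q.1) +i* (q'.2 - q.2) =
    (q'.1 - q.1)%:C + 'i * (q'.2 - q.2)%:C by simpc.
  apply: le_lt_trans (modulusD _ _) _; rewrite modulusM !modulus_real.
  have -> : modulus ('i : C) = 1 by rewrite /= expr0n add0r expr1n sqrtr1.
  by rewrite mul1r distrC [`|q'.2 - _|]distrC [ltRHS](splitr d) ltrD.
have [c] := compact_EVT_max A0 cA cv.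
rewrite inE => Ac hc; exists (c.1 +i* c.2) => // z zr.
by have := hc (complex.Re z, complex.Im z); case: z zr => a b zr; apply; rewrite inE.
Unshelve. all: by end_near.
Qed.

Lemma smooth_continuous h p (e : R) : smooth h p -> 0 < e ->
  exists2 d : R, 0 < d & forall w, modulus w < d -> modulus (h (p + w) - h p) < e.
Proof.
move=> /(_ 1%N)[P /expands_lipschitz[K [d [K0 d0 hd]]]] e0.
exists (Num.min d (e / K)); first by rewrite lt_min d0 divr_gt0.
move=> w; rewrite lt_min => /andP[wd we]; apply: le_lt_trans (hd _ wd) _.
by rewrite mulrC -ltr_pdivlMr.
Qed.

(** At an interior maximum [p] of [Re h + e |z|^2], averaging over the four
    points [p + w], [p - w], [p + iw], [p - iw] cancels the terms of order
    one and two of [h], so that the average of [Re h] changes by [O(w^3)] only,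
    whereas the average of [e |z|^2] increases by exactly [e |w|^2]. *)
Lemma max_principle_Re h (r B : R) z0 : 0 < r ->
  (forall z, modulus z <= r -> smooth h z) ->
  (forall z, modulus z = r -> complex.Re (h z) <= B) ->
  modulus z0 <= r -> complex.Re (h z0) <= B.
Proof.
move=> r0 sh hB z0r; rewrite leNgt; apply/negP => Bz0.
(* With this [e] the values on the circle stay below the one at [z0]. *)
pose e := (complex.Re (h z0) - B) / (2 * r ^+ 2).
have r20 : 0 < r ^+ 2 by rewrite exprn_gt0.
have e0 : 0 < e by rewrite divr_gt0 ?mulr_gt0// subr_gt0.
have er : e * r ^+ 2 = (complex.Re (h z0) - B) / 2.
  by rewrite /e; field; rewrite gt_eqF.
clearbody e.
pose v z := complex.Re (h z) + e * modulus z ^+ 2.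
have [p pr hp] : exists2 p, modulus p <= r & forall z, modulus z <= r -> v z <= v p.
  apply: disk_EVT; first exact: ltW.
  move=> p pr eta eta0.
  have eta20 : 0 < eta / 2 by rewrite divr_gt0.
  have [d1 d10 h1] := smooth_continuous (sh _ pr) eta20.
  pose d2 := eta / (2 * e * (2 * r + 1)).
  have rr : 0 < 2 * r + 1 by rewrite addr_gt0 ?mulr_gt0.
  exists (Num.min d1 (Num.min 1 d2)).
    by rewrite !lt_min d10 ltr01 /d2 /= divr_gt0// !mulr_gt0.
  move=> w; rewrite !lt_min => /and3P[wd1 w1 wd2].
  rewrite /v.
  have -> : complex.Re (h (p + w)) + e * modulus (p + w) ^+ 2 -
    (complex.Re (h p) + e * modulus p ^+ 2) = complex.Re (h (p + w) - h p) +
    e * (modulus (p + w) ^+ 2 - modulus p ^+ 2) by rewrite ReB; ring.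
  apply: le_lt_trans (ler_normD _ _) _; rewrite (splitr eta); apply: ltrD.
    exact: le_lt_trans (normRe_le_modulus _) (h1 _ wd1).
  rewrite normrM (gtr0_norm e0) subr_sqr normrM.
  have H1 : `|modulus (p + w) - modulus p| <= modulus w.
    by apply: le_trans (modulus_lip _ _) _; rewrite addrAC subrr add0r.
  have H2 : `|modulus (p + w) + modulus p| <= 2 * r + 1.
    by rewrite ger0_norm ?addr_ge0 ?modulus_ge0//; have := modulusD p w; lra.
  apply: (@le_lt_trans _ _ (e * (modulus w * (2 * r + 1)))).
    by rewrite ler_pM2l//; apply: ler_pM.
  move: wd2; rewrite /d2 ltr_pdivlMr ?mulr_gt0// => wd2.
  by rewrite ltr_pdivlMr//; apply: le_lt_trans wd2; rewrite le_eqVlt; apply/orP; left; apply/eqP; ring.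
have vz0 : complex.Re (h z0) <= v p.
  by apply: le_trans (hp _ z0r); rewrite /v lerDl mulr_ge0 ?exprn_ge0 ?modulus_ge0 ?(ltW e0).
have {}pr : modulus p < r.
  rewrite lt_neqAle pr andbT; apply/eqP => pE.
  by have := hB _ pE; move: vz0; rewrite /v pE er; lra.
have /expandsP[K [d [K0 d0 d1 hd]]] := smooth_expands 3 (sh _ (ltW pr)).
pose t := Num.min (Num.min (d / 2) ((r - modulus p) / 2)) (e / (2 * K)).
have t0 : 0 < t by rewrite !lt_min !divr_gt0 ?mulr_gt0// subr_gt0.
have td : t < d.
  by apply: (@le_lt_trans _ _ (d / 2)); rewrite ?ltr_pdivrMr ?ltr_pMr ?ltr1n// /t !ge_min lexx.
have tr : t <= (r - modulus p) / 2 by rewrite /t !ge_min lexx orbT.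
have tK : t * (2 * K) <= e by rewrite -ler_pdivlMr ?mulr_gt0// /t !ge_min lexx orbT.
clearbody t.
have key w : modulus w = t -> complex.Re (h p) + complex.Re (tcoef h p 1 * w)
   + complex.Re (tcoef h p 2 * w ^+ 2) - K * t ^+ 3 + e * modulus (p + w) ^+ 2 <=
   complex.Re (h p) + e * modulus p ^+ 2.
  move=> wt; have := hp (p + w); rewrite /v => hpw.
  have {}hpw : complex.Re (h (p + w)) + e * modulus (p + w) ^+ 2 <=
     complex.Re (h p) + e * modulus p ^+ 2.
    by apply: hpw; apply: le_trans (modulusD _ _) _; rewrite wt; lra.
  have := hd w; rewrite wt => /(_ td).
  rewrite horner_poly !big_ord_recl big_ord0 /= expr0 mulr1 expr1 addr0.
  rewrite tcoef0; last exact: sh (ltW pr).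
  rewrite modulus_distC => /(le_trans (Re_le_modulus _)).
  by rewrite ReB !ReD /bump /=; lra.
pose t' : C := t%:C; have mt : modulus t' = t by rewrite modulus_real gtr0_norm.
have mi : modulus ('i : C) = 1 by rewrite /= expr0n add0r expr1n sqrtr1.
have k1 := key t' mt.
have k2 := key (- t') (etrans (modulusN _) mt).
have k3 : modulus ('i * t') = t by rewrite modulusM mi mul1r.
have k4 := key (- ('i * t')) (etrans (modulusN _) k3).
move: k3 => /key k3.
move: k1 k2 k3 k4; rewrite !sqr_modulus.
case: (p) => x y; case: (tcoef h _ 1) => a b; case: (tcoef h _ 2) => a' b'.
rewrite /t'; rewrite !expr2; simpc; rewrite /=.
have : 0 < t ^+ 2 by rewrite exprn_gt0.
move=> t20 k1 k2 k3 k4.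
suff : e * t ^+ 2 <= K * t * t ^+ 2.
  by rewrite ler_pM2r// => eKt; lra.
by lra.
Qed.

(** [max_principle_Re] applied to [h] times the conjugate of [h z0]. *)
Lemma max_principle h (r B : R) z0 : 0 < r ->
  (forall z, modulus z <= r -> smooth h z) ->
  (forall z, modulus z = r -> modulus (h z) <= B) ->
  modulus z0 <= r -> modulus (h z0) <= B.
Proof.
move=> r0 sh hB z0r.
have B0 : 0 <= B.
  apply: le_trans (modulus_ge0 (h r%:C)) (hB _ _).
  by rewrite modulus_real gtr0_norm.
have [->//|hz0] := eqVneq (modulus (h z0)) 0.
have hz00 : 0 < modulus (h z0) by rewrite lt_neqAle eq_sym hz0 modulus_ge0.
rewrite -(ler_pM2l hz00).
have := @max_principle_Re (fun z => (h z0)^*%C * h z) r (modulus (h z0) * B) z0 r0.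
rewrite [_^*%C * h z0]mulrC mul_conj /= expr2; apply => // [z zr|z /hB hz].
  by apply: smoothM; [exact: smooth_cst|exact: sh].
apply: le_trans (Re_le_modulus _) _.
by rewrite modulusM modulus_conj ler_pM2l.
Qed.

Lemma smooth_bounded h (r : R) : 0 <= r ->
  (forall z, modulus z <= r -> smooth h z) ->
  exists2 B : R, 0 <= B & forall z, modulus z <= r -> modulus (h z) <= B.
Proof.
move=> r0 sh.
have [p pr hp] : exists2 p, modulus p <= r &
    forall z, modulus z <= r -> modulus (h z) <= modulus (h p).
  apply: disk_EVT => // p pr e e0.
  have [d d0 hd] := smooth_continuous (sh _ pr) e0.
  exists d => // w /hd; apply: le_lt_trans.
  exact: modulus_lip.
by exists (modulus (h p)); rewrite ?modulus_ge0.
Qed.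

End maximum_principle.

(** * Cauchy estimates and Taylor expansion on a disk *)

Section cauchy.
Variable R : realType.
Local Notation C := R[i].
Implicit Types (f g h : C -> C) (p z w : C).

Lemma prim_root_exists n : (0 < n)%N -> exists z : C, n.-primitive_root z.
Proof.
pose p : {poly C} := 'X^n - 1; have [r Dp] := closed_field_poly_normal p.
move=> n_gt0; rewrite (monicP _) ?monicXnsubC // scale1r in Dp.
have rn1 : all n.-unity_root r.
  by apply/allP=> z; rewrite -root_prod_XsubC -Dp.
have sz_r : (n < (size r).+1)%N.
  by rewrite -(size_prod_XsubC r id) -Dp size_XnsubC.
have [|z] := hasP (has_prim_root n_gt0 rn1 _ sz_r); last by exists z.
by rewrite -separable_prod_XsubC -Dp separable_Xn_sub_1 // pnatr_eq0 -lt0n.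
Qed.

Lemma prim_root_sum M (x : C) i j : M.-primitive_root x ->
  (i < M)%N -> (j < M)%N ->
  \sum_(k < M) (x ^+ i / x ^+ j) ^+ k = (i == j)%:R * M%:R.
Proof.
move=> xM iM jM; have M0 := prim_order_gt0 xM.
have x0 : x != 0.
  apply/eqP => x0; have := prim_expr_order xM; rewrite x0 expr0n gtn_eqF//=.
  by move/eqP; rewrite eq_sym oner_eq0.
have xj0 : x ^+ j != 0 by rewrite expf_neq0.
have [->|ij] := eqVneq i j.
  rewrite divff// mul1r; under eq_bigr do rewrite expr1n.
  by rewrite sumr_const card_ord.
set y := _ / _; rewrite mul0r.
have y1 : y - 1 != 0.
  rewrite subr_eq0; apply: contra ij => /eqP yE.
  have : x ^+ i = x ^+ j by rewrite -[LHS](divfK xj0) -/y yE mul1r.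
  by move/eqP; rewrite (eq_prim_root_expr xM) !modn_small.
apply: (mulfI y1); rewrite -subrX1 mulr0 /y exprMn exprVn -!exprM.
by rewrite ![(_ * M)%N]mulnC !exprM (prim_expr_order xM) !expr1n divr1 subrr.
Qed.

Lemma unity_root_modulus M (x : C) : (0 < M)%N -> x ^+ M = 1 -> modulus x = 1.
Proof.
move=> M0 /(congr1 modulus); rewrite modulusX modulus1 => h.
by apply/eqP; rewrite -(pexpr_eq1 M0 (modulus_ge0 _)) h.
Qed.

Lemma expands_rotate f a n P : modulus a = 1 -> expands f 0 n P ->
  expands (fun z => f (a * z)) 0 n (\poly_(i < size P) (a ^+ i * P`_i)).
Proof.
move=> a1 [K [d [d0 h]]]; exists K, d; split=> // w wd.
have -> : (\poly_(i < size P) (a ^+ i * P`_i)).[w] = P.[a * w].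
  rewrite horner_poly horner_coef; apply: eq_bigr => i _.
  by rewrite exprMn; ring.
by have := h (a * w); rewrite modulusM a1 mul1r !add0r; exact.
Qed.

Lemma smooth_rotate f a p : smooth f (a * p) -> smooth (fun z => f (a * z)) p.
Proof.
move=> sf; apply: (@smooth_comp _ f (fun z => a * z)) => //.
by apply: smoothM; [exact: smooth_cst|exact: smooth_id].
Qed.

Lemma tcoef_rotate f a n : modulus a = 1 -> smooth f 0 ->
  tcoef (fun z => f (a * z)) 0 n = a ^+ n * tcoef f 0 n.
Proof.
move=> a1 /(_ n.+1)[P hP].
rewrite -(expands_coef (expands_rotate a1 hP))// coef_poly -(expands_coef hP)//.
by case: ltnP => // sPn; rewrite nth_default// mulr0.
Qed.

(** The quotient [f z / z ^+ n] with its singularity at the origin removed. *)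
Definition quotXn f n : C -> C :=
  fun z => if z == 0 then tcoef f 0 n else f z / z ^+ n.

Lemma smooth_quotXn0 f n : smooth f 0 -> (forall j, (j < n)%N -> tcoef f 0 j = 0) ->
  smooth (quotXn f n) 0.
Proof.
move=> sf f0 N; have [P hP] := sf (N.+1 + n)%N.
have PE : P = drop_poly n P * 'X^n.
  rewrite -{1}(poly_take_drop n P) -[RHS]add0r; congr (_ + _).
  apply/polyP => i; rewrite coef_take_poly coef0; case: ltnP => // iltn.
  by rewrite (expands_coef hP) ?f0// (leq_trans iltn)// leq_addl.
have Pn : (drop_poly n P)`_0 = tcoef f 0 n.
  by rewrite coef_drop_poly add0n (expands_coef hP)// addSn ltnS leq_addl.
exists (drop_poly n P).
move: hP => /expandsP[K [d [K0 d0 d1 h]]].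
exists K, d; split=> // w wd; rewrite /quotXn add0r.
have [->|w0] := eqVneq w 0.
  by rewrite horner_coef0 Pn subrr modulus0 mulr_ge0 ?exprn_ge0 ?(ltW K0).
have mw0 : 0 < modulus w by rewrite modulus_gt0.
have -> : f w / w ^+ n - (drop_poly n P).[w] = (f (0 + w) - P.[w]) / w ^+ n.
  by rewrite {2}PE hornerM hornerXn add0r mulrBl mulfK// expf_neq0.
rewrite modulusM modulusV modulusX ler_pdivrMr ?exprn_gt0//.
apply: le_trans (h _ wd) _; rewrite -mulrA -exprD ler_pM2l//.
apply: (ler_wiXn2l (modulus_ge0 w)); last by rewrite addSn leqnSn.
by apply/ltW/(lt_le_trans wd).
Qed.

Lemma smooth_quotXn f n z : z != 0 -> smooth f z -> smooth (quotXn f n) z.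
Proof.
move=> z0 sf; have mz : 0 < modulus z by rewrite modulus_gt0.
apply: (@smooth_eq_near _ (fun z => f z * (z ^+ n)^-1) _ _ _ mz).
  move=> w wz; rewrite /quotXn; case: eqVneq => // /eqP.
  by rewrite addrC addr_eq0 => /eqP wE; move: wz; rewrite wE modulusN ltxx.
apply: smoothM => //.
apply: (@smooth_comp _ (fun z => z^-1) (fun z => z ^+ n)).
  by apply: smoothX; exact: smooth_id.
by apply: smooth_inv; rewrite expf_neq0.
Qed.

(** The average [F z] of [f (w ^+ k z) / w ^+ (n k)] over the powers of a
    root of unity [w] of order [n + 1] keeps the bound of [f] and has the
    expansion [tcoef f 0 n * z ^+ n + O (z ^+ n.+1)]; the maximum principle
    applies to [F z / z ^+ n]. *)
Lemma cauchy_estimate f (r B : R) n : 0 < r ->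
  (forall z, modulus z <= r -> smooth f z) ->
  (forall z, modulus z = r -> modulus (f z) <= B) ->
  modulus (tcoef f 0 n) * r ^+ n <= B.
Proof.
move=> r0 sf fB; pose M := n.+1.
have [x xM] := prim_root_exists (ltn0Sn n).
have x1 k : modulus (x ^+ k) = 1.
  by rewrite modulusX (unity_root_modulus _ (prim_expr_order xM)) ?expr1n.
have M0 : (M%:R : C) != 0 by rewrite pnatr_eq0.
pose a k : C := M%:R^-1 / (x ^+ n) ^+ k.
pose F z := \sum_(k < M) a k * f (x ^+ k * z).
have sF z : modulus z <= r -> smooth F z.
  move=> zr; apply: smooth_sum => k; apply: smoothM; first exact: smooth_cst.
  by apply: smooth_rotate; apply: sf; rewrite modulusM x1 mul1r.
have s0 : smooth f 0 by apply: sf; rewrite modulus0 ltW.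
have coefF j : (j < M)%N -> tcoef F 0 j = (j == n)%:R * tcoef f 0 j.
  move=> jM; rewrite /F tcoef_sum; last first.
    by move=> k; apply: smooth_rotate; rewrite mulr0.
  under eq_bigr => k _ do rewrite tcoef_rotate ?x1// mulrA.
  rewrite -mulr_suml; congr (_ * _).
  have -> : \sum_(i < M) a i * (x ^+ i) ^+ j =
     M%:R^-1 * \sum_(i < M) (x ^+ j / x ^+ n) ^+ i.
    rewrite mulr_sumr; apply: eq_bigr => i _.
    by rewrite /a exprMn exprVn -!exprM [(i * j)%N]mulnC; ring.
  by rewrite (prim_root_sum xM)// mulrCA mulVf ?mulr1.
have := @max_principle R (quotXn F n) r (B / r ^+ n) 0 r0.
rewrite modulus0 {3}/quotXn eqxx coefF// eqxx mul1r ler_pdivlMr ?exprn_gt0//.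
apply; last exact: ltW.
  move=> z zr; have [->|z0] := eqVneq z 0; last exact: smooth_quotXn (sF _ zr).
  apply: smooth_quotXn0; first by apply: sF; rewrite modulus0 ltW.
  by move=> j jn; rewrite coefF ?ltn_eqF ?mul0r// ltnW.
move=> z zr; rewrite /quotXn; case: eqVneq => [z0|z0].
  by move: r0; rewrite -zr z0 modulus0 ltxx.
rewrite modulusM modulusV modulusX zr ler_pM2r ?invr_gt0 ?exprn_gt0//.
apply: le_trans (modulus_sum _ _ _) _.
apply: (@le_trans _ _ (\sum_(k < M) M%:R^-1 * B)).
  apply: ler_sum => k _; rewrite !modulusM !modulusV modulusX modulus_nat x1.
  rewrite expr1n invr1 mulr1 ler_wpM2l ?invr_ge0//.
  by apply: fB; rewrite modulusM x1 mul1r.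
by rewrite sumr_const card_ord -[leLHS]mulr_natl mulrA divff ?mul1r// pnatr_eq0.
Qed.

(** The maximum principle for the quotient of the remainder by [z ^+ N]; the
    factor [N.+1] comes from bounding [f] and the [N] terms subtracted from it
    separately on the circle, by Cauchy's estimates. *)
Lemma taylor_remainder f (r B : R) N z : 0 < r ->
  (forall z, modulus z <= r -> smooth f z) ->
  (forall z, modulus z = r -> modulus (f z) <= B) -> modulus z <= r ->
  modulus (f z - psum (tcoef f 0) z N) <= N.+1%:R * B * (modulus z / r) ^+ N.
Proof.
move=> r0 sf fB zr.
pose T z := f z - psum (tcoef f 0) z N.
have sp p : smooth (fun z => psum (tcoef f 0) z N) p.
  apply: smooth_sum => i; apply: smoothM; first exact: smooth_cst.
  by apply: smoothX; exact: smooth_id.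
have sT p : modulus p <= r -> smooth T p by move=> pr; apply: smoothB (sf _ pr) _.
have s0 : smooth f 0 by apply: sf; rewrite modulus0 ltW.
have T0 j : (j < N)%N -> tcoef T 0 j = 0.
  move=> jN; rewrite /T tcoefB//.
  have : expands (fun z => psum (tcoef f 0) z N) 0 j.+1 (\poly_(i < N) tcoef f 0 i).
    exists 0, 1; split=> // w _.
    by rewrite add0r horner_poly subrr modulus0 mul0r.
  by move=> /expands_coef <-//; rewrite coef_poly jN subrr.
have TB p : modulus p = r -> modulus (T p) <= N.+1%:R * B.
  move=> pr; apply: le_trans (modulusB _ _) _.
  rewrite -add1n natrD mulrDl mul1r; apply: lerD; first exact: fB.
  apply: le_trans (modulus_sum _ _ _) _.
  apply: (@le_trans _ _ (\sum_(k < N) B)).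
    apply: ler_sum => k _; rewrite modulusM modulusX pr.
    exact: cauchy_estimate.
  by rewrite sumr_const card_ord -[leLHS]mulr_natl.
have B0 : 0 <= B.
  apply: le_trans (modulus_ge0 (f r%:C)) (fB _ _).
  by rewrite modulus_real gtr0_norm.
have Q : modulus (quotXn T N z) <= N.+1%:R * B / r ^+ N.
  apply: (@max_principle R _ r _ z r0) => // p pr.
    have [->|p0] := eqVneq p 0; last exact: smooth_quotXn (sT _ pr).
    by apply: smooth_quotXn0 => //; apply: sT; rewrite modulus0 ltW.
  rewrite /quotXn; case: eqVneq => [p0|p0].
    by move: r0; rewrite -pr p0 modulus0 ltxx.
  rewrite modulusM modulusV modulusX pr ler_pM2r ?invr_gt0 ?exprn_gt0//.
  exact: TB.
move: Q; rewrite /quotXn; have [->|z0] := eqVneq z 0.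
  case: N {sp sT TB} @T T0 => [|N] T T0 _.
    rewrite /psum big_ord0 subr0 expr0 mulr1 mul1r.
    have := @max_principle R f r B 0 r0 sf fB; rewrite modulus0; apply; exact: ltW.
  rewrite /psum big_ord_recl big1 => [|i _]; last by rewrite expr0n /= mulr0.
  rewrite tcoef0// expr0 mulr1 addr0 subrr modulus0 !mulr_ge0 ?exprn_ge0//.
  by rewrite mul0r.
have mz : 0 < modulus z by rewrite modulus_gt0.
rewrite modulusM modulusV modulusX ler_pdivrMr ?exprn_gt0// => /le_trans; apply.
by rewrite expr_div_n mulrAC [in leRHS]mulrA.
Qed.

(** For exponent one, [n.+1 x ^+ n] is at most the sum of the geometric series;
    a larger exponent is split between [z ^+ n] and [(x / z) ^+ n] with
    [x < z < 1]. *)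
Lemma poly_geometric_bound (x : R) k : 0 <= x < 1 ->
  exists2 K : R, 0 < K & forall n, n.+1%:R ^+ k * x ^+ n <= K.
Proof.
have lin (y : R) n : 0 <= y < 1 -> n.+1%:R * y ^+ n <= (1 - y)^-1.
  move=> /andP[y0 y1]; have y1' : 0 < 1 - y by rewrite subr_gt0.
  apply: (@le_trans _ _ (\sum_(i < n.+1) y ^+ i)).
    rewrite mulr_natl -[n.+1 in leLHS]card_ord -sumr_const; apply: ler_sum => i _.
    by apply: (ler_wiXn2l y0 (ltW y1)); rewrite -ltnS.
  rewrite -(ler_pM2l y1') divff ?gt_eqF//.
  have -> : (1 - y) * \sum_(i < n.+1) y ^+ i = 1 - y ^+ n.+1.
    by have := subrX1 y n.+1; move=> h; rewrite -opprB mulNr -h opprB.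
  by rewrite lerBlDr lerDl exprn_ge0.
elim: k x => [|k IH] x /andP[x0 x1].
  exists 1 => // n; rewrite expr0 mul1r; exact: exprn_ile1 x0 (ltW x1).
pose z := (1 + x) / 2; have z0 : 0 < z by rewrite /z; lra.
have [|K K0 hK] := IH z; first by rewrite ltW//= /z; lra.
have xz : 0 <= x / z < 1.
  by rewrite divr_ge0 ?(ltW z0)//= ltr_pdivrMr// /z; lra.
have xz1 : 0 < 1 - x / z by case/andP: xz => _; rewrite subr_gt0.
exists (K * (1 - x / z)^-1) => [|n]; first by rewrite mulr_gt0 ?invr_gt0.
have -> : n.+1%:R ^+ k.+1 * x ^+ n = (n.+1%:R ^+ k * z ^+ n) * (n.+1%:R * (x / z) ^+ n).
  rewrite exprS [x ^+ n](_ : _ = z ^+ n * (x / z) ^+ n); first by ring.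
  by rewrite -exprMn; congr (_ ^+ n); field; rewrite gt_eqF.
apply: ler_pM; rewrite ?hK ?lin// mulr_ge0 ?exprn_ge0 ?(ltW z0)//.
by case/andP: xz.
Qed.

Lemma geometric_cvg0 (K x e : R) : 0 <= x < 1 -> 0 < e ->
  exists N, forall n, (N <= n)%N -> n.+1%:R * K * x ^+ n < e.
Proof.
move=> /andP[x0 x1] e0; pose y := (1 + x) / 2.
have y0 : 0 < y by rewrite /y; lra.
have [|L L0 hL] := @poly_geometric_bound (x / y) 1.
  by rewrite divr_ge0 ?(ltW y0)//= ltr_pdivrMr// /y; lra.
pose A := L * (`|K| + 1); have A0 : 0 < A by rewrite mulr_gt0// ltr_wpDl.
have : (GRing.exp y : R^nat) @ \oo --> 0.
  by apply: cvg_expr; rewrite gtr0_norm// /y; lra.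
move=> /cvgrPdist_lt/(_ (e / A)); case; first by rewrite divr_gt0.
move=> N _ hN; exists N => n /hN /=.
rewrite sub0r normrN ger0_norm ?exprn_ge0 ?(ltW y0)// ltr_pdivlMr// => h.
apply: le_lt_trans h.
have -> : n.+1%:R * K * x ^+ n = (n.+1%:R ^+ 1 * (x / y) ^+ n * K) * y ^+ n.
  rewrite expr1 [x ^+ n](_ : _ = y ^+ n * (x / y) ^+ n); first by ring.
  by rewrite -exprMn; congr (_ ^+ n); field; rewrite gt_eqF.
rewrite [leRHS]mulrC ler_wpM2r ?exprn_ge0 ?(ltW y0)//.
apply: le_trans (ler_norm _) _; rewrite normrM.
apply: ler_pM => //; last by rewrite lerDl.
by rewrite ger0_norm ?hL// mulr_ge0 ?exprn_ge0// divr_ge0// ltW.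
Qed.

Lemma taylor_cvg f (r : R) z (e : R) : 0 < r ->
  (forall z, modulus z <= r -> smooth f z) -> modulus z < r -> 0 < e ->
  exists N, forall n, (N <= n)%N -> modulus (psum (tcoef f 0) z n - f z) < e.
Proof.
move=> r0 sf zr e0; have [B B0 hB] := smooth_bounded (ltW r0) sf.
have [|N hN] := @geometric_cvg0 B (modulus z / r) e _ e0.
  by rewrite divr_ge0 ?modulus_ge0 ?(ltW r0)//= ltr_pdivrMr ?mul1r.
exists N => n /hN; apply: le_lt_trans; rewrite modulus_distC.
by apply: taylor_remainder => //; [move=> w wr; apply: hB; rewrite wr|exact: ltW].
Qed.

Lemma smooth_shift f a p : smooth f (a + p) -> smooth (fun z => f (a + z)) p.
Proof.
move=> sf; apply: (@smooth_comp _ f (fun z => a + z)) => //.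
by apply: smoothD; [exact: smooth_cst|exact: smooth_id].
Qed.

Lemma tcoef_shift f a n : smooth f a -> tcoef (fun z => f (a + z)) 0 n = tcoef f a n.
Proof.
move=> /(_ n.+1)[P hP]; rewrite -(expands_coef hP)//; apply/esym.
apply: (@expands_coef _ _ _ n.+1) => //; move: hP => [K [d [d0 h]]]; exists K, d; split=> // w wd.
by rewrite add0r; exact: h.
Qed.

(** Asymptotic expansions on a whole disk force the convergence of the Taylor
    series there: the converse of [has_expansion_smooth]. *)
Lemma smooth_has_expansion f a (r : R) : 0 < r ->
  (forall w, modulus w <= r -> smooth f (a + w)) -> has_expansion f a (tcoef f a).
Proof.
move=> r0 sf; apply/has_expansionP; exists r => // w wr e e0.
have sa : smooth f a by rewrite -[a]addr0; apply: sf; rewrite modulus0 ltW.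
have [|N hN] := @taylor_cvg (fun z => f (a + z)) r w e r0 _ wr e0.
  by move=> z zr; apply: smooth_shift; exact: sf.
exists N => n /hN; congr (modulus (_ - _) < _).
by apply: eq_bigr => i _; rewrite tcoef_shift.
Qed.

End cauchy.

(** * Determinants of perturbed matrices of low rank *)

Section low_rank.
Variable R : realType.
Local Notation C := R[i].
Local Notation "B ^!" :=
  (orthomx (@Num.conj C) (mx_of_hermitian (hermitian1mx _)) B) : matrix_set_scope.

Lemma det_row_bound n (A : 'M[C]_n) (b : 'I_n -> R) :
  (forall i j, modulus (A i j) <= b i) ->
  modulus (\det A) <= n`!%:R * \prod_i b i.
Proof.
move=> Ab; apply: le_trans (modulus_sum _ _ _) _.
apply: (@le_trans _ _ (\sum_(s : 'S_n) \prod_i b i)).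
  apply: ler_sum => s _; rewrite modulusM modulusX modulusN modulus1 expr1n mul1r.
  by rewrite modulus_prod; apply: ler_prod => i _; rewrite modulus_ge0 Ab.
by rewrite sumr_const card_Sn -[leLHS]mulr_natl.
Qed.

Lemma unitary_row_norm m n (U : 'M[C]_(m, n)) i : U \is unitarymx ->
  \sum_j modulus (U i j) ^+ 2 = 1.
Proof.
move=> /unitarymxP /matrixP /(_ i i); rewrite !mxE eqxx => h.
apply: (@complexI R); rewrite rmorph_sum /= -[RHS]h; apply: eq_bigr => j _.
by rewrite !mxE -normCK normE rmorphXn.
Qed.

Lemma unitary_entry m n (U : 'M[C]_(m, n)) i j : U \is unitarymx ->
  modulus (U i j) <= 1.
Proof.
move=> /(@unitary_row_norm _ _ _ i) h.
rewrite -(@ler_pXn2r _ 2) ?nnegrE ?modulus_ge0// expr1n -h (bigD1 j)//= lerDl.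
by apply: sumr_ge0 => k _; rewrite exprn_ge0 ?modulus_ge0.
Qed.

Lemma unitary_det n (U : 'M[C]_n) : U \is unitarymx -> modulus (\det U) = 1.
Proof.
move=> /unitarymxP /(congr1 determinant).
rewrite det_mulmx det1 det_map_mx det_tr -normCK normE -rmorphXn.
move=> /(@complexI R) /eqP.
by rewrite (pexpr_eq1 _ (modulus_ge0 _))// => /eqP.
Qed.

Lemma mulmx_entry_bound m n p (A : 'M[C]_(m, n)) (B : 'M[C]_(n, p)) (e : R) i j :
  (forall k, modulus (A i k) <= 1) -> (forall k, modulus (B k j) <= e) ->
  modulus ((A *m B) i j) <= n%:R * e.
Proof.
move=> hA hB; rewrite mxE; apply: le_trans (modulus_sum _ _ _) _.
apply: (@le_trans _ _ (\sum_(k < n) e)).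
  apply: ler_sum => k _; rewrite modulusM -[leRHS]mul1r.
  by apply: ler_pM; rewrite ?modulus_ge0.
by rewrite sumr_const card_ord -[leLHS]mulr_natl.
Qed.

(** Complete an orthonormal basis of the left kernel of [B] to a unitary matrix
    [U].  On the rows of [U] in the kernel, [U T] is [U (T - B)], hence of size
    [N e]; on the at most [k] other rows it is of size [N K]. *)
Lemma det_low_rank N k (T B : 'M[C]_N) (K e : R) : 0 <= e -> e <= K ->
  (\rank B <= k <= N)%N -> (forall i j, modulus (T i j) <= K) ->
  (forall i j, modulus (T i j - B i j) <= e) ->
  modulus (\det T) <= N`!%:R * ((N%:R * K) ^+ k * (N%:R * e) ^+ (N - k)).
Proof.
move=> e0 eK /andP[rk kN] TK TBe.
have key p q (U1 : 'M[C]_(p, N)) (U2 : 'M[C]_(q, N)) : (p + q = N)%N ->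
    col_mx U1 U2 \is unitarymx -> U1 *m B = 0 ->
    modulus (\det T) <= N`!%:R * ((N%:R * e) ^+ p * (N%:R * K) ^+ q).
  move=> pqN; subst N; set U := col_mx U1 U2 => Uu U1B.
  have -> : modulus (\det T) = modulus (\det (U *m T)).
    by rewrite det_mulmx modulusM (unitary_det Uu) mul1r.
  pose b (i : 'I_(p + q)) := (p + q)%:R * (if (i < p)%N then e else K).
  have Ub i j : modulus ((U *m T) i j) <= b i.
    rewrite /b; case: ifP => ip; last first.
      by apply: mulmx_entry_bound => l; [exact: unitary_entry|exact: TK].
    have -> : (U *m T) i j = (U *m (T - B)) i j.
      rewrite mulmxBr [RHS]mxE [X in _ + X]mxE; suff -> : (U *m B) i j = 0.
        by rewrite subr0.
      have -> : i = lshift q (Ordinal ip) by apply: val_inj.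
      by rewrite mul_col_mx U1B col_mxEu mxE.
    apply: mulmx_entry_bound => l; first exact: unitary_entry.
    by have := TBe l j; rewrite !mxE.
  apply: le_trans (det_row_bound Ub) _; rewrite ler_wpM2l ?ler0n//.
  rewrite big_split_ord /b /= le_eqVlt; apply/orP; left; apply/eqP.
  congr (_ * _).
    under eq_bigr => i _ do rewrite ltn_ord.
    by rewrite prodr_const card_ord.
  under eq_bigr => i _ do rewrite ltnNge leq_addr /=.
  by rewrite prodr_const card_ord.
have [V rV VB] : exists2 V : 'M[C]_N, (\rank V = N - \rank B)%N & V *m B = 0.
  by exists (kermx B); rewrite ?mxrank_ker ?mulmx_ker.
have rVo : (\rank V + \rank V^!%MS = N)%N by exact: add_rank_ortho.
have rB : (\rank V^!%MS = \rank B)%N by rewrite rank_ortho rV subKn ?rank_leq_row.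
apply: le_trans (key _ _ _ _ rVo (schmidt_complete_unitarymx V) _) _.
  apply/sub_kermxP; rewrite eqmx_schmidt_free ?row_base_free// eq_row_base.
  exact/sub_kermxP.
rewrite ler_wpM2l ?ler0n// rB.
rewrite rV.
have -> : (N - \rank B = (N - k) + (k - \rank B))%N by lia.
rewrite exprD mulrC mulrCA mulrC ler_wpM2r ?exprn_ge0 ?mulr_ge0//.
have -> : (N%:R * K) ^+ k = (N%:R * K) ^+ (k - \rank B) * (N%:R * K) ^+ \rank B.
  by rewrite -exprD subnK.
have K0 : 0 <= K by exact: le_trans eK.
rewrite mulrC ler_wpM2r ?exprn_ge0 ?mulr_ge0//.
by apply: lerXn2r; rewrite ?nnegrE ?mulr_ge0// ler_wpM2l.
Qed.

End low_rank.

(** * Disk automorphisms and the pseudo-hyperbolic derivative *)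

Section mobius.
Variable R : realType.
Local Notation C := R[i].
Implicit Types (f g phi : C -> C) (a b p z w : C).

Definition smooth_on_disk f := forall z, modulus z < 1 -> smooth f z.

Lemma disk_near p : modulus p < 1 -> exists2 d : R, 0 < d &
  forall w, modulus w < d -> modulus (p + w) < 1.
Proof.
move=> p1; exists (1 - modulus p); first by rewrite subr_gt0.
by move=> w wd; apply: le_lt_trans (modulusD _ _) _; lra.
Qed.

Lemma smooth_on_disk_eq f g p : (forall z, modulus z < 1 -> f z = g z) ->
  modulus p < 1 -> smooth f p -> smooth g p.
Proof.
move=> fg /disk_near[d d0 hd]; apply: (smooth_eq_near d0) => w /hd; exact: fg.
Qed.

Lemma tcoef_on_disk_eq f g n : (forall z, modulus z < 1 -> f z = g z) ->
  smooth f 0 -> tcoef f 0 n = tcoef g 0 n.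
Proof.
move=> fg; apply: (@tcoef_eq_near _ _ _ _ 1) => // w w1.
by rewrite add0r fg.
Qed.

Lemma analytic_on_diskP f : analytic_on (@disk R) f <-> smooth_on_disk f.
Proof.
split=> [af z /af[c] /has_expansion_smooth //|sf z z1].
exists (tcoef f z).
have r0 : 0 < (1 - modulus z) / 2 by rewrite divr_gt0// subr_gt0.
apply: (smooth_has_expansion r0) => w wr; apply: sf.
apply: le_lt_trans (modulusD _ _) _; have : modulus z < 1 by []; lra.
Qed.

Definition mobius b z : C := (z - b) / (1 - b^*%C * z).

Lemma mobius_denom b z : modulus b < 1 -> modulus z < 1 -> 1 - b^*%C * z != 0.
Proof.
move=> b1 z1; rewrite subr_eq0; apply/eqP => /(congr1 (@Normc.normc R)).
rewrite modulus1 modulusM modulus_conj => h.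
have := modulus_ge0 b; have := modulus_ge0 z; nra.
Qed.

Lemma mobius_identity b z : modulus b < 1 -> modulus z < 1 ->
  (1 - modulus (mobius b z) ^+ 2) * modulus (1 - b^*%C * z) ^+ 2 =
  (1 - modulus b ^+ 2) * (1 - modulus z ^+ 2).
Proof.
move=> b1 z1; have d0 := mobius_denom b1 z1.
have md0 : modulus (1 - b^*%C * z) ^+ 2 != 0 by rewrite expf_neq0// modulus_eq0.
have -> : modulus (mobius b z) ^+ 2 =
    modulus (z - b) ^+ 2 / modulus (1 - b^*%C * z) ^+ 2.
  by rewrite /mobius modulusM modulusV expr_div_n.
rewrite [LHS]mulrBl mul1r divfK//.
rewrite !sqr_modulus; case: (z) (b) => x y [u v]; simpc; rewrite /=; ring.
Qed.

Lemma mobius_lt1 b z : modulus b < 1 -> modulus z < 1 -> modulus (mobius b z) < 1.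
Proof.
move=> b1 z1; have := mobius_identity b1 z1.
have d0 : 0 < modulus (1 - b^*%C * z) ^+ 2.
  by rewrite exprn_gt0// modulus_gt0 mobius_denom.
have h : 0 < (1 - modulus b ^+ 2) * (1 - modulus z ^+ 2).
  by rewrite mulr_gt0// subr_gt0 expr_lt1// modulus_ge0.
move=> E; rewrite -E pmulr_lgt0// subr_gt0 in h.
by rewrite expr_lt1// ?modulus_ge0 in h.
Qed.

(** A disk automorphism divides the distance to the boundary by at most a
    constant, so that it preserves polynomial growth at the boundary. *)
Lemma mobius_boundary b z : modulus b < 1 -> modulus z < 1 ->
  (1 - modulus b ^+ 2) / 8 * (1 - modulus z) <= 1 - modulus (mobius b z).
Proof.
move=> b1 z1; have := mobius_identity b1 z1; have := mobius_lt1 b1 z1.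
set t := modulus (mobius b z); set d := modulus (1 - _) => t1 E.
have t0 : 0 <= t by exact: modulus_ge0.
have d0 : 0 <= d by exact: modulus_ge0.
have d2 : d <= 2.
  apply: le_trans (modulusB _ _) _; rewrite modulus1 modulusM modulus_conj.
  have := modulus_ge0 b; have := modulus_ge0 z; nra.
have b0 := modulus_ge0 b; have z0 := modulus_ge0 z.
have h1 : d ^+ 2 <= 4 by nra.
have h2 : (1 - t ^+ 2) * d ^+ 2 <= (1 - t ^+ 2) * 4.
  by rewrite ler_wpM2l// subr_ge0 expr_le1 // ltW.
have h3 : 0 <= 1 - modulus b ^+ 2 by rewrite subr_ge0 expr_le1 // ltW.
have h4 : (1 - modulus b ^+ 2) * (1 - modulus z) <=
    (1 - modulus b ^+ 2) * (1 - modulus z ^+ 2).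
  by rewrite ler_wpM2l//; nra.
have h5 : 1 - t ^+ 2 <= 2 * (1 - t) by nra.
by rewrite mulrAC ler_pdivrMr//; lra.
Qed.

Lemma smooth_mobius b : modulus b < 1 -> smooth_on_disk (mobius b).
Proof.
move=> b1 z z1; apply: smoothM.
  by apply: smoothB; [exact: smooth_id|exact: smooth_cst].
apply: (@smooth_comp _ (fun z => z^-1) (fun z => 1 - b^*%C * z)).
  apply: smoothB; first exact: smooth_cst.
  by apply: smoothM; [exact: smooth_cst|exact: smooth_id].
by apply: smooth_inv; exact: mobius_denom.
Qed.

Lemma mobiusNK a z : modulus a < 1 -> modulus z < 1 ->
  mobius a (mobius (- a) z) = z.
Proof.
move=> a1 z1.
have na1 : modulus (- a) < 1 by rewrite modulusN.
have d0 := mobius_denom na1 z1.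
have d1 := mobius_denom a1 (mobius_lt1 na1 z1).
rewrite {1}/mobius; set X := mobius (- a) z in d1 *.
have XE : X * (1 - (- a)^*%C * z) = z + a by rewrite /X /mobius divfK// opprK.
apply: (mulIf d1); rewrite divfK//; apply: (mulIf d0).
have -> : (X - a) * (1 - (- a)^*%C * z) =
    X * (1 - (- a)^*%C * z) - a * (1 - (- a)^*%C * z) by ring.
have -> : z * (1 - a^*%C * X) * (1 - (- a)^*%C * z) =
    z * (1 - (- a)^*%C * z) - z * a^*%C * (X * (1 - (- a)^*%C * z)) by ring.
by rewrite XE rmorphN /=; ring.
Qed.

Lemma mobius0 b : mobius b b = 0.
Proof. by rewrite /mobius subrr mul0r. Qed.

Lemma mobiusN0 a : mobius (- a) 0 = a.
Proof. by rewrite /mobius mulr0 subr0 divr1 sub0r opprK. Qed.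

Lemma tcoef_id p : tcoef id p 1 = 1.
Proof.
by rewrite -(expands_coef (expands_id p 2))// coefD coefX coefC addr0.
Qed.

Lemma tcoef_mobius b : modulus b < 1 ->
  tcoef (mobius b) b 1 = ((1 - modulus b ^+ 2)^-1)%:C.
Proof.
move=> b1.
have sg : smooth (fun z => (1 - b^*%C * z)^-1) b.
  apply: (@smooth_comp _ (fun z => z^-1) (fun z => 1 - b^*%C * z)).
    apply: smoothB; first exact: smooth_cst.
    by apply: smoothM; [exact: smooth_cst|exact: smooth_id].
  by apply: smooth_inv; exact: mobius_denom.
have [P hP] := sg 2%N.
have h : expands (fun z => z - b) b 2 'X.
  by exists 0, 1; split=> // w _; rewrite hornerX [b + w]addrC addrK subrr modulus0 mul0r.
rewrite -(expands_coef (expandsM h hP))// mulrC coefMX /=.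
rewrite -(expands_value hP) -[b^*%C * b]mulrC mul_conj.
by rewrite -[1 in LHS]/((1 : R)%:C) -rmorphB fmorphV.
Qed.

Lemma tcoef_mobiusN a : modulus a < 1 ->
  tcoef (mobius (- a)) 0 1 = (1 - modulus a ^+ 2)%:C.
Proof.
move=> a1; have na1 : modulus (- a) < 1 by rewrite modulusN.
have z1 : modulus (0 : C) < 1 by rewrite modulus0 ltr01.
have sm := smooth_mobius na1 z1.
have E : tcoef (mobius a \o mobius (- a)) 0 1 = 1.
  rewrite -(tcoef_id 0); apply/esym/tcoef_on_disk_eq; last exact: smooth_id.
  by move=> z zz1 /=; rewrite mobiusNK.
rewrite tcoef_comp1// ?mobiusN0 ?tcoef_mobius// in E; last exact: smooth_mobius.
have a0 : (1 - modulus a ^+ 2)%:C != 0 :> C.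
  by rewrite (fmorph_eq0 (real_complex R)) gt_eqF// subr_gt0 expr_lt1// modulus_ge0.
rewrite fmorphV in E.
by apply: (mulfI (invr_neq0 a0)); rewrite mulVf//; exact: E.
Qed.

Lemma derive1_coef f a : smooth f a -> f^`() a = tcoef f a 1.
Proof.
move=> sf; rewrite /derive1; apply: (@cvg_lim C); first exact: norm_hausdorff.
have /expandsP[K [d [K0 d0 d1 h]]] := smooth_expands 2 sf.
apply/cvgrPdist_lt => e e0.
have eE : e = (complex.Re e)%:C.
  by move: (gtr0_real e0) => /complex_realP[k ->].
rewrite eE; rewrite eE ltcR in e0.
apply/nbhs_modulus; exists (Num.min d (complex.Re e / K)).
  by rewrite lt_min d0 divr_gt0.
move=> w; rewrite lt_min add0r => /andP[wd we] w0.
rewrite normE ltcR; have mw : 0 < modulus w by rewrite modulus_gt0.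
have -> : tcoef f a 1 - w^-1 *: (f (w + a) - f a) =
   - ((f (a + w) - (\poly_(i < 2) tcoef f a i).[w]) / w).
  rewrite horner_poly !big_ord_recl big_ord0 /= expr0 mulr1 expr1 addr0 tcoef0//.
  rewrite [w + a]addrC -[_ *: _]/(_ * _) /bump /=; field. exact: w0.
rewrite modulusN modulusM modulusV ltr_pdivrMr//.
apply: le_lt_trans (h _ wd) _; rewrite expr2 mulrA ltr_pM2r//.
by rewrite mulrC -ltr_pdivlMr.
Qed.

(** The conjugate [h] of [phi] by disk automorphisms that move [a] and [phi a]
    to the origin; its derivative there is [phi^#(a)] up to a unimodular
    factor. *)
Definition conjugate phi a : C -> C :=
  mobius (phi a) \o (phi \o mobius (- a)).

Section conjugate.
Variables (phi : C -> C) (a : C).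
Hypotheses (sphi : smooth_on_disk phi) (a1 : modulus a < 1)
  (phi1 : forall z, modulus z < 1 -> modulus (phi z) < 1).

Let na1 : modulus (- a) < 1. Proof. by rewrite modulusN. Qed.
Let z1 : modulus (0 : C) < 1. Proof. by rewrite modulus0 ltr01. Qed.

Lemma smooth_conjugate : smooth_on_disk (conjugate phi a).
Proof.
move=> z zz1; have m1 := mobius_lt1 na1 zz1.
apply: smooth_comp; last by apply: smooth_mobius; exact: phi1.
by apply: smooth_comp; [exact: smooth_mobius|exact: sphi].
Qed.

Lemma conjugate_lt1 z : modulus z < 1 -> modulus (conjugate phi a z) < 1.
Proof. by move=> zz1; apply: mobius_lt1; apply: phi1 => //; exact: mobius_lt1. Qed.

Lemma conjugate0 : conjugate phi a 0 = 0.
Proof. by rewrite /conjugate /= mobiusN0 mobius0. Qed.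

Lemma tcoef_conjugate : modulus (tcoef (conjugate phi a) 0 1) =
  pseudo_hyperbolic_derivative phi a.
Proof.
rewrite /conjugate.
rewrite tcoef_comp1 /= ?mobiusN0; first last.
- by apply: smooth_mobius; exact: phi1.
- apply: smooth_comp; first exact: smooth_mobius.
  by rewrite mobiusN0; exact: sphi.
rewrite tcoef_comp1 ?mobiusN0; first last.
- exact: sphi.
- exact: smooth_mobius.
rewrite tcoef_mobiusN// tcoef_mobius ?phi1//.
rewrite /pseudo_hyperbolic_derivative derive1_coef; last exact: sphi.
rewrite !modulusM !modulus_real !ger0_norm.
- by rewrite [in LHS]mulrC.
- by rewrite subr_ge0 expr_le1 ?modulus_ge0// ltW.
- by rewrite invr_ge0 subr_ge0 expr_le1 ?modulus_ge0// ltW// phi1.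
Qed.

(** The Schwarz-Pick inequality: Cauchy's estimate of order one for
    [conjugate phi a] on circles of radius close to 1. *)
Lemma pseudo_hyperbolic_derivative_le1 : pseudo_hyperbolic_derivative phi a <= 1.
Proof.
rewrite -tcoef_conjugate; set c := modulus _; rewrite leNgt; apply/negP => c1.
have c0 : 0 < c by lra.
pose r := (1 + c^-1) / 2.
have cV1 : c^-1 < 1 by rewrite invf_lt1.
have cV0 : 0 < c^-1 by rewrite invr_gt0.
have r0 : 0 < r by rewrite /r; lra.
have : c * r ^+ 1 <= 1.
  apply: (@cauchy_estimate _ _ r 1) => // z zr; first by apply: smooth_conjugate; rewrite /r in zr; lra.
  by apply/ltW/conjugate_lt1; rewrite zr /r; lra.
by rewrite expr1 /r mulrA ler_pdivrMr// mulrDr mulr1 divff ?gt_eqF//; lra.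
Qed.

End conjugate.

End mobius.

(** * Lower bound for approximation numbers *)

Section lower_bound.
Variable R : realType.
Local Notation C := R[i].
Implicit Types (f g phi : C -> C) (a z w : C).

(** The two properties of a space of analytic functions that the lower bound
    rests on: its elements grow at most polynomially at the boundary, and a
    ball of the bounded functions lies in its unit ball. *)
Definition growth_bound (nrm : (C -> C) -> \bar R) (K : R) (M : nat) :=
  forall g (e : R), smooth_on_disk g -> (nrm g <= e%:E)%E ->
  forall z, modulus z < 1 -> modulus (g z) * (1 - modulus z) ^+ M <= K * e.

Definition contains_bounded (H : set (C -> C)) (nrm : (C -> C) -> \bar R) (d : R) :=
  forall f, smooth_on_disk f -> (forall z, ~ modulus z < 1 -> f z = 0) ->
  (forall z, modulus z < 1 -> modulus (f z) <= d) -> H f /\ (nrm f <= 1)%E.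

Lemma bernoulli (x : R) n : 0 <= x <= 1 -> 1 - n%:R * x <= (1 - x) ^+ n.
Proof.
move=> /andP[x0 x1]; elim: n => [|n IH]; first by rewrite mul0r subr0 expr0.
rewrite exprS; apply: (@le_trans _ _ ((1 - x) * (1 - n%:R * x))).
  rewrite -natr1; have : 0 <= n%:R * (x * x) by rewrite !mulr_ge0.
  lra.
by rewrite ler_wpM2l// subr_ge0.
Qed.

(** The powers up to [N] of the radius [1 - 1 / (2 N)] stay away from 0 although
    its distance to the boundary is of order [1 / N]: Cauchy's estimates on
    this circle lose only a polynomial in [N]. *)
Lemma bernoulli_half N : (0 < N)%N -> 2^-1 <= (1 - (2 * N%:R)^-1 : R) ^+ N.
Proof.
move=> N0; have N0' : 0 < N%:R :> R by rewrite ltr0n.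
have N1 : 1 <= N%:R :> R by rewrite ler1n.
set x : R := (2 * N%:R)^-1.
have x0 : 0 <= x by rewrite invr_ge0 mulr_ge0.
have x1 : x <= 1 by rewrite /x invf_le1 ?mulr_gt0//; lra.
have x01 : 0 <= x <= 1 by rewrite x0.
apply: le_trans (bernoulli N x01); rewrite  /x invfM mulrCA divff ?gt_eqF//; lra.
Qed.

(** The Taylor coefficients of [g] in the coordinate [mobius (- a)], as
    functionals of [g], are of size polynomial in the degree. *)
Lemma tcoef_mobius_bound g a (A : R) M N j : modulus a < 1 -> smooth_on_disk g ->
  (forall z, modulus z < 1 -> modulus (g z) * (1 - modulus z) ^+ M <= A) ->
  (j < N)%N -> modulus (tcoef (g \o mobius (- a)) 0 j) <=
    2 * A * (2 * N%:R / ((1 - modulus a ^+ 2) / 8)) ^+ M.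
Proof.
move=> a1 sg gA jN; have N0 : (0 < N)%N by exact: leq_ltn_trans jN.
have N0' : 0 < N%:R :> R by rewrite ltr0n.
have N1 : 1 <= N%:R :> R by rewrite ler1n.
have na1 : modulus (- a) < 1 by rewrite modulusN.
set c := (1 - modulus a ^+ 2) / 8.
have c0 : 0 < c by rewrite divr_gt0// subr_gt0 expr_lt1 ?modulus_ge0.
pose r : R := 1 - (2 * N%:R)^-1.
have i0 : 0 < (2 * N%:R : R)^-1 by rewrite invr_gt0 mulr_gt0.
have i1 : (2 * N%:R : R)^-1 <= 2^-1 by rewrite lef_pV2 ?posrE ?mulr_gt0//; lra.
have r0 : 0 < r by rewrite /r; lra.
have r1 : r < 1 by rewrite /r; lra.
have A0 : 0 <= A.
  have := gA 0; rewrite modulus0 subr0 expr1n mulr1 ltr01 => /(_ isT).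
  exact: le_trans (modulus_ge0 _).
set B := A * (2 * N%:R / c) ^+ M.
have B0 : 0 <= B by rewrite mulr_ge0// exprn_ge0// divr_ge0 ?(ltW c0)// mulr_ge0.
have : modulus (tcoef (g \o mobius (- a)) 0 j) * r ^+ j <= B.
  apply: cauchy_estimate => // z zr.
    have z1 : modulus z < 1 by exact: le_lt_trans r1.
    apply: smooth_comp; first exact: smooth_mobius.
    by apply: sg; exact: mobius_lt1.
  have z1 : modulus z < 1 by rewrite zr.
  have m1 := mobius_lt1 na1 z1.
  have := mobius_boundary na1 z1; rewrite modulusN -/c zr /r subKr => hb.
  have h := gA _ m1; rewrite /= /B.
  have q0 : 0 < (c * (2 * N%:R)^-1) ^+ M by rewrite exprn_gt0// mulr_gt0.
  rewrite -(ler_pM2r q0).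
  have -> : A * (2 * N%:R / c) ^+ M * (c * (2 * N%:R)^-1) ^+ M = A.
    rewrite -mulrA -exprMn [X in X ^+ M](_ : _ = 1) ?expr1n ?mulr1//.
    by field; rewrite !gt_eqF.
  apply: le_trans h; rewrite ler_wpM2l ?modulus_ge0//.
  apply: lerXn2r hb; rewrite nnegrE ?subr_ge0; last exact: ltW.
  by rewrite mulr_ge0 ?(ltW c0) ?(ltW i0).
set t := modulus _ => h.
have rj : 2^-1 <= r ^+ j.
  apply: le_trans (bernoulli_half N0) _.
  by apply: (ler_wiXn2l (ltW r0) (ltW r1)); exact: ltnW.
have t0 : 0 <= t by exact: modulus_ge0.
have : t * 2^-1 <= B by apply: le_trans h; rewrite ler_wpM2l.
by rewrite -mulrA -/B; lra.
Qed.

Variables (phi : C -> C) (a : C).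
Hypotheses (sphi : smooth_on_disk phi) (a1 : modulus a < 1)
  (phi1 : forall z, modulus z < 1 -> modulus (phi z) < 1).

Let h := conjugate phi a.
Let s := pseudo_hyperbolic_derivative phi a.

(** The powers are truncated by 0 outside the disk, as the elements of the
    space are. *)
Definition test_fun (d : R) k : C -> C :=
  fun z => if z \in @disk R then d%:C * mobius (phi a) z ^+ k else 0.

Lemma in_disk z : (z \in @disk R) = (modulus z < 1).
Proof. by apply/idP/idP => [/set_mem //|z1]; apply/mem_set. Qed.

Lemma test_funE d k z : modulus z < 1 -> test_fun d k z = d%:C * mobius (phi a) z ^+ k.
Proof. by rewrite /test_fun in_disk => ->. Qed.

Lemma comp_opE f z : modulus z < 1 -> comp_op phi f z = f (phi z).
Proof. by rewrite /comp_op in_disk => ->. Qed.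

Lemma smooth_test_fun d k : smooth_on_disk (test_fun d k).
Proof.
move=> z z1; apply: (@smooth_on_disk_eq _ (fun z => d%:C * mobius (phi a) z ^+ k)) => //.
  by move=> w w1; rewrite test_funE.
apply: smoothM; first exact: smooth_cst.
by apply: smoothX; apply: smooth_mobius => //; exact: phi1.
Qed.

Lemma test_fun_le (d : R) k z : 0 <= d -> modulus z < 1 -> modulus (test_fun d k z) <= d.
Proof.
move=> d0 z1; rewrite test_funE// modulusM modulusX modulus_real ger0_norm//.
rewrite ler_piMr// exprn_ile1 ?modulus_ge0//; apply/ltW/mobius_lt1 => //.
exact: phi1.
Qed.

Lemma smooth_comp_op f : smooth_on_disk f -> smooth_on_disk (comp_op phi f).
Proof.
move=> sf z z1; apply: (@smooth_on_disk_eq _ (f \o phi)) => //.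
  by move=> w w1; rewrite comp_opE.
by apply: smooth_comp; [exact: sphi|apply: sf; exact: phi1].
Qed.

Let na1 : modulus (- a) < 1. Proof. by rewrite modulusN. Qed.
Let z1 : modulus (0 : C) < 1. Proof. by rewrite modulus0 ltr01. Qed.

(** In the coordinate [mobius (- a)] around [a], the test functions composed
    with [phi] become multiples of the powers of [h]. As [h] vanishes at the
    origin, their coefficients form a triangular matrix. *)
Definition functional j g : C := tcoef (g \o mobius (- a)) 0 j.

Lemma smooth_functional g : smooth_on_disk g -> smooth (g \o mobius (- a)) 0.
Proof.
move=> sg; apply: smooth_comp; first exact: smooth_mobius.
by apply: sg; exact: mobius_lt1.
Qed.

Lemma functional_sum j (I : Type) (r : seq I) (F : I -> C -> C) (u : I -> C) :
  (forall i, smooth_on_disk (F i)) ->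
  functional j (fun z => \sum_(i <- r) u i * F i z) =
  \sum_(i <- r) u i * functional j (F i).
Proof.
by move=> sF; rewrite /functional -tcoef_sum// => i; exact: smooth_functional.
Qed.

Lemma functional_test d k j : (j <= k)%N ->
  functional j (comp_op phi (test_fun d k)) =
  (j == k)%:R * (d%:C * tcoef h 0 1 ^+ k).
Proof.
move=> jk.
have sh : smooth h 0 by exact: smooth_conjugate.
have shk : smooth (fun z => h z ^+ k) 0 by exact: smoothX.
have -> : functional j (comp_op phi (test_fun d k)) =
    d%:C * tcoef (fun z => h z ^+ k) 0 j.
  have -> : d%:C * tcoef (fun z => h z ^+ k) 0 j =
      tcoef (fun z => \sum_(i <- [:: tt]) d%:C * h z ^+ k) 0 j.
    by rewrite (@tcoef_sum _ _ [:: tt] (fun=> fun z => h z ^+ k) (fun=> d%:C))// big_seq1.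
  apply: tcoef_on_disk_eq; last first.
    by apply: smooth_functional; apply: smooth_comp_op; exact: smooth_test_fun.
  move=> z zz1; have m1 := mobius_lt1 na1 zz1.
  by rewrite /= big_seq1 comp_opE// test_funE//; exact: phi1.
have [h1 h2] := tcoef_exp k sh (conjugate0 phi a).
have [->|jNk] := eqVneq j k; first by rewrite mul1r h1.
by rewrite h2 ?mulr0 ?mul0r// ltn_neqAle jNk.
Qed.

(** A linear relation between the functions [F i] is also one between the rows
    of the matrix, because the functionals are linear. *)
Lemma rank_functional N n (F : 'I_N -> C -> C) (e : 'I_n -> C -> C) :
  (forall i, smooth_on_disk (F i)) ->
  (forall i, exists c : 'I_n -> C, F i = \sum_(l < n) c l *: e l) ->
  (\rank (\matrix_(i < N, j < N) functional j (F i)) <= n)%N.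
Proof.
move=> sF /choice[c Fc]; set B := \matrix_(_, _) _.
pose A := \matrix_(i < N, l < n) c i l.
have AB : kermx A *m B = 0.
  apply/matrixP => i j; rewrite !mxE.
  under eq_bigr => k _ do rewrite [B _ _]mxE.
  rewrite -(functional_sum j _ (kermx A i) sF).
  have -> : (fun z => \sum_k kermx A i k * F k z) = fun=> 0.
    apply/funext => z.
    under eq_bigr => k _ do rewrite Fc fct_sumE mulr_sumr.
    rewrite exchange_big /= big1// => l _.
    have /matrixP/(_ i l) := mulmx_ker A; rewrite !mxE => K0.
    under eq_bigr => k _ do rewrite /= -[(c k l *: e l) z]/(c k l * e l z) mulrA.
    rewrite -mulr_suml.
    have -> : \sum_(i0 < N) kermx A i i0 * c i0 l = 0.
      by rewrite -[RHS]K0; apply: eq_bigr => k _; rewrite [A _ _]mxE.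
    by rewrite mul0r.
  rewrite /functional -(expands_coef (expands_cst 0 0 j.+1))//.
  by rewrite coefC; case: (nat_of_ord j).
have := mulmx0_rank_max AB; rewrite mxrank_ker.
have := rank_leq_row A; have := rank_leq_col A; have := rank_leq_row B; lia.
Qed.

Hypothesis s0 : 0 < s.

Lemma det_functional d N : 0 <= d ->
  modulus (\det (\matrix_(i < N, j < N)
    functional j (comp_op phi (test_fun d i)))) =
  d ^+ N * s ^+ 'C(N, 2).
Proof.
move=> d0; rewrite -det_tr det_trig; last first.
  apply/is_trig_mxP => i j ij; rewrite !mxE functional_test 1?ltnW//.
  by rewrite ltn_eqF// mul0r.
under eq_bigr => i _ do rewrite !mxE functional_test// eqxx mul1r.
rewrite modulus_prod.
under eq_bigr => i _ do rewrite modulusM modulus_real ger0_norm// modulusX tcoef_conjugate//.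
rewrite big_split prodr_const card_ord /=; congr (_ * _).
rewrite -/s; elim: N => [|N IH]; first by rewrite big_ord0.
by rewrite big_ord_recr/= IH binS bin1 exprD.
Qed.

Lemma fact_le_exp N : (N`! <= N ^ N)%N.
Proof.
elim: N => // N IH; rewrite factS expnS leq_mul2l /=.
by apply: (leq_trans IH); case: N {IH} => // N; rewrite leq_exp2r.
Qed.

Lemma bin_double_le n : ('C(2 * n, 2) <= 2 * n * n)%N.
Proof. by rewrite bin2 leq_half_double; nia. Qed.

Variables (H : set (C -> C)) (nrm : (C -> C) -> \bar R) (K d : R) (M : nat).
Hypotheses (K0 : 0 < K) (d0 : 0 < d <= 1)
  (Hsmooth : forall f, H f -> smooth_on_disk f)
  (Hgrowth : growth_bound nrm K M) (Hball : contains_bounded H nrm d).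

Let c : R := (1 - modulus a ^+ 2) / 8.

Let c0 : 0 < c.
Proof. by rewrite divr_gt0// subr_gt0 expr_lt1 ?modulus_ge0. Qed.

(** The determinant of the triangular matrix of the functionals on
    [C_phi (test_fun d k)], [k < 2 n], is [d ^ (2 n) s ^ (n (2 n - 1))]; if [S]
    has rank less than [n] and is at distance [e] from [C_phi], it is also
    at most of order [e ^ n] up to the [n]-th power of a polynomial in [n]. *)
Lemma approximation_bound n (S : (C -> C) -> C -> C) (e : R) : (0 < n)%N ->
  bounded_operator H nrm S -> rank_lt H S n ->
  (operator_norm H nrm (fun f => (comp_op phi f - S f)%R) <= e%:E)%E ->
  d ^+ 2 * s ^+ (2 * n) <=
   (2 * n)%:R ^+ 4 * 3 * (2 * (K * e) * (2 * (2 * n)%:R / c) ^+ M).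
Proof.
move=> n0 [SH _ _] [k [ee [kn Sspan]]] normS.
have [d00 d1] := andP d0.
have [N NE] : exists N, N = (2 * n)%N by exists (2 * n)%N.
rewrite -NE; have N0 : (0 < N)%N by rewrite NE muln_gt0.
have N1 : 1 <= N%:R :> R by rewrite ler1n.
set eps := 2 * (K * e) * _.
pose t (k : nat) := test_fun d k.
have Ht k' : H (t k') /\ (nrm (t k') <= 1)%E.
  apply: Hball => [|z /negP|z z1']; first exact: smooth_test_fun.
    by rewrite /t /test_fun in_disk => /negbTE ->.
  by apply: test_fun_le => //; exact: ltW.
pose D k' := comp_op phi (t k') - S (t k').
have sT k' : smooth_on_disk (comp_op phi (t k')).
  by apply: smooth_comp_op; exact: smooth_test_fun.
have sS k' : smooth_on_disk (S (t k')).
  by apply: Hsmooth; apply: SH; case: (Ht k').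
have sD k' : smooth_on_disk (D k').
  by move=> z zz1; apply: smoothB; [exact: sT|exact: sS].
have nD k' : (nrm (D k') <= e%:E)%E.
  by apply: le_trans normS; apply: ereal_sup_ubound; exists (t k').
have fD k' j : (j < N)%N -> modulus (functional j (D k')) <= eps.
  by move=> jN; apply: tcoef_mobius_bound => //; apply: Hgrowth.
have fT k' j : (j < N)%N -> modulus (functional j (comp_op phi (t k'))) <= 2 * d.
  move=> jN; have := @tcoef_mobius_bound (comp_op phi (t k')) a d 0 N j a1 (sT k').
  rewrite !expr0 !mulr1; apply => // z zz1; rewrite mulr1 comp_opE//.
  by apply: test_fun_le; [exact: ltW|exact: phi1].
have eps0 : 0 <= eps by exact: le_trans (modulus_ge0 _) (fD 0%N 0%N N0).
have s1 : s <= 1 by exact: pseudo_hyperbolic_derivative_le1.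
have s00 : 0 <= s by exact: ltW.
have N4 : 1 <= N%:R ^+ 4 :> R by rewrite exprn_ege1.
(* For [eps > 1] the inequality holds because its left-hand side is at most 1. *)
have [eps1|eps1] := ltP 1 eps.
  apply: (@le_trans _ _ 1).
    by apply: mulr_ile1; rewrite ?exprn_ge0 ?(ltW d00)// exprn_ile1// ltW.
  apply: (@le_trans _ _ (N%:R ^+ 4 * 3 * 1)); first by lra.
  by rewrite ler_pM2l ?(ltW eps1)//; lra.
pose T := \matrix_(i < N, j < N) functional j (comp_op phi (t i)).
pose B := \matrix_(i < N, j < N) functional j (S (t i)).
have rB : (\rank B <= k)%N.
  apply: rank_functional => i; first exact: sS.
  by apply: Sspan; case: (Ht i).
have := @det_low_rank R N n T B 3 eps eps0.
have eps3 : eps <= 3 by lra.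
move=> /(_ eps3).
rewrite (leq_trans rB (ltnW kn)) {1}NE leq_pmull//= => /(_ isT).
have h1 i j : modulus (T i j) <= 3.
  by rewrite mxE; apply: le_trans (fT _ _ (ltn_ord j)) _; lra.
have h2 i j : modulus (T i j - B i j) <= eps.
  rewrite !mxE /functional -tcoefB.
  - exact: fD.
  - by apply: smooth_functional; exact: sT.
  - by apply: smooth_functional; exact: sS.
move=> /(_ h1 h2); rewrite det_functional ?(ltW d00)//.
have Nn : (N - n = n)%N by rewrite NE mul2n -addnn addnK.
rewrite Nn => key.
(* Both sides are [n]-th powers once the exponent of [s] is increased from
   [n (2 n - 1)] to [2 n n]. *)
have hs : s ^+ (2 * n * n) <= s ^+ 'C(N, 2).
  by rewrite NE; exact: (ler_wiXn2l s00 s1 (bin_double_le n)).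
rewrite -(@ler_pXn2r _ n)// ?nnegrE; first last.
- by apply: mulr_ge0 => //; lra.
- by rewrite mulr_ge0// exprn_ge0// ltW.
have -> : (d ^+ 2 * s ^+ N) ^+ n = d ^+ N * s ^+ (2 * n * n).
  by rewrite exprMn -!exprM NE.
apply: le_trans (le_trans _ key) _.
  by rewrite ler_wpM2l// exprn_ge0// ltW.
have -> : (N%:R ^+ 4 * 3 * eps) ^+ n = N%:R ^+ N * ((N%:R * 3) ^+ n * (N%:R * eps) ^+ n).
  rewrite {3}NE exprM -!exprMn; congr (_ ^+ n); ring.
rewrite ler_wpM2r//.
  by apply: mulr_ge0; apply: exprn_ge0; apply: mulr_ge0.
by rewrite -natrX ler_nat fact_le_exp.
Qed.

(** The polynomial factor of [approximation_bound] is absorbed by the powers of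
    [kappa / s < 1]. *)
Theorem approx_number_lower_bound (kappa : R) : 0 < kappa -> kappa < s ->
  exists2 q : R, 0 < q & forall n : nat, (1 <= n)%N ->
    ((q * kappa ^+ (2 * n))%:E <= approx_number H nrm (comp_op phi) n)%E.
Proof.
move=> kappa0 kappas; have [d00 d1] := andP d0.
pose x := (kappa / s) ^+ 2.
have x01 : 0 <= x < 1.
  have ks : 0 <= kappa / s by apply: divr_ge0; exact: ltW.
  apply/andP; split; first exact: exprn_ge0.
  by rewrite /x expr_lt1// ltr_pdivrMr// mul1r.
have [L L0 hL] := poly_geometric_bound (4 + M) x01.
pose Q := 2 ^+ 4 * 3 * (2 * K * (4 / c) ^+ M).
have cM0 : 0 < (4 / c) ^+ M by apply: exprn_gt0; exact: divr_gt0.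
have Q0 : 0 < Q.
  by rewrite /Q; apply: mulr_gt0; apply: mulr_gt0 => //; exact: mulr_gt0.
exists (d ^+ 2 / (Q * L)); first by rewrite divr_gt0 ?exprn_gt0 ?mulr_gt0.
move=> n n1; set q := _ / _.
apply: le_ereal_inf_tmp => _ [S [Sb Sr] <-].
have bound (e : R) : (operator_norm H nrm (fun f => (comp_op phi f - S f)%R) <= e%:E)%E ->
    q * kappa ^+ (2 * n) <= e.
  move=> /(approximation_bound n1 Sb Sr) he.
  have n0' : 0 < n%:R :> R by rewrite ltr0n.
  have E : (2 * n)%:R ^+ 4 * 3 * (2 * (K * e) * (2 * (2 * n)%:R / c) ^+ M) =
      Q * n%:R ^+ (4 + M) * e.
    rewrite natrM exprD; have -> : 2 * (2%:R * n%:R) / c = 4 / c * n%:R :> R.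
      by field; rewrite gt_eqF.
    by rewrite /Q [(4 / c * n%:R) ^+ M]exprMn; ring.
  rewrite E in he.
  have s2 : 0 < s ^+ (2 * n) by rewrite exprn_gt0.
  have n4 : 0 < n%:R ^+ (4 + M) :> R by rewrite exprn_gt0.
  have kE : kappa ^+ (2 * n) = s ^+ (2 * n) * x ^+ n.
    by rewrite /x -exprM -exprMn; congr (_ ^+ _); field; rewrite gt_eqF.
  have xn0 : 0 <= x ^+ n by apply: exprn_ge0; case/andP: x01.
  have nL : n%:R ^+ (4 + M) * x ^+ n <= L.
    apply: le_trans (hL n); apply: ler_wpM2r => //.
    by apply: lerXn2r; rewrite ?nnegrE// ler_nat.
  have e0 : 0 <= e.
    have : 0 <= Q * n%:R ^+ (4 + M) * e.
      by apply: le_trans he; apply: mulr_ge0; apply: exprn_ge0; exact: ltW.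
    by rewrite pmulr_rge0// mulr_gt0.
  rewrite /q mulrAC ler_pdivrMr ?mulr_gt0// kE mulrA.
  apply: (@le_trans _ _ (Q * n%:R ^+ (4 + M) * e * x ^+ n)).
    by apply: ler_wpM2r.
  have -> : Q * n%:R ^+ (4 + M) * e * x ^+ n = Q * e * (n%:R ^+ (4 + M) * x ^+ n) by ring.
  have -> : e * (Q * L) = Q * e * L by ring.
  by apply: ler_wpM2l => //; apply: mulr_ge0 => //; exact: ltW.
have q0 : 0 < q * kappa ^+ (2 * n).
  apply: mulr_gt0; last exact: exprn_gt0.
  by apply: divr_gt0; [exact: exprn_gt0|exact: mulr_gt0].
case: (operator_norm _ _ _) bound => [r||] bound.
- by rewrite lee_fin; exact: bound.
- by rewrite leey.
- by have := bound 0 (leNye _); rewrite leNgt q0.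
Qed.

End lower_bound.

(** * The Hardy space *)

Section hardy.
Variable R : realType.
Local Notation C := R[i].
Implicit Types (f g : C -> C) (z w : C).

Lemma taylor_coefE f n : smooth_on_disk f -> taylor_coef f n = tcoef f 0 n.
Proof.
move=> sf; apply: has_expansion_coef; apply: getPex.
have : analytic_on (@disk R) f by apply/analytic_on_diskP.
by move=> /(_ 0); apply; rewrite /disk /= expr0n /= addr0 sqrtr0.
Qed.

Lemma hardy_normE f : smooth_on_disk f -> hardy_norm f =
  ((\sum_(0 <= n <oo) (modulus (tcoef f 0 n) ^+ 2)%:E) `^ 2^-1)%E.
Proof.
move=> sf; congr (_ `^ _)%E; apply: eq_eseriesr => n _.
by rewrite taylor_coefE.
Qed.

Lemma sqr_le_poweR (x e : R) (s : \bar R) : 0 <= x ->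
  ((x ^+ 2)%:E <= s)%E -> (s `^ 2^-1 <= e%:E)%E -> x <= e.
Proof.
move=> x0 xs se.
have : ((x ^+ 2)%:E `^ 2^-1 <= s `^ 2^-1)%E.
  apply: gt0_ler_poweR => //.
    by rewrite in_itv /= leey lee_fin exprn_ge0.
  by rewrite in_itv /= leey (le_trans _ xs)// lee_fin exprn_ge0.
move=> /le_trans/(_ se); rewrite poweR_EFin lee_fin -powR_mulrn// -powRrM.
by rewrite divff ?powRr1// pnatr_eq0.
Qed.

(** Every coefficient is at most the norm; sum the geometric series. *)
Lemma hardy_growth : growth_bound (@hardy_norm R) 1 1.
Proof.
move=> g e sg; rewrite hardy_normE// => ge z z1.
have ce n : modulus (tcoef g 0 n) <= e.
  apply: sqr_le_poweR ge; first exact: modulus_ge0.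
  apply: le_trans; last first.
    by apply: (nneseries_lim_ge n.+1) => k _; rewrite lee_fin exprn_ge0 ?modulus_ge0.
  rewrite big_mkord big_ord_recr /= leeDr// sume_ge0// => k _.
  by rewrite lee_fin exprn_ge0 ?modulus_ge0.
have e0 : 0 <= e by apply: le_trans (ce 0%N); exact: modulus_ge0.
have z0 := modulus_ge0 z; have z1' : 0 < 1 - modulus z by rewrite subr_gt0.
rewrite expr1 mul1r -ler_pdivlMr//; apply/ler_addgt0Pl => eta eta0.
pose r := (1 + modulus z) / 2.
have r0 : 0 < r by rewrite /r; lra.
have zr : modulus z < r by rewrite /r; lra.
have sr w : modulus w <= r -> smooth g w by move=> wr; apply: sg; rewrite /r in wr; lra.
have [N /(_ N (leqnn _)) hN] := taylor_cvg r0 sr zr eta0.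
have -> : g z = psum (tcoef g 0) z N - (psum (tcoef g 0) z N - g z) by rewrite subKr.
apply: le_trans (modulusB _ _) _; rewrite addrC; apply: lerD; first exact: ltW.
apply: le_trans (modulus_sum _ _ _) _.
apply: (@le_trans _ _ (\sum_(k < N) e * modulus z ^+ k)).
  by apply: ler_sum => k _; rewrite modulusM modulusX ler_wpM2r ?exprn_ge0.
rewrite -mulr_sumr ler_wpM2l// -[leRHS]mul1r ler_pdivlMr//.
have := subrX1 (modulus z) N; have := exprn_ge0 N z0; lra.
Qed.

(** In the expansion of the squares, the terms of indices [i != j] cancel by
    [prim_root_sum]. *)
Lemma discrete_parseval M (x : C) (a : nat -> C) : M.-primitive_root x ->
  \sum_(k < M) modulus (\sum_(j < M) a j * (x ^+ k) ^+ j) ^+ 2 =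
  M%:R * \sum_(j < M) modulus (a j) ^+ 2.
Proof.
move=> xM; have M0 := prim_order_gt0 xM.
have x1 : modulus x = 1 by exact: unity_root_modulus (prim_expr_order xM).
have xJ : x^*%C = x^-1.
  have x0 : x != 0 by rewrite -modulus_gt0 x1.
  by apply: (mulfI x0); rewrite mul_conj x1 expr1n divff.
apply: (@complexI R); rewrite rmorphM rmorph_nat /= !rmorph_sum /=.
under eq_bigr => k _ do rewrite -mul_conj rmorph_sum mulr_suml /=.
rewrite mulr_sumr exchange_big /=; apply: eq_bigr => j _.
under eq_bigr => k _ do rewrite mulr_sumr.
rewrite exchange_big /= (bigD1 j)//= [X in _ + X]big1 ?addr0.
  have E k : a j * (x ^+ k) ^+ j * (a j * (x ^+ k) ^+ j)^*%C =
      (modulus (a j) ^+ 2)%:C.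
    by rewrite mul_conj modulusM !modulusX x1 !expr1n mulr1.
  under eq_bigr => k _ do rewrite E.
  by rewrite sumr_const card_ord -[LHS]mulr_natl.
move=> i ij.
have E k : a j * (x ^+ k) ^+ j * (a i * (x ^+ k) ^+ i)^*%C =
    a j * (a i)^*%C * (x ^+ j / x ^+ i) ^+ k.
  rewrite rmorphM /= !rmorphXn /= xJ exprMn -!exprM -exprVn -exprM.
  by rewrite [(j * k)%N]mulnC [(i * k)%N]mulnC; ring.
under eq_bigr => k _ do rewrite E.
rewrite -mulr_sumr (prim_root_sum xM)// eq_sym.
by rewrite (negbTE (ij : i != j :> nat)) mul0r mulr0.
Qed.

Lemma le1_of_geometric (s : R) n : (forall r, 0 < r < 1 -> s * r ^+ n <= 1) -> s <= 1.
Proof.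
move=> h; rewrite leNgt; apply/negP => s1.
have s0 : 0 < s by lra.
pose x : R := (1 - s^-1) / (2 * n.+1%:R).
have sV : s^-1 < 1 by rewrite invf_lt1.
have sV0 : 0 < s^-1 by rewrite invr_gt0.
have n1 : 1 <= n.+1%:R :> R by rewrite ler1n.
have dn : 0 < 2 * n.+1%:R :> R by rewrite mulr_gt0.
have x0 : 0 < x by rewrite divr_gt0// subr_gt0.
have xE : x * (2 * n.+1%:R) = 1 - s^-1 by rewrite /x divfK// gt_eqF.
have x1 : x < 1 by rewrite /x ltr_pdivrMr// mul1r; lra.
have := h (1 - x); rewrite subr_gt0 x1 ltrBlDr ltrDl x0 => /(_ isT).
have := @bernoulli _ x n; rewrite (ltW x0) (ltW x1) => /(_ isT) hb hs.
have : s * (1 - n%:R * x) <= 1 by apply: le_trans hs; rewrite ler_wpM2l// ltW.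
have : s * s^-1 = 1 by rewrite divff// gt_eqF.
move: xE; rewrite -natr1; have := ler0n R n; nra.
Qed.

(** Parseval on a circle of radius [r < 1] for the Taylor polynomial of degree
    less than [M], which is uniformly close to [f] there when [M] is large. *)
Lemma tcoef_sum_sqr_le1 f m : smooth_on_disk f ->
  (forall z, modulus z < 1 -> modulus (f z) <= 1) ->
  \sum_(j < m) modulus (tcoef f 0 j) ^+ 2 <= 1.
Proof.
move=> sf f1; (* It suffices to bound the sum weighted by [r ^+ (2 j) >= r ^+ (2 m)]. *)
apply: (@le1_of_geometric _ (m * 2)) => r /andP[r0 r1].
apply/ler_addgt0Pr => e e0.
pose r' := (1 + r) / 2.
have r'0 : 0 < r' by rewrite /r'; lra.
have r'1 : r' < 1 by rewrite /r'; lra.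
have rr' : 0 <= r / r' < 1.
  by rewrite divr_ge0 ?(ltW r0) ?(ltW r'0)//= ltr_pdivrMr// mul1r /r'; lra.
pose eta := Num.min 1 (e / 3).
have eta0 : 0 < eta by rewrite lt_min ltr01 divr_gt0.
have eta1 : eta <= 1 by rewrite /eta ge_min lexx.
have etae : eta * 3 <= e by rewrite -ler_pdivlMr// /eta ge_min lexx orbT.
have [N hN] := geometric_cvg0 1 rr' eta0.
pose M := (maxn N m).+1.
have [x xM] := prim_root_exists R (ltn0Sn (maxn N m)).
have x1 k : modulus (x ^+ k) = 1.
  by rewrite modulusX (unity_root_modulus _ (prim_expr_order xM)) ?expr1n.
pose a j := tcoef f 0 j * r%:C ^+ j.
have mr : modulus (r%:C : C) = r by rewrite modulus_real gtr0_norm.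
have bound k : modulus (\sum_(j < M) a j * (x ^+ k) ^+ j) <= 1 + eta.
  have -> : \sum_(j < M) a j * (x ^+ k) ^+ j = psum (tcoef f 0) (r%:C * x ^+ k) M.
    by apply: eq_bigr => j _; rewrite /a exprMn mulrA.
  set w := r%:C * _; have mw : modulus w = r by rewrite modulusM mr x1 mulr1.
  have -> : psum (tcoef f 0) w M = f w - (f w - psum (tcoef f 0) w M).
    by rewrite subKr.
  apply: le_trans (modulusB _ _) _; apply: lerD; first by apply: f1; rewrite mw.
  apply: le_trans (@taylor_remainder _ f r' 1 M w r'0 _ _ _) _.
  - by move=> z zr; apply: sf; exact: le_lt_trans r'1.
  - by move=> z zr; apply: f1; rewrite zr.
  - by rewrite mw /r'; lra.
  by rewrite mw; apply/ltW/hN; rewrite /M leqW// leq_maxl.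
have : \sum_(j < M) modulus (a j) ^+ 2 <= (1 + eta) ^+ 2.
  have M0 : 0 < M%:R :> R by rewrite ltr0n.
  rewrite -(ler_pM2l M0) -(discrete_parseval a xM).
  apply: (@le_trans _ _ (\sum_(k < M) (1 + eta) ^+ 2)).
    apply: ler_sum => k _; apply: lerXn2r; rewrite ?nnegrE ?modulus_ge0//.
    by rewrite addr_ge0// ltW.
  by rewrite sumr_const card_ord -[leLHS]mulr_natl.
move=> hM; apply: (@le_trans _ _ ((1 + eta) ^+ 2)); last by nra.
apply: le_trans hM.
have mM : (m <= M)%N by rewrite /M leqW// leq_maxr.
rewrite -(big_mkord xpredT (fun j => modulus (a j) ^+ 2)) (@big_cat_nat _ _ _ m)//=.
rewrite ler_wpDr//; first by rewrite sumr_ge0// => j _; rewrite exprn_ge0 ?modulus_ge0.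
rewrite big_mkord mulr_suml; apply: ler_sum => j _.
rewrite /a modulusM modulusX mr exprMn -exprM ler_wpM2l ?exprn_ge0 ?modulus_ge0//.
by apply: (ler_wiXn2l (ltW r0) (ltW r1)); rewrite leq_mul2r ltnW.
Qed.

Lemma hardy_contains_bounded :
  contains_bounded (bergman_space (-1)) (space_norm (-1)) (1 : R).
Proof.
move=> f sf f0 f1.
have n1 : (hardy_norm f <= 1)%E.
  rewrite hardy_normE// -[leRHS](poweR1r 2^-1).
  have s0 : (0 <= \sum_(0 <= n <oo) (modulus (tcoef f 0 n) ^+ 2)%:E)%E.
    by apply: nneseries_ge0 => n _ _; rewrite lee_fin exprn_ge0 ?modulus_ge0.
  apply: gt0_ler_poweR; rewrite ?in_itv/= ?leey ?s0 ?lee01 ?invr_ge0//.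
  apply: lime_le; first by apply: is_cvg_nneseries => n _ _; rewrite lee_fin exprn_ge0 ?modulus_ge0.
  near=> m; rewrite big_mkord sumEFin lee_fin.
  exact: tcoef_sum_sqr_le1.
have E : space_norm (-1) f = hardy_norm f by rewrite /space_norm eqxx.
split; last by rewrite E.
split; [exact/analytic_on_diskP|exact: f0|].
by rewrite E; apply: le_lt_trans n1 _; rewrite ltry.
Unshelve. all: by end_near.
Qed.

End hardy.

(** * Shears and rotations preserve the area measure *)

Section area.
Variable R : realType.
Local Notation C := R[i].
Local Notation T := (measurableTypeR R).
Local Notation mu := (@lebesgue_measure R).
Local Notation mu2 := (@lebesgue_measure R \x @lebesgue_measure R)%E.
Local Open Scope ereal_scope.

Lemma integral_translate (c : R) (f : T -> \bar R) : measurable_fun setT f ->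
  (forall y, 0 <= f y) -> \int[mu]_y f (y + c)%R = \int[mu]_y f y.
Proof.
move=> mf f0.
have mphi : measurable_fun setT (fun y : T => (y + c)%R : T).
  by apply: measurable_funD; [exact: measurable_id|exact: measurable_cst].
transitivity (\int[pushforward mu (fun y : T => (y + c)%R : T)]_y f y).
  by rewrite ge0_integral_pushforward.
apply: eq_measure_integral => A mA _; apply/esym.
apply: (@lebesgue_measure_unique _ (pushforward mu (fun y : T => (y + c)%R : T))) => //.
move=> _ [[a b] _ <-]; rewrite /pushforward.
rewrite [X in _ = mu X](_ : _ = `](a - c)%R, (b - c)%R]%classic); last first.
  by apply/seteqP; split=> y /=; rewrite !in_itv /= ltrBlDr lerBrDr.
by rewrite !lebesgue_measure_itv /= !lte_fin ltrD2r -!EFinD opprB addrA subrK.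
Qed.

Implicit Type F : T * T -> \bar R.

Lemma integral_shear2 F (h : T -> T) : measurable_fun setT F ->
  measurable_fun setT h -> (forall p, 0 <= F p) ->
  \int[mu2]_p F (p.1, (p.2 + h p.1)%R) = \int[mu2]_p F p.
Proof.
move=> mF mh F0.
have ms : measurable_fun setT (fun p : T * T => (p.1, (p.2 + h p.1)%R) : T * T).
  apply: measurable_fun_pair => //=; apply: measurable_funD => //.
  exact: measurableT_comp.
rewrite [LHS]fubini_tonelli1; last by move=> p; exact: F0.
  2: exact: (measurableT_comp mF).
rewrite (fubini_tonelli1 F mF F0); apply: eq_integral => x _ /=.
apply: (@integral_translate (h x) (fun y => F (x, y))) => //.
exact: measurable_fun_pair2.
Qed.

Lemma integral_shear1 F (h : T -> T) : measurable_fun setT F ->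
  measurable_fun setT h -> (forall p, 0 <= F p) ->
  \int[mu2]_p F ((p.1 + h p.2)%R, p.2) = \int[mu2]_p F p.
Proof.
move=> mF mh F0.
have ms : measurable_fun setT (fun p : T * T => ((p.1 + h p.2)%R, p.2) : T * T).
  apply: measurable_fun_pair => //=; apply: measurable_funD => //.
  exact: measurableT_comp.
rewrite [LHS]fubini_tonelli2; last by move=> p; exact: F0.
  2: exact: (measurableT_comp mF).
rewrite (fubini_tonelli2 F mF F0); apply: eq_integral => y _ /=.
apply: (@integral_translate (h y) (fun x => F (x, y))) => //.
exact: measurable_fun_pair1.
Qed.

(** A rotation that is not plus or minus the identity is the product of three
    shears. *)
Lemma integral_rotation F (c s : R) : measurable_fun setT F ->
  (forall p, 0 <= F p) -> s != 0%R -> (c ^+ 2 + s ^+ 2 = 1)%R ->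
  \int[mu2]_p F ((c * p.1 - s * p.2)%R, (s * p.1 + c * p.2)%R) = \int[mu2]_p F p.
Proof.
move=> mF F0 s0 cs; pose t := ((c - 1) / s)%R.
have mlin (a : R) : measurable_fun setT (fun x : T => (a * x)%R : T).
  by apply: measurable_funM; [exact: measurable_cst|exact: measurable_id].
have ms2 (a : R) : measurable_fun setT (fun p : T * T => (p.1, (p.2 + a * p.1)%R) : T * T).
  apply: measurable_fun_pair => //=; apply: measurable_funD => //.
  by apply: measurable_funM => //; exact: measurable_cst.
have ms1 (a : R) : measurable_fun setT (fun p : T * T => ((p.1 + a * p.2)%R, p.2) : T * T).
  apply: measurable_fun_pair => //=; apply: measurable_funD => //.
  by apply: measurable_funM => //; exact: measurable_cst.
rewrite -[RHS](@integral_shear1 _ (fun y => (t * y)%R))//.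
rewrite -[RHS](@integral_shear2 _ (fun x => (s * x)%R))//; last exact: (measurableT_comp mF).
rewrite -[RHS](@integral_shear1 _ (fun y => (t * y)%R))//; last first.
  by apply: (measurableT_comp mF); apply: (measurableT_comp (ms1 t)) => //; exact: ms2.
apply: eq_integral => p _ /=; congr F; congr (_, _).
  rewrite /t; have : (1 - c ^+ 2 = s ^+ 2)%R by rewrite -cs addrAC subrr add0r.
  move=> E; apply: (mulIf s0).
  have -> : ((c * p.1 - s * p.2) * s = c * p.1 * s - s ^+ 2 * p.2)%R by ring.
  by rewrite -E; field.
by rewrite /t; field.
Qed.

End area.

(** * The area mean value inequality *)

Section submean.
Variable R : realType.
Local Notation C := R[i].
Implicit Types (f g : C -> C) (p z w : C).

(** The average of [g (x ^+ k * w)] over [k] is [g 0] up to the remainder of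
    order [M], since the roots of unity annihilate the powers between 1 and
    [M - 1]; half of [|g 0|] remains once [M] is large. *)
Lemma root_average g (r r' : R) : 0 <= r -> r < r' ->
  (forall z, modulus z <= r' -> smooth g z) ->
  exists M (x : C), [/\ (2 < M)%N, M.-primitive_root x & forall w, modulus w <= r ->
    M%:R * (modulus (g 0) ^+ 2 / 4) <= \sum_(k < M) modulus (g (x ^+ k * w)) ^+ 2].
Proof.
move=> r0 rr' sg; have r'0 : 0 < r' by exact: le_lt_trans rr'.
have s0 : smooth g 0 by apply: sg; rewrite modulus0 ltW.
have [B B0 hB] := smooth_bounded (ltW r'0) sg.
have [N hN] : exists N, forall n, (N <= n)%N -> 0 < modulus (g 0) ->
    n.+1%:R * B * (r / r') ^+ n < modulus (g 0) / 2.
  have [g0|g0] := ltP 0 (modulus (g 0)); last by exists 0%N.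
  have [||N hN] := @geometric_cvg0 _ B (r / r') (modulus (g 0) / 2).
  - by rewrite divr_ge0 ?(ltW r'0)//= ltr_pdivrMr ?mul1r.
  - exact: divr_gt0.
  by exists N => n /hN.
pose M := (maxn 2 N).+1.
have M0 : 0 < M%:R :> R by rewrite ltr0n.
have [x xM] := prim_root_exists R (ltn0Sn (maxn 2 N)).
have x1 k : modulus (x ^+ k) = 1.
  by rewrite modulusX (unity_root_modulus _ (prim_expr_order xM)) ?expr1n.
exists M, x; split=> // [|w wr]; first by rewrite ltnS leq_maxl.
have [g00|] := ltP 0 (modulus (g 0)); last first.
  move=> g00; have -> : modulus (g 0) = 0 by apply/eqP; rewrite eq_le g00 modulus_ge0.
  by rewrite expr0n mul0r mulr0 sumr_ge0// => k _; rewrite exprn_ge0 ?modulus_ge0.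
set m := modulus (g 0) / 2; have m0 : 0 <= m by rewrite divr_ge0 ?modulus_ge0.
have avg : \sum_(k < M) psum (tcoef g 0) (x ^+ k * w) M = M%:R * g 0.
  rewrite /psum exchange_big /= big_ord_recl [X in _ + X]big1 ?addr0 => [|i _].
    under eq_bigr do rewrite expr0 mulr1.
    by rewrite sumr_const card_ord tcoef0// -[LHS]mulr_natl.
  under eq_bigr => k _ do rewrite exprMn mulrCA mulrC -exprM mulnC exprM.
  rewrite -mulr_sumr.
  have := @prim_root_sum R M x (lift ord0 i) 0 xM (ltn_ord _) (ltn0Sn _).
  rewrite expr0 mul0r; under eq_bigr do rewrite divr1.
  by move=> ->; rewrite mulr0.
have tl : M%:R * m <= \sum_(k < M) modulus (g (x ^+ k * w)).
  have h1 : M%:R * modulus (g 0) <=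
      \sum_(k < M) modulus (psum (tcoef g 0) (x ^+ k * w) M).
    by rewrite -modulus_nat -modulusM -avg; exact: modulus_sum.
  have h2 : \sum_(k < M) modulus (psum (tcoef g 0) (x ^+ k * w) M) <=
      \sum_(k < M) (modulus (g (x ^+ k * w)) + m).
    apply: ler_sum => k _; set z := x ^+ k * w.
    have zr : modulus z <= r by rewrite /z modulusM x1 mul1r.
    have : modulus (g z - psum (tcoef g 0) z M) <= m.
      apply: le_trans (@taylor_remainder _ g r' B M z r'0 sg _ _) _.
      - by move=> y yr; apply: hB; rewrite yr.
      - by apply: le_trans zr _; exact: ltW.
      have NM : (N <= M)%N by rewrite leqW// leq_maxr.
      apply: le_trans (ltW (hN _ NM g00)).
      rewrite ler_wpM2l ?mulr_ge0//; apply: lerXn2r; rewrite ?nnegrE ?divr_ge0 ?modulus_ge0 ?(ltW r'0)//.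
      by rewrite ler_pM2r ?invr_gt0.
    have := modulusB (g z) (g z - psum (tcoef g 0) z M); rewrite subKr; lra.
  rewrite big_split /= sumr_const card_ord -[X in _ + X]mulr_natl in h2.
  have E : M%:R * modulus (g 0) = M%:R * m + M%:R * m by rewrite /m; field.
  by move: h1 h2; rewrite E; lra.
have -> : modulus (g 0) ^+ 2 / 4 = m ^+ 2 by rewrite /m; field.
(* The squares are bounded below by [t ^+ 2 >= 2 m t - m ^+ 2]. *)
have : \sum_(k < M) (2 * m * modulus (g (x ^+ k * w)) - m ^+ 2) <=
   \sum_(k < M) modulus (g (x ^+ k * w)) ^+ 2.
  apply: ler_sum => k _; set t := modulus _.
  by have := sqr_ge0 (t - m); rewrite sqrrB; lra.
apply: le_trans.
rewrite big_split /= sumr_const card_ord -[X in _ + X]mulr_natl -mulr_sumr.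
have : m * (M%:R * m) <= m * \sum_(k < M) modulus (g (x ^+ k * w)) by rewrite ler_wpM2l.
by rewrite expr2; lra.
Qed.

Local Notation T := (measurableTypeR R).
Local Notation mu := (@lebesgue_measure R).
Local Notation mu2 := (@lebesgue_measure R \x @lebesgue_measure R)%E.
Local Notation pt q := (q.1 +i* q.2 : C).

Lemma measurable_sqr_dist p :
  measurable_fun setT (fun q : T * T => modulus (pt q - p) ^+ 2 : T).
Proof.
have -> : (fun q : T * T => modulus (pt q - p) ^+ 2 : T) = fun q =>
   (q.1 - complex.Re p) * (q.1 - complex.Re p) +
   (q.2 - complex.Im p) * (q.2 - complex.Im p).
  by apply/funext => q; rewrite sqr_modulus -!expr2; case: (p).
by apply: measurable_funD; apply: measurable_funM; apply: measurable_funB => //;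
  exact: measurable_cst.
Qed.

Lemma measurable_disk p (r : R) : 0 <= r ->
  measurable [set q : T * T | modulus (pt q - p) < r].
Proof.
move=> r0.
have -> : [set q : T * T | modulus (pt q - p) < r] =
   setT `&` (fun q : T * T => modulus (pt q - p) ^+ 2 : T) @^-1` [set` `]-oo, (r ^+ 2)[%R].
  have E q : (modulus (pt q - p) ^+ 2 \in `]-oo, (r ^+ 2)[%R) = (modulus (pt q - p) < r).
    by rewrite in_itv /= ltr_pXn2r ?nnegrE ?modulus_ge0.
  apply/seteqP; split => [q qr|q [_ qr]]; first by split => //; exact: etrans (E q) qr.
  exact: etrans (esym (E q)) qr.
by apply: measurable_sqr_dist => //; exact: measurable_itv.
Qed.

Definition unit_disk2 : set (T * T) := [set q | modulus (pt q) < 1].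

Lemma measurable_unit_disk2 : measurable unit_disk2.
Proof.
have := measurable_disk 0 (@ler01 R); congr measurable.
by apply/seteqP; split => q; rewrite /mkset /unit_disk2 subr0.
Qed.

Lemma measurable_psum (c : nat -> C) n :
  measurable_fun setT (fun q : T * T => complex.Re (psum c (pt q) n) : T) /\
  measurable_fun setT (fun q : T * T => complex.Im (psum c (pt q) n) : T).
Proof.
pose mc (f : T * T -> C) :=
  measurable_fun setT (fun q => complex.Re (f q) : T) /\
  measurable_fun setT (fun q => complex.Im (f q) : T).
have mM (f g : T * T -> C) : mc f -> mc g -> mc (fun q => f q * g q).
  move=> [f1 f2] [g1 g2]; split.
    rewrite (_ : (fun _ => _) = fun q => complex.Re (f q) * complex.Re (g q) -
        complex.Im (f q) * complex.Im (g q)).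
      by apply: measurable_funB; exact: measurable_funM.
    by apply/funext => q; case: (f q) (g q) => a b [a' b'].
  rewrite (_ : (fun _ => _) = fun q => complex.Re (f q) * complex.Im (g q) +
      complex.Im (f q) * complex.Re (g q)).
    by apply: measurable_funD; exact: measurable_funM.
  by apply/funext => q; case: (f q) (g q) => a b [a' b'].
have mcst (a : C) : mc (fun=> a) by split; exact: measurable_cst.
have mpt : mc (fun q => pt q) by split; [exact: measurable_fst|exact: measurable_snd].
have mX k : mc (fun q => pt q ^+ k).
  elim: k => [|k IH]; first by under eq_fun do rewrite expr0; exact: mcst.
  by under eq_fun do rewrite exprS; exact: mM.
suff : mc (fun q => psum c (pt q) n) by [].
elim: n => [|n [IH1 IH2]].
  by rewrite /psum; under eq_fun do rewrite big_ord0; exact: mcst.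
have [h1 h2] := mM _ _ (mcst (c n)) (mX n).
split.
  rewrite (_ : (fun _ => _) = fun q => complex.Re (psum c (pt q) n) +
      complex.Re (c n * pt q ^+ n)); first exact: measurable_funD.
  by apply/funext => q; rewrite /psum big_ord_recr /= -ReD.
rewrite (_ : (fun _ => _) = fun q => complex.Im (psum c (pt q) n) +
    complex.Im (c n * pt q ^+ n)); first exact: measurable_funD.
apply/funext => q; rewrite /psum big_ord_recr /=.
by case: (\sum_(_ < _) _) (c n * _) => a b [a' b'].
Qed.

(** As a limit of polynomials, by Taylor's expansion on the whole disk. *)
Lemma measurable_sqr_modulus g : smooth_on_disk g ->
  measurable_fun unit_disk2 (fun q : T * T => modulus (g (pt q)) ^+ 2 : T).
Proof.
move=> sg.
apply: (@measurable_fun_cvg _ _ R unit_disk2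
  (fun n (q : T * T) => modulus (psum (tcoef g 0) (pt q) n) ^+ 2)).
- move=> n; apply: measurable_funTS.
  have [h1 h2] := measurable_psum (tcoef g 0) n.
  rewrite (_ : (fun _ => _) = fun q => complex.Re (psum (tcoef g 0) (pt q) n) *
     complex.Re (psum (tcoef g 0) (pt q) n) + complex.Im (psum (tcoef g 0) (pt q) n) *
     complex.Im (psum (tcoef g 0) (pt q) n)).
    by apply: measurable_funD; exact: measurable_funM.
  by apply/funext => q; rewrite sqr_modulus !expr2.
move=> q; rewrite /unit_disk2 /mkset; set z := pt q => z1.
suff h : (fun n => modulus (psum (tcoef g 0) z n)) @ \oo --> modulus (g z).
  under eq_fun do rewrite expr2; rewrite expr2; exact: cvgM.
apply/cvgrPdist_lt => e e0; have z0 := modulus_ge0 z.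
pose r := (1 + modulus z) / 2.
have [|||N hN] := @taylor_cvg R g r z e _ _ _ e0.
- by rewrite /r; lra.
- by move=> w; rewrite /r => wr; apply: sg; lra.
- by rewrite /r; lra.
exists N => // n /= /hN; apply: le_lt_trans; rewrite modulus_distC.
exact: modulus_lip.
Qed.

End submean.

Section bergman_growth.
Variable R : realType.
Local Notation C := R[i].
Implicit Types (f g : C -> C) (p z w a : C).
Local Notation T := (measurableTypeR R).
Local Notation mu := (@lebesgue_measure R).
Local Notation mu2 := (@lebesgue_measure R \x @lebesgue_measure R)%E.
Local Notation pt q := (q.1 +i* q.2 : C).
Implicit Type F : T * T -> \bar R.

Definition rotation2 a (q : T * T) : T * T :=
  (complex.Re (a * pt q), complex.Im (a * pt q)).

Definition translation2 p (q : T * T) : T * T :=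
  (q.1 + complex.Re p, q.2 + complex.Im p).

Lemma rotation2E a q : pt (rotation2 a q) = a * pt q.
Proof. by rewrite /rotation2; case: (a * pt q). Qed.

Lemma translation2E p q : pt (translation2 p q) = p + pt q.
Proof. by case: p => x y; rewrite /translation2 /= addrC [q.2 + _]addrC. Qed.

Lemma measurable_rotation2 a : measurable_fun setT (rotation2 a).
Proof.
case: a => c s; apply: measurable_fun_pair.
  by apply: measurable_funB; apply: measurable_funM => //; exact: measurable_cst.
by apply: measurable_funD; apply: measurable_funM => //; exact: measurable_cst.
Qed.

Lemma measurable_translation2 p : measurable_fun setT (translation2 p).
Proof.
by apply: measurable_fun_pair; apply: measurable_funD => //; exact: measurable_cst.
Qed.

Lemma integral_rotation2 F a : measurable_fun setT F -> (forall q, 0 <= F q)%E ->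
  modulus a = 1 -> complex.Im a != 0 ->
  (\int[mu2]_q F (rotation2 a q) = \int[mu2]_q F q)%E.
Proof.
move=> mF F0 a1 ai.
rewrite -[RHS](@integral_rotation R F (complex.Re a) (complex.Im a))//; last first.
  by rewrite -sqr_modulus a1 expr1n.
apply: eq_integral => q _; congr F; rewrite /rotation2.
by case: (a) => c s /=; congr (_, _); rewrite addrC.
Qed.

Lemma integral_rotation2X F a k : measurable_fun setT F ->
  (forall q, 0 <= F q)%E -> modulus a = 1 -> complex.Im a != 0 ->
  (\int[mu2]_q F (rotation2 (a ^+ k)%R q) = \int[mu2]_q F q)%E.
Proof.
move=> mF F0 a1 ai; elim: k => [|k IH].
  apply: eq_integral => q _; congr F; rewrite /rotation2 expr0 mul1r.
  by case: q.
rewrite -IH -(@integral_rotation2 (F \o rotation2 (a ^+ k)) a)//.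
  by apply: eq_integral => q _; rewrite /comp {2}/rotation2 rotation2E mulrA -exprSr.
  by apply: measurableT_comp => //; exact: measurable_rotation2.
by move=> q; exact: F0.
Qed.

Lemma integral_translation2 F p : measurable_fun setT F ->
  (forall q, 0 <= F q)%E ->
  (\int[mu2]_q F (translation2 p q) = \int[mu2]_q F q)%E.
Proof.
move=> mF F0.
rewrite -[RHS](@integral_shear1 R F (cst (complex.Re p)))//.
rewrite -[RHS](@integral_shear2 R _ (cst (complex.Im p)))//.
apply: (measurableT_comp mF); apply: measurable_fun_pair => //.
by apply: measurable_funD => //; exact: measurable_cst.
Qed.

Lemma Im_prim_root M a : M.-primitive_root a -> (2 < M)%N -> complex.Im a != 0.
Proof.
move=> aM M2; apply/eqP => a0.
have a1 : modulus a = 1.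
  exact: unity_root_modulus (prim_order_gt0 aM) (prim_expr_order aM).
have : a ^+ 2 == 1.
  have := sqr_modulus a; rewrite a1 a0 expr1n expr0n addr0 expr2 => h.
  case: (a) a0 h => x y /= -> h; rewrite expr2; simpc.
  by rewrite -h.
by rewrite -(prim_order_dvd aM) => /(dvdn_leq (ltn0Sn 1)); rewrite leqNgt M2.
Qed.

Lemma area_disk_ge (r : R) : 0 < r ->
  (((r / 2) ^+ 2)%:E <= mu2 [set q : T * T | (modulus (pt q) < r)%R])%E.
Proof.
move=> r0; have r20 : 0 < r / 2 by rewrite divr_gt0.
have m2 : measurable [set q : T * T | modulus (pt q) < r].
  have := measurable_disk 0 (ltW r0); congr measurable.
  by apply/seteqP; split => q; rewrite /mkset subr0.
apply: (@le_trans _ _ (mu2 (`]0, r / 2]%classic `*` `]0, r / 2]%classic))).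
  have E : mu `]0, r / 2]%classic = (r / 2)%:E.
    by rewrite lebesgue_measure_itv /= lte_fin r20 sube0.
  rewrite expr2 EFinM product_measure1E//.
  by rewrite le_eqVlt; apply/orP; left; apply/eqP; congr (_ * _)%E; rewrite -E.
apply: le_measure; rewrite ?inE//; first exact: measurableX.
move=> q [/=]; rewrite !in_itv /= => /andP[q10 q1] /andP[q20 q2]; rewrite /mkset.
have : modulus (pt q) ^+ 2 < r ^+ 2 by rewrite sqr_modulus /=; nra.
by rewrite ltr_pXn2r ?nnegrE ?modulus_ge0 ?(ltW r0).
Qed.

Lemma sume_const_ge0 (s : \bar R) M : (0 <= s)%E ->
  (\sum_(k < M) s = M%:R%:E * s)%E.
Proof.
move=> s0; elim: M => [|M IH]; first by rewrite big_ord0 mul0e.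
by rewrite big_ord_recr /= IH -natr1 EFinD ge0_muleDl ?lee_fin ?mul1e.
Qed.

(** The area mean value inequality, up to a constant. The mean over a circle
    is replaced by the one over the points [x ^+ k * w], [x] a root of unity:
    the rotations by [x ^+ k] preserve the area of the disk. *)
Lemma area_submean g p : smooth_on_disk g -> modulus p < 1 ->
  ((modulus (g p) ^+ 2 / 4 * ((1 - modulus p) / 4) ^+ 2)%:E <=
   \int[mu2]_(q in [set q : T * T | (modulus (pt q - p) < (1 - modulus p) / 2)%R])
     (modulus (g (pt q)) ^+ 2)%:E)%E.
Proof.
move=> sg p1; set r := (1 - modulus p) / 2.
have p0 := modulus_ge0 p.
have r0 : 0 < r by rewrite divr_gt0// subr_gt0.
have -> : (1 - modulus p) / 4 = r / 2 by rewrite /r; field.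
set B := [set q | _].
have mB : measurable B by apply: measurable_disk; exact: ltW.
pose F : T * T -> \bar R := (fun q => (modulus (g (pt q)) ^+ 2)%:E) \_ B.
have BD : B `<=` @unit_disk2 R.
  move=> q; rewrite /B /unit_disk2 /mkset => qr.
  by have := modulusD (pt q - p) p; rewrite subrK; move: qr; rewrite /r; lra.
have F0 q : (0 <= F q)%E.
  by rewrite /F patchE; case: ifP => // _; rewrite lee_fin exprn_ge0 ?modulus_ge0.
have mF : measurable_fun setT F.
  apply/(measurable_restrictT _ mB); apply/measurable_EFinP.
  by apply: measurable_funS (measurable_sqr_modulus sg) => //; exact: measurable_unit_disk2.
rewrite integral_mkcond -/F.
pose G := F \o translation2 p.
have mG : measurable_fun setT G.
  by apply: measurableT_comp => //; exact: measurable_translation2.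
have G0 q : (0 <= G q)%E by exact: F0.
have GE q : modulus (pt q) < r -> G q = (modulus (g (p + pt q)) ^+ 2)%:E.
  move=> qr; rewrite /G /F /comp patchE translation2E mem_set//.
  by rewrite /B /mkset translation2E addrAC subrr add0r.
rewrite -(integral_translation2 p)// -/G.
have rr : r < (1 - modulus p) * (3 / 4) by rewrite /r; lra.
have sgp z : modulus z <= (1 - modulus p) * (3 / 4) -> smooth (fun z => g (p + z)) z.
  move=> zr; apply: smooth_shift; apply: sg.
  by apply: le_lt_trans (modulusD _ _) _; lra.
have [M [x [M2 xM avg]]] := root_average (ltW r0) rr sgp.
rewrite /= addr0 in avg.
have x1 : modulus x = 1.
  exact: unity_root_modulus (prim_order_gt0 xM) (prim_expr_order xM).
have xi := Im_prim_root xM M2.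
set A := modulus (g p) ^+ 2 / 4.
have A0 : 0 <= A by rewrite divr_ge0 ?exprn_ge0 ?modulus_ge0.
have M0 : 0 < M%:R :> R by rewrite ltr0n (ltn_trans _ M2).
set B0 := [set q : T * T | modulus (pt q) < r].
have mB0 : measurable B0.
  have := measurable_disk 0 (ltW r0); congr measurable.
  by apply/seteqP; split => q; rewrite /B0 /mkset subr0.
have mGx k : measurable_fun setT (G \o rotation2 (x ^+ k)).
  by apply: measurableT_comp => //; exact: measurable_rotation2.
have key : ((M%:R * A)%:E * mu2 B0 <= M%:R%:E * \int[mu2]_q G q)%E.
  rewrite -integral_cst//.
  apply: (@le_trans _ _ (\int[mu2]_(q in B0) \sum_(k < M) (G \o rotation2 (x ^+ k)%R) q)%E).
    apply: ge0_le_integral => //.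
    - by move=> q _ /=; rewrite lee_fin mulr_ge0// ltW.
    - apply: emeasurable_sum => k; exact: measurable_funTS.
    move=> q qr; have {}qr : modulus (pt q) < r by exact: qr.
    have := avg _ (ltW qr); rewrite -lee_fin -sumEFin => /le_trans; apply.
    apply: lee_sum => k _; rewrite /= GE ?rotation2E//.
    by rewrite modulusM modulusX x1 expr1n mul1r.
  apply: (@le_trans _ _ (\int[mu2]_q \sum_(k < M) (G \o rotation2 (x ^+ k)%R) q)%E).
    apply: ge0_subset_integral => //.
    - by apply: emeasurable_sum => k.
    - by move=> q _; apply: sume_ge0 => k _; exact: G0.
  rewrite ge0_integral_sum//; last by move=> k q _; exact: G0.
  under eq_bigr => k _ do rewrite (integral_rotation2X k)//.
  by rewrite sume_const_ge0//; apply: integral_ge0 => q _; exact: G0.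
have := area_disk_ge r0; rewrite -/B0 => hB.
have hA : ((M%:R * A)%:E * ((r / 2) ^+ 2)%:E <= M%:R%:E * \int[mu2]_q G q)%E.
  apply: le_trans key; apply: lee_pmul => //.
  - by rewrite lee_fin mulr_ge0// ltW.
  - by rewrite lee_fin exprn_ge0// divr_ge0// ltW.
by move: hA; rewrite -EFinM -mulrA EFinM lee_pmul2l.
Qed.

End bergman_growth.

(** * Integrability of the Bergman weight *)

Section bergman_weight.
Variable R : realType.
Local Notation C := R[i].
Local Notation T := (measurableTypeR R).
Local Notation mu := (@lebesgue_measure R).
Local Notation mu2 := (@lebesgue_measure R \x @lebesgue_measure R)%E.
Local Notation pt q := (q.1 +i* q.2 : C).
Local Notation disk2 := (@unit_disk2 R).
Implicit Types (V : set (T * T)) (e : R).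

Lemma measure_le_itv (A : set T) (a e : R) : measurable A -> 0 <= e ->
  (forall y : R, A y -> a <= y <= a + e) -> (mu A <= e%:E)%E.
Proof.
move=> mA e0 Aa; apply: (@le_trans _ _ (mu `[a, a + e]%classic)).
  by apply: le_measure; rewrite ?inE// => y /Aa; rewrite /= in_itv.
rewrite lebesgue_measure_itv /= lte_fin ltrDl; case: ifP => _; last by rewrite lee_fin.
by rewrite -EFinD addrAC subrr add0r.
Qed.

Lemma indicator_strip (f : T -> \bar R) e : measurable_fun setT f -> 0 <= e ->
  (forall x, 0 <= f x)%E -> (forall x : R, -1 <= x <= 1 -> (f x <= e%:E)%E) ->
  (forall x : R, ~~ (-1 <= x <= 1) -> f x = 0%E) ->
  (\int[mu]_x f x <= (2 * e)%:E)%E.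
Proof.
move=> mf e0 f0 fe fout.
pose I : set T := `[-1, 1]%classic.
have mI : measurable I by exact: measurable_itv.
apply: (@le_trans _ _ (\int[mu]_(x in I) f x)%E).
  rewrite [leRHS]integral_mkcond le_eqVlt; apply/orP; left; apply/eqP.
  apply: eq_integral => x _; rewrite patchE; case: ifP => // /negP h.
  apply: fout; apply/negP => hx; apply: h; apply/mem_set.
  by rewrite /I /= in_itv.
apply: (@le_trans _ _ (\int[mu]_(x in I) (cst e%:E) x)%E).
  by apply: ge0_le_integral => //; exact: measurable_funTS.
rewrite integral_cst//.
have E : mu I = 2%:E.
  rewrite /I lebesgue_measure_itv /= lte_fin; have -> : (-1 < 1 :> R) by lra.
  by rewrite -EFinD opprK.
by rewrite mulrC EFinM; apply: lee_pmul => //; rewrite ?lee_fin// -E.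
Qed.

(** By Fubini, from the length of the sections. *)
Lemma strip_measure1 V e : measurable V -> 0 <= e ->
  (forall x y : R, V (x, y) -> -1 <= x <= 1) ->
  (forall x : R, exists a : R, forall y : R, V (x, y) -> a <= y <= a + e) ->
  (mu2 V <= (2 * e)%:E)%E.
Proof.
move=> mV e0 V1 V2.
have -> : mu2 V = (\int[mu2]_q (\1_V q)%:E)%E by rewrite integral_indic// setIT.
have mI : measurable_fun setT (fun q : T * T => (\1_V q : R)%:E).
  by apply/measurable_EFinP.
rewrite fubini_tonelli1//.
apply: indicator_strip => //.
- exact: measurable_fun_fubini_tonelli_F.
- by move=> x; apply: integral_ge0 => y _; rewrite lee_fin.
- move=> x _; have [a ha] := V2 x.
  have mx : measurable (xsection V x) by exact: measurable_xsection.
  have -> : fubini_F mu (fun q : T * T => (\1_V q : R)%:E) x =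
      mu (xsection V x).
    rewrite /fubini_F -[in RHS](setIT (xsection V x)) -integral_indic//.
    by apply: eq_integral => y _; rewrite !indicE mem_xsection.
  by apply: (measure_le_itv mx e0 (a := a)) => y; rewrite /xsection /= => /set_mem /ha.
- move=> x /negP hx; rewrite /fubini_F integral0_eq// => y _.
  by rewrite indicE memNset// => /V1.
Qed.

Lemma strip_measure2 V e : measurable V -> 0 <= e ->
  (forall x y : R, V (x, y) -> -1 <= y <= 1) ->
  (forall y : R, exists a : R, forall x : R, V (x, y) -> a <= x <= a + e) ->
  (mu2 V <= (2 * e)%:E)%E.
Proof.
move=> mV e0 V1 V2.
have -> : mu2 V = (\int[mu2]_q (\1_V q)%:E)%E by rewrite integral_indic// setIT.
have mI : measurable_fun setT (fun q : T * T => (\1_V q : R)%:E).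
  by apply/measurable_EFinP.
rewrite fubini_tonelli2//.
apply: indicator_strip => //.
- exact: measurable_fun_fubini_tonelli_G.
- by move=> y; apply: integral_ge0 => x _; rewrite lee_fin.
- move=> y _; have [a ha] := V2 y.
  have my : measurable (ysection V y) by exact: measurable_ysection.
  have -> : fubini_G mu (fun q : T * T => (\1_V q : R)%:E) y =
      mu (ysection V y).
    rewrite /fubini_G -[in RHS](setIT (ysection V y)) -integral_indic//.
    by apply: eq_integral => x _; rewrite !indicE mem_ysection.
  by apply: (measure_le_itv my e0 (a := a)) => x; rewrite /ysection /= => /set_mem /ha.
- move=> y /negP hy; rewrite /fubini_G integral0_eq// => x _.
  by rewrite indicE memNset// => /V1.
Qed.

Definition boundary_ring e : set (T * T) :=
  [set q | 0 < 1 - modulus (pt q) ^+ 2 <= e].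

Lemma boundary_ringE e (x y : R) :
  boundary_ring e (x, y) = (0 < 1 - (x ^+ 2 + y ^+ 2) <= e) :> Prop.
Proof. by rewrite /boundary_ring /mkset sqr_modulus. Qed.

Lemma measurable_boundary_ring e : measurable (boundary_ring e).
Proof.
have -> : boundary_ring e = setT `&`
   (fun q : T * T => modulus (pt q - 0) ^+ 2 : T) @^-1` [set` `[1 - e, 1[%R].
  have E q : (modulus (pt q - 0) ^+ 2 \in `[1 - e, 1[%R) =
     (0 < 1 - modulus (pt q) ^+ 2 <= e).
    by rewrite subr0; set t := modulus _ ^+ 2; rewrite in_itv /=; apply/andP/andP => -[h1 h2]; split; lra.
  apply/seteqP; split => [q qr|q [_ qr]]; first by split => //; exact: etrans (E q) qr.
  exact: etrans (esym (E q)) qr.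
by apply: measurable_sqr_dist => //; exact: measurable_itv.
Qed.

(** With [s = sqrt (1 - x ^+ 2)], the inequality
    [1 - x ^+ 2 - y ^+ 2 = (s - y) (s + y) <= e] forces [s - y <= e] when
    [y >= 1 / 2]. *)
Lemma ring_section (x e : R) : exists s : R, forall y : R,
  0 < 1 - (x ^+ 2 + y ^+ 2) <= e -> 2^-1 <= y -> s - e <= y <= s.
Proof.
exists (Num.sqrt (1 - x ^+ 2)) => y /andP[h1 h2] y2.
have x1 : 0 <= 1 - x ^+ 2 by have := sqr_ge0 y; lra.
have := sqr_sqrtr x1; set s := Num.sqrt _ => sE.
have s0 : 0 <= s by exact: sqrtr_ge0.
have ys : y < s by nra.
apply/andP; split; last exact: ltW.
by have : (s - y) * (s + y) <= e; nra.
Qed.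

(** For small [e] one of the coordinates is at least [1 / 2] in absolute value on
    the ring; on each of the four corresponding pieces the sections in that
    direction are contained in intervals of length [e]. *)
Lemma boundary_ring_measure e : 0 < e -> (mu2 (boundary_ring e) <= (8 * e)%:E)%E.
Proof.
move=> e0.
pose A := boundary_ring e.
have mA : measurable A by exact: measurable_boundary_ring.
have e0' := ltW e0.
have sq1 (x y : R) : A (x, y) -> (-1 <= x <= 1) && (-1 <= y <= 1).
  rewrite /A boundary_ringE => /andP[h _].
  have := sqr_ge0 x; have := sqr_ge0 y => y2 x2.
  by apply/andP; split; apply/andP; split; nra.
have [e2|e2] := ltP 2^-1 e.
  apply: (@le_trans _ _ (2 * 2)%:E); last by rewrite lee_fin; lra.
  apply: strip_measure1 => // [x y /sq1/andP[] //|x].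
  by exists (-1) => y' /sq1/andP[_ /andP[h1 h2]]; apply/andP; split; lra.
pose h i : set (T * T) := match i with
  | 0%N => [set q | 2^-1 <= q.2] | 1%N => [set q | q.2 <= - 2^-1]
  | 2%N => [set q | 2^-1 <= q.1] | _ => [set q | q.1 <= - 2^-1] end.
have mh i : measurable (h i).
  have m1 : measurable [set q : T * T | 2^-1 <= q.2].
    have := @measurable_snd _ _ T T measurableT _ (measurable_itv `[2^-1, +oo[%R).
    by rewrite setTI; congr measurable; apply/seteqP; split => q /=; rewrite in_itv /= andbT.
  have m2 : measurable [set q : T * T | q.2 <= - 2^-1].
    have := @measurable_snd _ _ T T measurableT _ (measurable_itv `]-oo, (- 2^-1)]%R).
    by rewrite setTI; congr measurable; apply/seteqP; split => q /=; rewrite in_itv /=.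
  have m3 : measurable [set q : T * T | 2^-1 <= q.1].
    have := @measurable_fst _ _ T T measurableT _ (measurable_itv `[2^-1, +oo[%R).
    by rewrite setTI; congr measurable; apply/seteqP; split => q /=; rewrite in_itv /= andbT.
  have m4 : measurable [set q : T * T | q.1 <= - 2^-1].
    have := @measurable_fst _ _ T T measurableT _ (measurable_itv `]-oo, (- 2^-1)]%R).
    by rewrite setTI; congr measurable; apply/seteqP; split => q /=; rewrite in_itv /=.
  by case: i => [//|[//|[//|//]]].
have mAh i : measurable (A `&` h i) by exact: measurableI.
have b0 : (mu2 (A `&` h 0%N) <= (2 * e)%:E)%E.
  apply: strip_measure1 => // [x y [/sq1/andP[] //]|x].
  have [s hs] := ring_section x e; exists (s - e) => y [].
  by rewrite /A boundary_ringE /= subrK; exact: hs.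
have b1 : (mu2 (A `&` h 1%N) <= (2 * e)%:E)%E.
  apply: strip_measure1 => // [x y [/sq1/andP[] //]|x].
  have [s hs] := ring_section x e; exists (- s) => y [].
  rewrite /A boundary_ringE /= => hy y2.
  by have := hs (- y); rewrite sqrrN => /(_ hy); lra.
have b2 : (mu2 (A `&` h 2%N) <= (2 * e)%:E)%E.
  apply: strip_measure2 => // [x y [/sq1/andP[] //]|y].
  have [s hs] := ring_section y e; exists (s - e) => x [].
  by rewrite /A boundary_ringE /= subrK [x ^+ 2 + _]addrC; exact: hs.
have b3 : (mu2 (A `&` h 3%N) <= (2 * e)%:E)%E.
  apply: strip_measure2 => // [x y [/sq1/andP[] //]|y].
  have [s hs] := ring_section y e; exists (- s) => x [].
  rewrite /A boundary_ringE /= [x ^+ 2 + _]addrC => hx x2.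
  by have := hs (- x); rewrite sqrrN => /(_ hx); lra.
have cov : A `<=` ((A `&` h 0%N) `|` (A `&` h 1%N)) `|` ((A `&` h 2%N) `|` (A `&` h 3%N)).
  move=> [x y] Axy; have := Axy; rewrite {1}/A boundary_ringE => /andP[_ h2].
  have [y1|y1] := leP 2^-1 y; first by left; left.
  have [y2|y2] := leP y (- 2^-1); first by left; right.
  have [x1|x1] := leP 2^-1 x; first by right; left.
  have [x2|x2] := leP x (- 2^-1); first by right; right.
  by exfalso; nra.
have half V1 V2 : measurable V1 -> measurable V2 -> (mu2 V1 <= (2 * e)%:E)%E ->
    (mu2 V2 <= (2 * e)%:E)%E -> (mu2 (V1 `|` V2) <= (4 * e)%:E)%E.
  move=> mV1 mV2 h1 h2; apply: le_trans (measureU2 _ mV1 mV2) _.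
  by apply: le_trans (leeD h1 h2) _; rewrite -EFinD lee_fin; lra.
have m01 := measurableU _ _ (mAh 0%N) (mAh 1%N).
have m23 := measurableU _ _ (mAh 2%N) (mAh 3%N).
have l01 := half _ _ (mAh 0%N) (mAh 1%N) b0 b1.
have l23 := half _ _ (mAh 2%N) (mAh 3%N) b2 b3.
have mAll := measurableU _ _ m01 m23.
apply: le_trans (le_measure mu2 (mem_set mA) (mem_set mAll) cov) _.
apply: le_trans (measureU2 _ m01 m23) _; apply: le_trans (leeD l01 l23) _.
by rewrite -EFinD lee_fin; lra.
Qed.

End bergman_weight.

(** * The Bergman spaces *)

Section bergman_space.
Variable R : realType.
Local Notation C := R[i].
Local Notation T := (measurableTypeR R).
Local Notation mu := (@lebesgue_measure R).
Local Notation mu2 := (@lebesgue_measure R \x @lebesgue_measure R)%E.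
Local Notation pt q := (q.1 +i* q.2 : C).
Local Notation disk2 := (@unit_disk2 R).
Implicit Types (alpha : R) (f g : C -> C).

Definition weight alpha (q : T * T) : R := (1 - modulus (pt q) ^+ 2) `^ alpha.

Lemma weight_ge0 alpha q : 0 <= weight alpha q.
Proof. exact: powR_ge0. Qed.

Lemma measurable_weight alpha : measurable_fun setT (weight alpha : T * T -> T).
Proof.
have m1 : measurable_fun setT (fun q : T * T => 1 - modulus (pt q) ^+ 2 : T).
  apply: measurable_funB; first exact: measurable_cst.
  by have := measurable_sqr_dist (0 : C); under eq_fun do rewrite subr0.
exact: (measurableT_comp (@measurable_powR R alpha) m1).
Qed.

Lemma disk2_ring q : disk2 q -> boundary_ring 1 q.
Proof.
rewrite /unit_disk2 /boundary_ring /mkset => q1.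
have q0 := modulus_ge0 (pt q).
by rewrite subr_gt0 expr_lt1// q1 lerBlDr lerDl exprn_ge0.
Qed.

Lemma powR_neg_le (alpha s t : R) : alpha <= 0 -> 0 < s -> s <= t ->
  t `^ alpha <= s `^ alpha.
Proof.
move=> a0 s0 st; rewrite -[alpha]opprK (powRN t (- alpha)) (powRN s (- alpha)).
have t0 := lt_le_trans s0 st.
rewrite lef_pV2 ?posrE ?powR_gt0//.
by apply: ge0_ler_powR; rewrite ?oppr_ge0 ?nnegrE ?(ltW s0) ?(ltW t0).
Qed.

(** For a negative exponent, the weight is at most [(2^-(k+1))^alpha] on the part
    of the ring [1 - |z|^2 <= 2^-k] outside the next ring. The rings have
    measure of order [2^-k], so that the integral is dominated by a geometric
    series of ratio [2^-(alpha+1)]. *)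
Lemma weight_integral alpha : -1 < alpha ->
  exists2 L : R, 0 < L & (\int[mu2]_(q in disk2) (weight alpha q)%:E <= L%:E)%E.
Proof.
move=> alpha1; have mD := @measurable_unit_disk2 R.
have mw : measurable_fun disk2 (fun q => (weight alpha q)%:E).
  by apply/measurable_EFinP; apply: measurable_funTS; exact: measurable_weight.
have [a0|a0] := leP 0 alpha.
  exists (8 * 1); first by rewrite mulr1.
  apply: (@le_trans _ _ (\int[mu2]_(q in disk2) (cst 1%:E) q)%E).
    apply: ge0_le_integral => //; first by move=> q _; rewrite lee_fin weight_ge0.
    move=> q /disk2_ring /andP[q0 q1] /=; rewrite lee_fin.
    rewrite -[leRHS](powRr0 (1 - modulus (pt q) ^+ 2)).
    by apply: ger_powR => //; rewrite q0.
  rewrite integral_cst// mul1e; apply: le_trans (boundary_ring_measure ltr01).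
  apply: le_measure; rewrite ?inE//; first exact: measurable_boundary_ring.
  exact: disk2_ring.
have h0 : 0 < 2^-1 :> R by rewrite invr_gt0.
pose a : R := 2^-1 `^ alpha.
have a00 : 0 < a by rewrite powR_gt0.
pose rho := a / 2.
have rho0 : 0 < rho by rewrite divr_gt0.
have rho1 : rho < 1.
  have -> : rho = 2^-1 `^ (alpha + 1).
    rewrite powRD ?powRr1 ?(ltW h0)//.
    by apply/implyP => _; rewrite gt_eqF.
  suff : 2^-1 `^ (alpha + 1) < 1 `^ (alpha + 1) :> R by rewrite powR1.
  apply: gt0_ltr_powR; rewrite ?nnegrE//.
  - by rewrite -ltrBlDr sub0r.
  - by rewrite invf_lt1// ltr1n.
have aE k : (2^-1 ^+ k.+1) `^ alpha = a ^+ k.+1.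
  by rewrite -[2^-1 ^+ k.+1]powR_mulrn ?(ltW h0)// powRAC powR_mulrn// (ltW a00).
pose u k (q : T * T) : \bar R := ((a ^+ k.+1) * \1_(boundary_ring (2^-1 ^+ k)) q)%:E.
have u0 k q : (0 <= u k q)%E.
  by rewrite lee_fin mulr_ge0// exprn_ge0// ltW.
have mu_ k : measurable_fun setT (u k).
  apply/measurable_EFinP; apply: measurable_funM; first exact: measurable_cst.
  by apply: measurable_indic; exact: measurable_boundary_ring.
have dom q : disk2 q -> ((weight alpha q)%:E <= \sum_(0 <= k <oo) u k q)%E.
  move=> /disk2_ring; rewrite /boundary_ring /mkset /weight.
  set t := 1 - _ => /andP[t0 t1].
  have ex : exists n, 2^-1 ^+ n < t.
    have : (GRing.exp (2^-1 : R) : R^nat) @ \oo --> 0.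
      by apply: cvg_expr; rewrite gtr0_norm// invf_lt1// ltr1n.
    move=> /cvgrPdist_lt/(_ _ t0)[N _ /(_ N (leqnn _))] /=.
    by rewrite sub0r normrN gtr0_norm ?exprn_gt0// => h; exists N.
  (* [k] is the index of the innermost ring containing [q]. *)
  case: (ex_minnP ex) => -[|k] kt kmin; first by move: kt; rewrite expr0 ltNge t1.
  have tk : t <= 2^-1 ^+ k.
    by rewrite leNgt; apply/negP => /kmin; rewrite ltnn.
  apply: (@le_trans _ _ (u k q)).
    rewrite lee_fin indicE mem_set ?mulr1 -?aE.
      by apply: powR_neg_le; [exact: ltW a0|exact: exprn_gt0|exact: ltW kt].
    by rewrite /boundary_ring /mkset -/t t0.
  apply: le_trans (nneseries_lim_ge k.+1 _); last by move=> *; exact: u0.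
  by rewrite big_nat_recr//= leeDr// sume_ge0.
exists (8 * a / (1 - rho)); first by rewrite divr_gt0 ?mulr_gt0// subr_gt0.
apply: (@le_trans _ _ (\int[mu2]_(q in disk2) \sum_(0 <= k <oo) u k q)%E).
  apply: ge0_le_integral => //.
  - by move=> q _; rewrite lee_fin weight_ge0.
  - apply: ge0_emeasurable_sum => k; first by move=> *; exact: u0.
    by move=> _; exact: measurable_funTS.
rewrite integral_nneseries//; last by move=> k; exact: measurable_funTS.
apply: lime_le.
  by apply: is_cvg_nneseries => k _ _; apply: integral_ge0 => q _; exact: u0.
near=> n.
apply: (@le_trans _ _ (\sum_(0 <= k < n) (8 * a * rho ^+ k)%:E)%E).
  apply: lee_sum => k _.
  have mB : measurable (boundary_ring (2^-1 ^+ k) : set (T * T)).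
    exact: measurable_boundary_ring.
  have ak0 : 0 <= a ^+ k.+1 by rewrite exprn_ge0// ltW.
  apply: (@le_trans _ _ (\int[mu2]_q u k q)%E).
    by apply: ge0_subset_integral => // q _; exact: u0.
  rewrite /u; under eq_integral do rewrite EFinM.
  rewrite ge0_integralZl_EFin//; last first.
    by apply/measurable_EFinP; apply: measurable_indic.
  rewrite integral_indic// setIT.
  apply: le_trans (lee_wpmul2l _ (boundary_ring_measure (exprn_gt0 k h0))) _.
    by rewrite lee_fin.
  rewrite -EFinM lee_fin /rho expr_div_n exprVn exprS.
  by rewrite le_eqVlt; apply/orP; left; apply/eqP; ring.
rewrite sumEFin lee_fin -mulr_sumr ler_wpM2l ?mulr_ge0 ?(ltW a00)//.
have r1 : 0 < 1 - rho by rewrite subr_gt0.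
rewrite -[leRHS]mul1r ler_pdivlMr// big_mkord.
have := subrX1 rho n; have := exprn_ge0 n (ltW rho0); lra.
Unshelve. all: by end_near.
Qed.

Lemma bergman_integralE alpha g : bergman_integral alpha g =
  ((pi^-1)%:E * \int[mu2]_(q in disk2)
     (modulus (g (pt q)) ^+ 2 * weight alpha q)%:E)%E.
Proof. by []. Qed.

Lemma measurable_bergman_integrand alpha g : smooth_on_disk g ->
  measurable_fun disk2
    (fun q : T * T => (modulus (g (pt q)) ^+ 2 * weight alpha q)%:E).
Proof.
move=> sg; apply/measurable_EFinP; apply: measurable_funM.
  exact: measurable_sqr_modulus.
by apply: measurable_funTS; exact: measurable_weight.
Qed.

(** [area_submean] on the disk of centre [p] and radius [(1 - |p|) / 2], where
    the weight is at least a power of the radius. *)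
Lemma bergman_growth alpha : -1 < alpha ->
  exists K M, 0 < K /\ growth_bound (@space_norm R alpha) K M.
Proof.
move=> alpha1; pose m := Num.bound `|alpha|.
have am : alpha <= m%:R.
  by apply: le_trans (ler_norm _) _; apply/ltW/archi_boundP.
have ap : 0 < alpha + 1 by rewrite -ltrBlDr sub0r.
(* The constant of [area_submean] is [1 / 16] in terms of the radius
   [(1 - |p|) / 2]. *)
pose k : R := Num.sqrt ((alpha + 1) * pi^-1 / 16).
have k2 : 0 < (alpha + 1) * pi^-1 / 16 by rewrite !mulr_gt0// invr_gt0 pi_gt0.
have k0 : 0 < k by rewrite sqrtr_gt0.
have kE : k ^+ 2 = (alpha + 1) * pi^-1 / 16 by rewrite sqr_sqrtr// ltW.
clearbody k.
exists (2 ^+ m.+1 / k), m.+1; split; first by rewrite divr_gt0// exprn_gt0.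
move=> g e sg; rewrite /space_norm gt_eqF// bergman_integralE => ge p p1.
have p0 := modulus_ge0 p.
have [r rE] : exists r, r = (1 - modulus p) / 2 by exists ((1 - modulus p) / 2).
have r0 : 0 < r by rewrite rE divr_gt0// subr_gt0.
have r1 : r <= 1 by rewrite rE; lra.
have x0 : 0 <= modulus (g p) * r ^+ m.+1 * k.
  apply: mulr_ge0 (ltW k0); apply: mulr_ge0; first exact: modulus_ge0.
  by apply: exprn_ge0; exact: ltW.
suff xe : modulus (g p) * r ^+ m.+1 * k <= e.
  have -> : (1 - modulus p) ^+ m.+1 = r ^+ m.+1 * 2 ^+ m.+1.
    by rewrite -exprMn rE divfK.
  rewrite mulrA.
  have : modulus (g p) * r ^+ m.+1 <= e / k by rewrite ler_pdivlMr.
  have -> : 2 ^+ m.+1 / k * e = e / k * 2 ^+ m.+1 by ring.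
  by move=> h; apply: ler_wpM2r => //; rewrite exprn_ge0.
apply: sqr_le_poweR x0 _ ge.
set B := [set q : T * T | modulus (pt q - p) < r].
have mB : measurable B by apply: measurable_disk; exact: ltW.
have BD : B `<=` disk2.
  move=> q; rewrite /B /unit_disk2 /mkset => qr.
  by have := modulusD (pt q - p) p; rewrite subrK; move: qr; rewrite rE; lra.
have mI := measurable_bergman_integrand alpha sg.
have I0 q : (0 <= (modulus (g (pt q)) ^+ 2 * weight alpha q)%:E)%E.
  by rewrite lee_fin mulr_ge0 ?exprn_ge0 ?modulus_ge0 ?weight_ge0.
have wB q : B q -> r ^+ (2 * m) <= weight alpha q.
  move=> Bq; have q1 := BD _ Bq; have /andP[t0 t1] := disk2_ring q1.
  rewrite /weight; set t := 1 - _ in t0 t1 *.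
  have rt : r <= t.
    move: Bq; rewrite /B /mkset => qr; have := modulusD (pt q - p) p.
    rewrite subrK => h; have q0 := modulus_ge0 (pt q).
    have hq : modulus (pt q) <= 1 - r by move: h qr; rewrite rE; lra.
    rewrite /t expr2; nra.
  apply: (@le_trans _ _ (t ^+ m)).
    apply: (@le_trans _ _ (r ^+ m)).
      by apply: (ler_wiXn2l (ltW r0) r1); rewrite leq_pmull.
    by apply: lerXn2r; rewrite ?nnegrE ?(ltW r0) ?(ltW t0).
  rewrite -powR_mulrn ?(ltW t0)//; apply: ger_powR => //.
  by rewrite t0.
have sub := area_submean sg p1; rewrite -rE -/B in sub.
have intB : ((r ^+ (2 * m))%:E * \int[mu2]_(q in B) (modulus (g (pt q)) ^+ 2)%:E <=
    \int[mu2]_(q in disk2) (modulus (g (pt q)) ^+ 2 * weight alpha q)%:E)%E.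
  have mgB : measurable_fun B (fun q => (modulus (g (pt q)) ^+ 2)%:E).
    apply/measurable_EFinP.
    by apply: measurable_funS (measurable_sqr_modulus sg) => //; exact: measurable_unit_disk2.
  rewrite -ge0_integralZl_EFin//; first last.
  - by rewrite exprn_ge0// ltW.
  - by move=> q _; rewrite lee_fin exprn_ge0 ?modulus_ge0.
  apply: (@le_trans _ _ (\int[mu2]_(q in B) (modulus (g (pt q)) ^+ 2 * weight alpha q)%:E)%E).
    apply: ge0_le_integral => //.
    - by move=> q _; rewrite -EFinM lee_fin mulr_ge0 ?exprn_ge0 ?modulus_ge0 ?(ltW r0).
    - exact: measurable_funeM.
    - by apply: measurable_funS mI => //; exact: measurable_unit_disk2.
    - move=> q Bq; rewrite -EFinM lee_fin mulrC ler_wpM2l ?exprn_ge0 ?modulus_ge0//.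
      exact: wB.
  by apply: ge0_subset_integral => //; exact: measurable_unit_disk2.
have r4 : (1 - modulus p) / 4 = r / 2 by rewrite rE; field.
rewrite r4 in sub.
have rm0 : 0 <= r ^+ (2 * m) by rewrite exprn_ge0// ltW.
have step : ((r ^+ (2 * m) * (modulus (g p) ^+ 2 / 4 * (r / 2) ^+ 2))%:E <=
    \int[mu2]_(q in disk2) (modulus (g (pt q)) ^+ 2 * weight alpha q)%:E)%E.
  by apply: le_trans intB; rewrite EFinM lee_wpmul2l.
have ap0 : 0 <= (alpha + 1) * pi^-1 by rewrite mulr_ge0 ?(ltW ap)// invr_ge0 pi_ge0.
apply: (@le_trans _ _ (((alpha + 1) * pi^-1)%:E *
   (r ^+ (2 * m) * (modulus (g p) ^+ 2 / 4 * (r / 2) ^+ 2))%:E)%E).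
  rewrite -EFinM lee_fin [(_ * k) ^+ 2]exprMn kE [(_ * r ^+ _) ^+ 2]exprMn -exprM.
  have -> : r ^+ (m.+1 * 2) = r ^+ (2 * m) * r ^+ 2.
    by rewrite -exprD mulnC mulnS addnC.
  rewrite [(r / 2) ^+ 2]exprMn.
  have : 0 <= (alpha + 1) * pi^-1 * (r ^+ (2 * m) * (modulus (g p) ^+ 2 * r ^+ 2)).
    by rewrite mulr_ge0// mulr_ge0// mulr_ge0 ?exprn_ge0 ?modulus_ge0 ?(ltW r0).
  rewrite exprVn => h.
  lra.
by rewrite [leRHS]muleA -[((alpha + 1)%:E * (pi^-1)%:E)%E]EFinM lee_wpmul2l.
Qed.

Lemma bergman_contains_bounded alpha : -1 < alpha ->
  exists2 d : R, 0 < d <= 1 &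
    contains_bounded (bergman_space alpha) (space_norm alpha) d.
Proof.
move=> alpha1; have [L L0 hL] := weight_integral alpha1.
have ap : 0 < alpha + 1 by rewrite -ltrBlDr sub0r.
have pi0 : 0 < (pi^-1 : R) by rewrite invr_gt0 pi_gt0.
pose Q := (alpha + 1) * (pi^-1 * L).
have Q0 : 0 < Q by rewrite mulr_gt0// mulr_gt0.
pose d := Num.min 1 Q^-1.
have d0 : 0 < d by rewrite lt_min ltr01 invr_gt0.
have d1 : d <= 1 by rewrite /d ge_min lexx.
have dQ : d * Q <= 1 by rewrite -ler_pdivlMr// mul1r /d ge_min lexx orbT.
exists d; first by rewrite d0.
move=> f sf f0 fd.
have n1 : (space_norm alpha f <= 1)%E.
  rewrite /space_norm gt_eqF// bergman_integralE.
  set I := (\int[mu2]_(q in _) _)%E.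
  have I0 : (0 <= I)%E.
    apply: integral_ge0 => q _.
    by rewrite lee_fin mulr_ge0 ?exprn_ge0 ?modulus_ge0 ?weight_ge0.
  have IL : (I <= (d * L)%:E)%E.
    have mw : measurable_fun disk2 (fun q => (weight alpha q)%:E).
      by apply/measurable_EFinP; apply: measurable_funTS; exact: measurable_weight.
    apply: (@le_trans _ _ (\int[mu2]_(q in disk2) (d%:E * (weight alpha q)%:E))%E).
      have mD := @measurable_unit_disk2 R.
      apply: ge0_le_integral => //.
      - by move=> q _; rewrite lee_fin mulr_ge0 ?exprn_ge0 ?modulus_ge0 ?weight_ge0.
      - exact: measurable_bergman_integrand.
      - exact: measurable_funeM.
      move=> q q1; rewrite -EFinM lee_fin ler_wpM2r ?weight_ge0//.
      have fq := fd (pt q) q1; have f00 := modulus_ge0 (f (pt q)).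
      by rewrite expr2; nra.
    rewrite ge0_integralZl_EFin ?(ltW d0)//; first last.
    - by move=> q _; rewrite lee_fin weight_ge0.
    - exact: measurable_unit_disk2.
    by rewrite EFinM lee_wpmul2l// lee_fin ltW.
  rewrite -[leRHS](poweR1r 2^-1); apply: gt0_ler_poweR.
  - by rewrite invr_ge0.
  - by rewrite in_itv /= leey !mule_ge0 ?lee_fin ?(ltW ap) ?(ltW pi0).
  - by rewrite in_itv /= leey lee01.
  apply: (@le_trans _ _ ((alpha + 1)%:E * (pi^-1%:E * (d * L)%:E))%E).
    by rewrite !lee_wpmul2l ?lee_fin ?(ltW ap) ?(ltW pi0).
  rewrite -!EFinM lee_fin; apply: le_trans dQ.
  by rewrite le_eqVlt; apply/orP; left; apply/eqP; rewrite /Q; ring.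
split=> //; split; [exact/analytic_on_diskP|exact: f0|].
by apply: le_lt_trans n1 _; rewrite ltry.
Qed.

End bergman_space.

(** * Composition operators *)

Section composition.
Variable R : realType.
Local Notation C := R[i].
Implicit Types (phi : C -> C) (a z w : C) (alpha kappa : R).

(** The mean value theorem along the segment from 0 to [z], for the real part of
    [phi] times the conjugate of [phi z - phi 0]. *)
Lemma zero_derivative_const phi : smooth_on_disk phi ->
  (forall z, modulus z < 1 -> tcoef phi z 1 = 0) ->
  forall z, modulus z < 1 -> phi z = phi 0.
Proof.
move=> sphi phi0 z z1; have z0 := modulus_ge0 z.
pose l := (phi z - phi 0)^*%C.
pose f (t : R) : R := complex.Re (l * phi (t%:C * z)).
have tz1 (t : R) : t \in `[0, 1]%R -> modulus (t%:C * z) < 1.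
  rewrite in_itv /= => /andP[t0 t1]; rewrite modulusM modulus_real ger0_norm//.
  by apply: le_lt_trans z1; rewrite ler_piMl.
have df (t : R) : t \in `[0, 1]%R -> is_derive (t : R) (1 : R) f 0.
  move=> t01; have p1 := tz1 t t01; set p := t%:C * z in p1.
  have sp := sphi _ p1.
  have /expandsP[K [d [K0 d0 d1 h]]] := smooth_expands 2 sp.
  suff cv : (fun h : R => h^-1 *: ((f \o shift t) (h *: (1 : R)) - f t)) @ 0^' --> (0 : R).
    by apply: DeriveDef; [apply/cvg_ex; exists 0|exact: cvg_lim cv].
  apply/cvgrPdist_lt => e e0.
  pose L := modulus l * K + 1.
  have L0 : 0 < L by rewrite ltr_wpDl// mulr_ge0 ?modulus_ge0// ltW.
  have dm : 0 < Num.min d (e / L) by rewrite lt_min d0 divr_gt0.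
  near=> u.
  have u0 : u != 0 by near: u; exact: nbhs_dnbhs_neq.
  have : `|u| < Num.min d (e / L).
    by near: u; apply: dnbhs0_lt.
  rewrite lt_min => /andP[ud ue].
  have uz : modulus (u%:C * z) <= `|u|.
    by rewrite modulusM modulus_real ler_piMr// ltW.
  have := h (u%:C * z) (le_lt_trans uz ud).
  rewrite horner_poly !big_ord_recl big_ord0 /= /bump /= phi0// mul0r !addr0 expr0 mulr1 tcoef0// => hu.
  rewrite sub0r normrN normrM normfV mulrC ltr_pdivrMr ?normr_gt0//.
  have -> : f (u *: 1 + t) - f t = complex.Re (l * (phi (p + u%:C * z) - phi p)).
    rewrite /f -ReB -mulrBr; congr (complex.Re (_ * (phi _ - _))).
    by rewrite -[u *: 1]/(u * 1) mulr1 rmorphD mulrDl addrC.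
  apply: le_lt_trans (normRe_le_modulus _) _; rewrite modulusM.
  apply: (@le_lt_trans _ _ (modulus l * (K * `|u| ^+ 2))).
    rewrite ler_wpM2l ?modulus_ge0//; apply: le_trans hu _.
    rewrite ler_pM2l//; apply: lerXn2r; rewrite ?nnegrE ?modulus_ge0//.
  rewrite mulrA expr2 mulrA ltr_pM2r ?normr_gt0//.
  move: ue; rewrite ltr_pdivlMr// /L mulrDr mulr1 => ue.
  by have := normr_gt0 u; rewrite u0 => ?; rewrite mulrC; lra.
have hd (x : R) : x \in `]0, 1[%R -> is_derive x (1 : R) f ((fun=> 0) x).
  by move=> x01; apply: df; move: x01; rewrite !in_itv /= => /andP[/ltW -> /ltW ->].
have hc : {within `[0, 1], continuous f}.
  by apply: derivable_within_continuous => x x01; have [] := df _ x01.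
have [c _] := MVT (@ltr01 R) hd hc.
rewrite mul0r /f mul1r -[(0 : R)%:C]/(0 : C) mul0r -ReB -mulrBr mulrC.
rewrite mul_conj /= => /eqP; rewrite sqrf_eq0 modulus_eq0 subr_eq0 => /eqP //.
Unshelve. all: by end_near.
Qed.

Lemma schur_smooth phi : schur phi -> smooth_on_disk phi.
Proof. by move=> [/analytic_on_diskP]. Qed.

Lemma schur_lt1 phi : schur phi -> forall z, modulus z < 1 -> modulus (phi z) < 1.
Proof. by move=> [_ h _] z /h. Qed.

Lemma schur_derivative phi : schur phi -> exists a, modulus a < 1 /\
  0 < pseudo_hyperbolic_derivative phi a.
Proof.
move=> sphi; have sm := schur_smooth sphi; apply/not_existsP => hn.
case: (sphi) => _ _; apply; exists (phi 0) => z z1.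
apply: zero_derivative_const => // {z1}z z1; apply/eqP; rewrite -modulus_eq0.
apply/eqP; have := hn z; apply: contra_notP => /eqP h; split=> //.
rewrite /pseudo_hyperbolic_derivative derive1_coef; last exact: sm.
rewrite divr_gt0 ?mulr_gt0// ?subr_gt0 ?expr_lt1 ?modulus_ge0//.
  by rewrite lt_neqAle eq_sym h modulus_ge0.
exact: schur_lt1.
Qed.

Lemma composition_lower_bound alpha phi a kappa : -1 <= alpha -> schur phi ->
  modulus a < 1 -> 0 < kappa -> kappa < pseudo_hyperbolic_derivative phi a ->
  exists2 c : R, 0 < c & forall n : nat, (1 <= n)%N ->
    ((c * kappa ^+ (2 * n))%:E <= comp_approx_number alpha phi n)%E.
Proof.
move=> alpha1 sphi a1 kappa0 ka.
have s0 := lt_trans kappa0 ka.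
have Hs f : bergman_space alpha f -> smooth_on_disk f.
  by move=> [/analytic_on_diskP].
have sm := schur_smooth sphi; have p1 := schur_lt1 sphi.
have [E|E] := eqVneq alpha (-1).
  have g : growth_bound (space_norm alpha) (1 : R) 1.
    move=> g e sg ge z z1; apply: hardy_growth => //.
    by move: ge; rewrite /space_norm E eqxx.
  have b : contains_bounded (bergman_space alpha) (space_norm alpha) (1 : R).
    by rewrite E; exact: hardy_contains_bounded.
  apply: (approx_number_lower_bound sm a1 p1 s0 ltr01 _ Hs g b) => //.
  by rewrite ltr01 lexx.
have {}alpha1 : -1 < alpha by rewrite lt_neqAle eq_sym E.
have [K [M [K0 g]]] := bergman_growth alpha1.
have [d d01 b] := bergman_contains_bounded alpha1.
exact: (approx_number_lower_bound sm a1 p1 s0 K0 d01 Hs g b).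
Qed.

Lemma limn_einf_ge (u : (\bar R)^nat) (x : \bar R) N :
  (forall n, (N <= n)%N -> (x <= u n)%E) -> (x <= limn_einf u)%E.
Proof.
move=> h; rewrite limn_einf_lim.
have -> : limn (einfs u) = ereal_sup (range (einfs u)).
  by apply: cvg_lim; [exact: ereal_hausdorff|exact: cvg_einfs_sup].
apply: (@le_trans _ _ (einfs u N)); last by apply: ereal_sup_ubound; exists N.
by apply: le_ereal_inf_tmp => _ [n /= Nn <-]; exact: h.
Qed.

Lemma rate_ge (u : (\bar R)^nat) (c kappa kappa' : R) : 0 < c -> 0 < kappa ->
  kappa < kappa' ->
  (forall n, (1 <= n)%N -> ((c * kappa' ^+ (2 * n))%:E <= u n)%E) ->
  ((kappa ^+ 2)%:E <= limn_einf (fun n => u n `^ n%:R^-1))%E.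
Proof.
move=> c0 k0 kk hu; have k'0 := lt_trans k0 kk.
pose x := (kappa / kappa') ^+ 2.
have kk0 : 0 < kappa / kappa' by rewrite divr_gt0.
have x0 : 0 < x by rewrite exprn_gt0.
have x1 : x < 1 by rewrite /x expr_lt1// ?(ltW kk0)// ltr_pdivrMr// mul1r.
have : (GRing.exp x : R^nat) @ \oo --> 0 by apply: cvg_expr; rewrite gtr0_norm.
move=> /cvgrPdist_lt/(_ _ c0)[N _ hN].
apply: (@limn_einf_ge _ _ N.+1) => n Nn.
have n0 : (0 < n)%N by exact: leq_ltn_trans Nn.
have := hN n (ltnW Nn) => /=; rewrite sub0r normrN gtr0_norm ?exprn_gt0// => hx.
have kn : (((kappa ^+ 2) ^+ n)%:E <= u n)%E.
  apply: le_trans (hu n n0); rewrite lee_fin.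
  have -> : (kappa ^+ 2) ^+ n = x ^+ n * kappa' ^+ (2 * n).
    by rewrite exprM -exprMn /x -exprMn divfK// gt_eqF.
  by rewrite ler_wpM2r ?exprn_ge0// ltW.
have -> : ((kappa ^+ 2)%:E = ((kappa ^+ 2) ^+ n)%:E `^ n%:R^-1)%E.
  have k20 : 0 <= kappa ^+ 2 by rewrite exprn_ge0// ltW.
  rewrite poweR_EFin -[(_ ^+ 2) ^+ n]powR_mulrn// -powRrM divff ?powRr1//.
  by rewrite pnatr_eq0 -lt0n.
apply: gt0_ler_poweR => //.
- by rewrite in_itv /= leey lee_fin !exprn_ge0// ltW.
- rewrite in_itv /= leey andbT; apply: le_trans kn.
  by rewrite lee_fin !exprn_ge0// ltW.
Qed.

End composition.

Theorem theorem3p1 (R : realType) (alpha : R) (phi : R[i] -> R[i])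
    (halpha : -1 <= alpha) (hphi : schur phi) :
  [/\ exists c r : R, [/\ 0 < c, 0 < r < 1 &
        forall n : nat, (1 <= n)%N ->
          ((c * r ^+ n)%:E <= comp_approx_number alpha phi n)%E],
      (pseudo_hyperbolic_sup phi ^+ 2 <= comp_approx_rate alpha phi)%E
    & forall kappa : R, 0 < kappa ->
        (kappa%:E < pseudo_hyperbolic_sup phi)%E ->
        exists2 c : R, 0 < c &
          forall n : nat, (1 <= n)%N ->
            ((c * kappa ^+ (2 * n))%:E <= comp_approx_number alpha phi n)%E].
Proof.
have sm := schur_smooth hphi; have p1 := schur_lt1 hphi.
have le1 z : Normc.normc z < 1 -> pseudo_hyperbolic_derivative phi z <= 1.
  by move=> z1; exact: pseudo_hyperbolic_derivative_le1.
have third (kappa : R) : 0 < kappa -> (kappa%:E < pseudo_hyperbolic_sup phi)%E ->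
    exists2 c : R, 0 < c & forall n : nat, (1 <= n)%N ->
      ((c * kappa ^+ (2 * n))%:E <= comp_approx_number alpha phi n)%E.
  move=> kappa0 /ereal_sup_gt[_ [a a1 <-]]; rewrite lte_fin => ka.
  exact: composition_lower_bound ka.
have [a [a1 sa0]] := schur_derivative hphi.
have supa : ((pseudo_hyperbolic_derivative phi a)%:E <= pseudo_hyperbolic_sup phi)%E.
  by apply: ereal_sup_ubound; exists a.
have sup1 : (pseudo_hyperbolic_sup phi <= 1%:E)%E.
  by apply: ge_ereal_sup => _ [z z1 <-]; rewrite lee_fin; exact: le1.
split=> //.
- pose kappa := pseudo_hyperbolic_derivative phi a / 2.
  have kappa0 : 0 < kappa by rewrite divr_gt0.
  have sa1 := le1 a a1.
  have ka : kappa < pseudo_hyperbolic_derivative phi a by rewrite /kappa; lra.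
  have [c c0 hc] := composition_lower_bound halpha hphi a1 kappa0 ka.
  exists c, (kappa ^+ 2); split=> // [|n n1]; last by rewrite -exprM; exact: hc.
  by rewrite exprn_gt0//= expr_lt1 ?(ltW kappa0)//; lra.
have rate (kappa : R) : 0 < kappa -> (kappa%:E < pseudo_hyperbolic_sup phi)%E ->
    ((kappa ^+ 2)%:E <= comp_approx_rate alpha phi)%E.
  move=> kappa0 /ereal_sup_gt[_ [b b1 <-]]; rewrite lte_fin => kb.
  pose kappa' := (kappa + pseudo_hyperbolic_derivative phi b) / 2.
  have k1 : kappa < kappa' by rewrite /kappa'; lra.
  have k2 : kappa' < pseudo_hyperbolic_derivative phi b by rewrite /kappa'; lra.
  have [c c0 hc] := composition_lower_bound halpha hphi b1 (lt_trans kappa0 k1) k2.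
  exact: rate_ge c0 kappa0 k1 hc.
move: rate supa sup1; case: (pseudo_hyperbolic_sup phi) => [s||] rate //.
rewrite !lee_fin => sas s1; have s0 := lt_le_trans sa0 sas.
rewrite -EFin_expe leNgt; apply/negP => Ls.
have half := rate (s / 2); rewrite lte_fin in half.
have {}half : (((s / 2) ^+ 2)%:E <= comp_approx_rate alpha phi)%E.
  by apply: half; lra.
case: (comp_approx_rate alpha phi) Ls rate half => [l||] //; rewrite !(lte_fin, lee_fin).
move=> ls rate hl.
have l0 : 0 <= l by apply: le_trans hl; rewrite sqr_ge0.
pose t := Num.sqrt l; have t0 : 0 <= t by exact: sqrtr_ge0.
have tE : t ^+ 2 = l by exact: sqr_sqrtr.
have ts : t < s by rewrite -(@ltr_pXn2r _ 2) ?nnegrE ?(ltW s0)// tE.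
have := rate ((t + s) / 2); rewrite lte_fin lee_fin => h.
have {}h : ((t + s) / 2) ^+ 2 <= l by apply: h; lra.
by move: h; rewrite -tE expr2 expr2; nra.
Qed.
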